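(* Let $1<p<\infty$, let $f\in\mathbb{C}[z]$ satisfy $f(0)\ne0$, let $\alpha\in(0,1)\setminus\mathbb{Q}$, and let $(p_n/q_n)$ be the continued-fraction convergents of $\alpha$. If for arbitrarily large $n$ (i.e. for every $N$ there is $n\ge N$) one has $$q_{n+1}>\psi_{f,p}(q_n),$$ then $f$ (restricted to $[0,1]$) is cyclic for the Bishop operator $T_\alpha$ on $L^p[0,1]$.
   Context: $L^p[0,1]$ is the complex space. For $\alpha\in(0,1)$ the Bishop operator is $(T_\alpha f)(t)=t\,f(\{t+\alpha\})$, where $\{\cdot\}$ is the fractional part. A vector $f\in L^p[0,1]$ is cyclic for $T_\alpha$ if the closed linear span of $\{T_\alpha^n f:n\ge0\}$ is $L^p[0,1]$. Write $f(z)=\sum_{\nu=0}^m a_\nu z^\nu$ with $a_0\ne0$ and $a_m\neq0$ ($m\ge0$ the degree). The function $\psi_{f,p}:\{1,2,3,\dots\}\to(0,\infty)$ is defined as follows ($\log$ is the natural logarithm, $\mathrm e=\exp(1)$). Put $$B_0=\sum_{\nu=0}^m|a_\nu|,\qquad B_1=\sum_{\nu=1}^m\nu|a_\nu|,\qquad A_{f,p}=2^{1/p}B_0+\bigl(B_1^p+(2B_0)^p\bigr)^{1/p}.$$ For every integer $q\ge2$ put $$s_q=\frac{q(q-1)}2,\quad \ell_q=\frac{(q-1)(q-2)}2,\quad \varepsilon_q=\frac1{q+1},\quad W_q=\frac{q!}{q^q},\quad a_q=\frac{\varepsilon_q^p}{8q},\quad \Gamma_q=3+\frac4{W_q}$$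 (here $a_q$ is this cutoff parameter, not a coefficient of $f$), and $$\kappa_{f,q}=qm+\ell_q,\qquad b_{f,q}=|a_0|^q q^{-s_q},\qquad \eta_{f,q}=\frac{b_{f,q}}2\left(\frac{\varepsilon_q^p}{8}\right)^{\kappa_{f,q}},\qquad J_{f,q}=qB_0+B_1,$$ where $a_0=f(0)$ is the constant coefficient of $f$; $$U_{f,q}=q!\,B_0^{q-1},\qquad R_{f,q}=q!\,q\,J_{f,q}B_0^{q-1},\qquad V_{f,q}=q!\left((q-1)J_{f,q}B_0^{q-2}+\pi qB_0^{q-1}\right),\qquad H_{f,q}=\frac{U_{f,q}}{\eta_{f,q}},$$ $$L_{f,q}=\frac{H_{f,q}}{a_q}+\frac{V_{f,q}}{\eta_{f,q}}+\frac{2U_{f,q}R_{f,q}}{\eta_{f,q}^2}\quad(\text{with } a_q=\varepsilon_q^p/(8q)),$$ $$\Lambda_{f,q}=\max\left\{1,\frac{\pi qB_0L_{f,q}}{\varepsilon_q}\right\},\qquad N_{f,q}=\left\lceil4\Lambda_{f,q}\log(4\Lambda_{f,q}+\mathrm e)\right\rceil,\qquad d_{f,q}=qN_{f,q}+q-1,$$ $$C_{f,q}=3qH_{f,q}N_{f,q}\Gamma_q^{N_{f,q}},\qquad \delta_{f,q}=\min\left\{\frac1{2d_{f,q}},\ \frac{\varepsilon_q^p}{2A_{f,p}^pC_{f,q}^pd_{f,q}^{p+1}}\right\}.$$ Then $\psi_{f,p}(1)=1$ and $\psi_{f,p}(q)=\dfrac1{q\,\delta_{f,q}}$ for $q\ge2$.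 *)

(* Defs.v *)
From HB Require Import structures.
From mathcomp Require Import all_boot all_order all_algebra.
From mathcomp Require Import all_classical all_reals all_analysis.
From mathcomp Require Import complex.
Set Implicit Arguments.
Unset Strict Implicit.
Unset Printing Implicit Defensive.
Import Order.TTheory GRing.Theory Num.Theory.
Import numFieldNormedType.Exports.
Import ComplexField.
Local Open Scope classical_set_scope.
Local Open Scope complex_scope.
Local Open Scope ring_scope.

(* Normc.normc : R[i] -> R is the modulus, whereas `|z| lives in R[i]. *)

Definition frac (R : realType) (x : R) : R := x - (Num.floor x)%:~R.

Section ComplexLp.
Variable R : realType.
Implicit Types (p : R) (g h : R -> R[i]) (S : set (R -> R[i])).

(* Vectors of L^p[0,1] are handled through representatives R -> R[i]; only the
   values on [0,1] matter, and two representatives are identified when their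
   Lp_norm distance is 0 (equality almost everywhere on [0,1]). *)
Definition Lp_norm p g : \bar R :=
  Lnorm (@lebesgue_measure R) p%:E
    ((fun t => (Normc.normc (g t))%:E) \_ `[0%R : R, 1%R]).

Definition Lp p : set (R -> R[i]) :=
  [set g | [/\ measurable_fun `[0%R : R, 1%R] (fun t => complex.Re (g t)),
               measurable_fun `[0%R : R, 1%R] (fun t => complex.Im (g t)) &
               (Lp_norm p g < +oo)%E]].

Definition linear_span S : set (R -> R[i]) :=
  [set g | exists n (c : 'I_n -> R[i]) (h : 'I_n -> R -> R[i]),
     (forall i, S (h i)) /\ g = (fun t => \sum_(i < n) c i * h i t)].

Definition Lp_closure p S : set (R -> R[i]) :=
  [set g | Lp p g /\
     forall e : R, 0 < e ->
       exists2 h, S h & (Lp_norm p (fun t => (g t - h t)%R) < e%:E)%E].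

Definition orbit (T : (R -> R[i]) -> R -> R[i]) g : set (R -> R[i]) :=
  [set iter n T g | n in [set: nat]].

Definition cyclic_vector p (T : (R -> R[i]) -> R -> R[i]) g : Prop :=
  Lp p g /\ Lp_closure p (linear_span (orbit T g)) = Lp p.

Definition bishop (alpha : R) g : R -> R[i] :=
  fun t => t%:C * g (frac (t + alpha)).

End ComplexLp.

Section ContinuedFraction.
Variable R : realType.
Implicit Types alpha : R.

Fixpoint complete_quotient alpha n : R :=
  if n is k.+1 then (frac (complete_quotient alpha k))^-1 else alpha.

(* Truncation is the floor here: every complete quotient of an irrational
   alpha > 0 is positive. *)
Definition partial_quotient alpha n : nat :=
  Num.truncn (complete_quotient alpha n).

(* ((p_(n-1), q_(n-1)), (p_n, q_n)), with (p_(-1), q_(-1)) = (1, 0). *)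
Fixpoint convergent_pair alpha n : (nat * nat) * (nat * nat) :=
  if n is k.+1 then
    let: (u, v) := convergent_pair alpha k in
    let a := partial_quotient alpha n in
    (v, (a * v.1 + u.1, a * v.2 + u.2)%N)
  else ((1, 0), (partial_quotient alpha 0, 1))%N.

Definition convergent alpha n : nat * nat := (convergent_pair alpha n).2.

End ContinuedFraction.

Section Psi.
Variables (R : realType) (f : {poly R[i]}) (p : R).
Implicit Type q : nat.

Definition B0 : R := \sum_(0 <= i < size f) Normc.normc f`_i.
Definition B1 : R := \sum_(1 <= i < size f) i%:R * Normc.normc f`_i.
Definition A_ : R :=
  2 `^ p^-1 * B0 + (B1 `^ p + (2 * B0) `^ p) `^ p^-1.

Definition s_ q : nat := (q * (q - 1) %/ 2)%N.
Definition ell_ q : nat := ((q - 1) * (q - 2) %/ 2)%N.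
Definition eps_ q : R := 1 / (q.+1)%:R.
Definition W_ q : R := q`!%:R / q%:R ^+ q.
Definition cutoff_ q : R := eps_ q `^ p / (8 * q%:R).
Definition Gamma_ q : R := 3 + 4 / W_ q.

(* The degree of f is (size f).-1. *)
Definition kappa_ q : nat := (q * (size f).-1 + ell_ q)%N.
Definition b_ q : R := Normc.normc f`_0 ^+ q * q%:R ^- s_ q.
Definition eta_ q : R := b_ q / 2 * (eps_ q `^ p / 8) ^+ kappa_ q.
Definition J_ q : R := q%:R * B0 + B1.

Definition U_ q : R := q`!%:R * B0 ^+ (q - 1).
Definition R_ q : R := q`!%:R * q%:R * J_ q * B0 ^+ (q - 1).
Definition V_ q : R :=
  q`!%:R * ((q - 1)%:R * J_ q * B0 ^+ (q - 2) + pi * q%:R * B0 ^+ (q - 1)).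
Definition H_ q : R := U_ q / eta_ q.
Definition L_ q : R :=
  H_ q / cutoff_ q + V_ q / eta_ q + 2 * U_ q * R_ q / eta_ q ^+ 2.
Definition Lambda_ q : R := Num.max 1 (pi * q%:R * B0 * L_ q / eps_ q).
Definition N_ q : nat :=
  `|Num.ceil (4 * Lambda_ q * ln (4 * Lambda_ q + expR 1))|%N.
Definition d_ q : nat := (q * N_ q + q - 1)%N.
Definition C_ q : R := 3 * q%:R * H_ q * (N_ q)%:R * Gamma_ q ^+ N_ q.
Definition delta_ q : R :=
  Num.min (1 / (2 * (d_ q)%:R))
          (eps_ q `^ p / (2 * A_ `^ p * C_ q `^ p * (d_ q)%:R `^ (p + 1))).

(* Only the values at q >= 1 are meaningful. *)
Definition psi q : R := if q == 1%N then 1 else 1 / (q%:R * delta_ q).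

End Psi.

(* Main.v *)
(* A rational approximation r/q of alpha makes the Bishop operator almost periodic: on
   the cell i/q + [0, 1/q) the q-th power of T_(r/q) is multiplication by the monotone
   function w(s) = prod_j (s + j/q).  Solving the q x q linear system with matrix
   M(s) = (T^k f (s + j/q)) expresses any target polynomial P as sum_k c_k(s) T^k f, and
   D = det M is a polynomial with |D(0)| >= |f(0)|^q q^(-q(q-1)/2), so D is small only
   on a set of small measure.  Replacing 1/D by the Lipschitz function
   conj D / (|D|^2 + e^2) and each c_k by a Bernstein polynomial in w / W_q, one obtains a
   polynomial in T_(r/q), hence in T_alpha when alpha is close enough to r/q, that sends
   f close to P.  Bernstein polynomials of degree N_q approximate c_k only to order
   (Lipschitz constant) / sqrt N_q; since p > 1, e can be chosen much larger than
   sqrt eta_q, which makes this error small.  Density of polynomials in L^p concludes. *)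

(* The numbers [N_], [d_], [C_] and [delta_] are prescribed, so the construction has to fit inside
   them. For large q the polynomials f and P only cost factors q^O(q), while the small quantities
   have size q^(-c q^2), so only the constants c compete. The degree of D is at most k, of order
   q^2. With theta = q^rho, the condition e theta^(2k) <= b_q makes the regularization error
   O(1/theta) in the mean; this slow decay suffices because P is fixed while q grows. So e may have
   exponent c = 1/2 + 2 rho, whereas eta_q has c at least (1 + p)/2. Since N_q is at least q^(-O(q))
   / eta_q^2, the Bernstein error is at most q^O(q) eta_q / e^2, and it tends to 0 once 1 + 4 rho <
   (1 + p)/2. Such a rho > 0 exists because p > 1. Taking e of the size of eta_q itself would make
   this estimate useless. *)
Require Import Defs.
From mathcomp Require Import all_boot all_order all_algebra all_fingroup.
From mathcomp Require Import all_classical all_reals all_analysis.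
From mathcomp Require Import measurable_realfun complex.
From mathcomp Require Import ring lra zify.
Set Implicit Arguments.
Unset Strict Implicit.
Unset Printing Implicit Defensive.
Import Order.TTheory GRing.Theory Num.Theory.
Import numFieldNormedType.Exports.
Local Notation frac := Defs.frac.
Local Open Scope complex_scope.
Local Open Scope ring_scope.

(** * Continued fractions *)

Section Frac.
Variable R : realType.
Implicit Types x y : R.

Lemma frac_ge0 x : 0 <= frac x.
Proof. by rewrite /frac subr_ge0 floor_le. Qed.

Lemma frac_lt1 x : frac x < 1.
Proof. by have := floorD1_gt x; rewrite /frac intrD; lra. Qed.

Lemma frac_unique x y (m : int) : x = m%:~R + y -> 0 <= y -> y < 1 -> frac x = y.
Proof.
move=> -> y0 y1; rewrite /frac (@floor_def _ _ m); first by lra.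
by rewrite intrD; apply/andP; split; lra.
Qed.

Lemma frac_id x : 0 <= x -> x < 1 -> frac x = x.
Proof. by move=> x0 x1; apply: (@frac_unique _ _ 0); rewrite ?add0r. Qed.

Lemma frac_fracD x y : frac (frac x + y) = frac (x + y).
Proof.
apply: (@frac_unique _ _ (Num.floor (x + y) - Num.floor x)).
- by rewrite /frac intrB; lra.
- exact: frac_ge0.
- exact: frac_lt1.
Qed.

Lemma frac_gt0 x : irrational x -> 0 < frac x.
Proof.
move=> xirr; rewrite lt_def frac_ge0 andbT; apply/eqP => x0; apply: xirr.
exists (Num.floor x)%:~R => //; rewrite ratr_int.
by move: x0; rewrite /frac; lra.
Qed.

Lemma irrational_frac x : irrational x -> irrational (frac x).
Proof.
move=> xirr [r _ rx]; apply: xirr; exists (r + (Num.floor x)%:~R) => //.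
by rewrite rmorphD /= ratr_int rx /frac; lra.
Qed.

Lemma irrational_inv x : irrational x -> irrational x^-1.
Proof.
by move=> xirr [r _ rx]; apply: xirr; exists r^-1; rewrite // fmorphV /= rx invrK.
Qed.

End Frac.

Section ConvergentTheory.
Variables (R : realType) (alpha : R).
Hypotheses (alpha_gt0 : 0 < alpha) (alpha_irr : irrational alpha).
Notation x_ := (complete_quotient alpha).
Notation a_ := (partial_quotient alpha).

Lemma irrational_complete_quotient n : irrational (x_ n).
Proof. by elim: n => //= n IH; apply/irrational_inv/irrational_frac. Qed.

Lemma complete_quotient_gt1 n : 1 < x_ n.+1.
Proof.
have h := frac_gt0 (@irrational_complete_quotient n).
by rewrite /= invf_gt1 // frac_lt1.
Qed.

Lemma complete_quotient_gt0 n : 0 < x_ n.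
Proof. by case: n => // n; apply: lt_trans (complete_quotient_gt1 n). Qed.

Lemma partial_quotient_le n : (a_ n)%:R <= x_ n.
Proof. by rewrite truncn_le ltW // complete_quotient_gt0. Qed.

Lemma partial_quotient_gt0 n : (0 < a_ n.+1)%N.
Proof. by rewrite truncn_gt0 ltW // complete_quotient_gt1. Qed.

Lemma complete_quotientE n : x_ n * x_ n.+1 = (a_ n)%:R * x_ n.+1 + 1.
Proof.
have h := frac_gt0 (@irrational_complete_quotient n).
have -> : (a_ n)%:R = (Num.floor (x_ n))%:~R :> R.
  rewrite /partial_quotient truncn_floor ltW ?complete_quotient_gt0 //.
  by rewrite -{2}(@gez0_abs (Num.floor _)) // floor_ge0 ltW // complete_quotient_gt0.
have -> : x_ n = (Num.floor (x_ n))%:~R + frac (x_ n) by rewrite /frac; lra.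
rewrite [x_ n.+1]/= mulrDl mulfV ?gt_eqF //.
by congr (_ * _ + _); congr (_%:~R); congr Num.floor; rewrite /frac; lra.
Qed.

Lemma convergent_pairS n : (convergent_pair alpha n.+1).1 = convergent alpha n.
Proof. by rewrite /convergent /=; case: (convergent_pair alpha n). Qed.

Lemma convergent_recE n : convergent alpha n.+1 =
  (a_ n.+1 * (convergent alpha n).1 + (convergent_pair alpha n).1.1,
   a_ n.+1 * (convergent alpha n).2 + (convergent_pair alpha n).1.2)%N.
Proof. by rewrite /convergent /=; case: (convergent_pair alpha n). Qed.

(** This is alpha = (x p_n + p_(n-1)) / (x q_n + q_(n-1)), x being the next complete quotient, with
    denominators cleared. The induction step multiplies by the following quotient and uses
    [complete_quotientE]. *)
Lemma convergent_alpha n :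
  alpha * (x_ n.+1 * (convergent alpha n).2%:R + (convergent_pair alpha n).1.2%:R)
  = x_ n.+1 * (convergent alpha n).1%:R + (convergent_pair alpha n).1.1%:R.
Proof.
elim: n => [|n IH].
  by have := complete_quotientE 0; rewrite /convergent /=; lra.
have e := complete_quotientE n.+1; move: IH; rewrite convergent_recE convergent_pairS.
set p := (convergent alpha n).1; set q := (convergent alpha n).2.
set p' := (convergent_pair alpha n).1.1; set q' := (convergent_pair alpha n).1.2.
rewrite !natrD !natrM; move: e; set x := x_ n.+1; set y := x_ n.+2; set a := a_ n.+1.
move=> e IH.
have y0 : y != 0 by rewrite gt_eqF // complete_quotient_gt0.
have /(mulIf y0) : alpha * (x * q%:R + q'%:R) * y = (x * p%:R + p'%:R) * y by rewrite IH.
have -> : (y * (a%:R * p%:R + p'%:R) + p%:R) = (x * p%:R + p'%:R) * y.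
  by rewrite mulrDl mulrAC e; ring.
rewrite -IH => _; rewrite -mulrA; congr (_ * _).
by rewrite mulrDl mulrAC e; ring.
Qed.

(** The recursion only flips the sign of p_n q_(n-1) - p_(n-1) q_n; the absolute value avoids
    tracking it. *)
Lemma convergent_det n :
  `|(convergent alpha n).1%:Z * (convergent_pair alpha n).1.2%:Z
    - (convergent_pair alpha n).1.1%:Z * (convergent alpha n).2%:Z| = 1.
Proof.
elim: n => [|n IH]; first by rewrite /convergent /=; lia.
by rewrite -IH convergent_recE convergent_pairS !PoszD !PoszM -normrN; congr `|_|; ring.
Qed.

Lemma convergent_coprime n :
  coprime (convergent alpha n).1 (convergent alpha n).2.
Proof.
have := convergent_det n; move: (convergent_pair _ _).1 (convergent _ _).
move=> [p' q'] [p q] /=; rewrite /coprime; set g := gcdn p q => det.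
have /dvdnP [k pE] : (g %| p)%N by exact: dvdn_gcdl.
have /dvdnP [l qE] : (g %| q)%N by exact: dvdn_gcdr.
rewrite -dvdn1; clearbody g; have -> : 1%N = absz (p%:Z * q'%:Z - p'%:Z * q%:Z)%R by lia.
apply/dvdnP; exists (absz (k%:Z * q'%:Z - p'%:Z * l%:Z)%R).
rewrite pE qE !PoszM.
have -> : k%:Z * g%:Z * q'%:Z - p'%:Z * (l%:Z * g%:Z) = (k%:Z * q'%:Z - p'%:Z * l%:Z) * g%:Z by ring.
by rewrite abszM absz_nat.
Qed.

Lemma convergent_gt0 n : (0 < (convergent alpha n).2)%N.
Proof.
elim: n => // n IH; rewrite convergent_recE /=.
by rewrite addn_gt0 muln_gt0 partial_quotient_gt0 IH.
Qed.

(** Guarantees that a gap at a late index occurs at a large denominator. The induction looks two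
    steps back, since q_0 = q_1 = 1 may happen and strict growth starts at index 2. *)
Lemma convergent_ge n : (n <= (convergent alpha n).2)%N.
Proof.
elim/ltn_ind: n => -[|[|n]] IH //; first exact: convergent_gt0.
have h1 := IH n.+1 (leqnn _); have h2 := convergent_gt0 n.
have h3 := partial_quotient_gt0 n.+1.
rewrite convergent_recE convergent_pairS /=.
move: h1 h2 h3; move: (convergent alpha n.+1).2 (convergent alpha n).2 (a_ n.+2).
move=> u v w h1 h2 h3; have : (1 * u <= w * u)%N by rewrite leq_mul2r h3 orbT.
by move: (w * u)%N => z; lia.
Qed.

(** The distance is exactly 1 / (q_n (x q_n + q_(n-1))) by [convergent_alpha] and [convergent_det],
    and x is at least the partial quotient that enters q_(n+1). *)
Lemma convergent_approx n :
  `|alpha - (convergent alpha n).1%:R / (convergent alpha n).2%:R|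
  <= ((convergent alpha n).2%:R * (convergent alpha n.+1).2%:R)^-1.
Proof.
have q0 := convergent_gt0 n; have q1 := convergent_gt0 n.+1.
have x0 := complete_quotient_gt0 n.+1.
have le_a := partial_quotient_le n.+1.
have eA := convergent_alpha n; have := convergent_det n.
move: eA q0 q1; rewrite convergent_recE.
move: (x_ n.+1) (a_ n.+1) x0 le_a => x a x0 le_a.
move: (convergent_pair _ _).1 (convergent _ _) => [p' q'] [p q] /= eA q0 q1 det.
have det' : `|p%:R * q'%:R - p'%:R * q%:R| = 1 :> R.
  by have := congr1 (fun z : int => z%:~R : R) det; rewrite intr_norm rmorphB /= !rmorphM.
have qR : 0 < q%:R :> R by rewrite ltr0n.
have q'R : 0 <= q'%:R :> R by rewrite ler0n.
have D0 : 0 < x * q%:R + q'%:R by rewrite ltr_wpDr // mulr_gt0.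
have -> : alpha = (x * p%:R + p'%:R) / (x * q%:R + q'%:R).
  by rewrite -eA mulfK ?gt_eqF.
have -> : (x * p%:R + p'%:R) / (x * q%:R + q'%:R) - p%:R / q%:R
   = - (p%:R * q'%:R - p'%:R * q%:R) / (q%:R * (x * q%:R + q'%:R)).
  by field; rewrite !gt_eqF.
rewrite normrM normrN det' mul1r normfV gtr0_norm ?mulr_gt0 //.
rewrite lef_pV2 ?posrE ?mulr_gt0 ?ltr0n //.
rewrite ler_pM2l // natrD natrM lerD2r ler_pM2r //.
Qed.

End ConvergentTheory.

Local Notation normc := Normc.normc.

(** * Complex moduli, coefficient norms and Bernstein polynomials *)

Section Modulus.
Variable R : realType.
Implicit Types x y z : R[i].

Lemma normcE z : (normc z)%:C = `|z|. Proof. by []. Qed.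

Lemma normc_ge0 z : 0 <= normc z.
Proof. by rewrite -lecR normcE rmorph0 normr_ge0. Qed.

Lemma ler_normcD x y : normc (x + y) <= normc x + normc y.
Proof. by rewrite -lecR rmorphD /= !normcE ler_normD. Qed.

Lemma normcN x : normc (- x) = normc x.
Proof. by apply: complexI; rewrite !normcE normrN. Qed.

Lemma normcBC x y : normc (x - y) = normc (y - x).
Proof. by rewrite -normcN opprB. Qed.

Lemma ler_normcB x y : normc (x - y) <= normc x + normc y.
Proof. by rewrite -(normcN y) ler_normcD. Qed.

Lemma lerB_normc x y : normc x - normc y <= normc (x - y).
Proof. by rewrite lerBlDr -{1}(subrK y x) ler_normcD. Qed.

Lemma ler_normc_distD z x y : normc (x - y) <= normc (x - z) + normc (z - y).
Proof. by rewrite -(subrKA z x) ler_normcD. Qed.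

Lemma normc_real (x : R) : normc x%:C = `|x|.
Proof. by rewrite /= expr0n addr0 sqrtr_sqr. Qed.

Lemma normc_conj z : normc z^*%C = normc z.
Proof. by case: z => a b /=; rewrite sqrrN. Qed.

Lemma mul_conjc z : z * z^*%C = ((normc z) ^+ 2)%:C.
Proof.
case: z => a b /=; rewrite sqr_sqrtr ?addr_ge0 ?sqr_ge0 //.
by apply/eqP; rewrite eq_complex /=; apply/andP; split; apply/eqP; ring.
Qed.

Lemma normcX z n : normc (z ^+ n) = normc z ^+ n.
Proof.
elim: n => [|n IH]; first by rewrite !expr0 Normc.normc1.
by rewrite !exprS Normc.normcM IH.
Qed.

Lemma normc_prod (I : Type) (s : seq I) (P : pred I) (F : I -> R[i]) :
  normc (\prod_(i <- s | P i) F i) = \prod_(i <- s | P i) normc (F i).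
Proof. by apply: (big_morph _ (@Normc.normcM _)); rewrite Normc.normc1. Qed.

Lemma ler_normc_sum (I : Type) (s : seq I) (P : pred I) (F : I -> R[i]) :
  normc (\sum_(i <- s | P i) F i) <= \sum_(i <- s | P i) normc (F i).
Proof.
elim/big_rec2: _ => [|i y x _ le_xy]; first by rewrite Normc.normc0.
by rewrite (le_trans (ler_normcD _ _)) // lerD2l.
Qed.

Lemma normc_natr n : normc (n%:R : R[i]) = n%:R.
Proof. by rewrite -(rmorph_nat (real_complex R)) normc_real normr_nat. Qed.

End Modulus.

Section CoefNorm.
Variable R : realType.
Implicit Types P Q : {poly R[i]}.

(** The Wiener norm: submultiplicative, and a bound for the modulus on the closed unit disc. [B0 f]
    is this norm of f, and [B1 f] that of its derivative. *)
Definition coef_norm P : R := \sum_(i < size P) normc P`_i.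

Lemma coef_norm_widen P n : (size P <= n)%N ->
  coef_norm P = \sum_(i < n) normc P`_i.
Proof.
move=> le_n; rewrite /coef_norm (big_ord_widen n (fun i => normc P`_i)) //.
rewrite [RHS](bigID (fun i : 'I_n => (i < size P)%N)) /= [X in _ + X]big1 ?addr0 // => i.
by rewrite -leqNgt => /(nth_default 0) ->; rewrite Normc.normc0.
Qed.

Lemma coef_norm_ge0 P : 0 <= coef_norm P.
Proof. by apply: sumr_ge0 => i _; apply: normc_ge0. Qed.

Lemma coef_norm0 : coef_norm 0 = 0.
Proof. by rewrite /coef_norm size_poly0 big_ord0. Qed.

Lemma coef_normD P Q : coef_norm (P + Q) <= coef_norm P + coef_norm Q.
Proof.
set n := maxn (size P) (size Q).
rewrite (@coef_norm_widen (P + Q) n) ?size_polyD //.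
rewrite (@coef_norm_widen P n) ?leq_maxl // (@coef_norm_widen Q n) ?leq_maxr //.
by rewrite -big_split ler_sum //= => i _; rewrite coefD ler_normcD.
Qed.

Lemma coef_normZ c P : coef_norm (c *: P) = normc c * coef_norm P.
Proof.
rewrite (@coef_norm_widen (c *: P) (size P)) ?size_scale_leq // mulr_sumr.
by apply: eq_bigr => i _; rewrite coefZ Normc.normcM.
Qed.

Lemma coef_normC c : coef_norm c%:P = normc c.
Proof.
by rewrite (@coef_norm_widen _ 1) ?size_polyC_leq1 // big_ord1 coefC.
Qed.

Lemma coef_normMX P : coef_norm (P * 'X) = coef_norm P.
Proof.
rewrite (@coef_norm_widen (P * 'X) (size P).+1) ?size_polyMXn //; last first.
  by rewrite (leq_trans (size_polyMleq _ _)) // size_polyX addn2.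
by rewrite big_ord_recl coefMX Normc.normc0 add0r; apply: eq_bigr => i _; rewrite coefMX.
Qed.

Lemma coef_normM P Q : coef_norm (P * Q) <= coef_norm P * coef_norm Q.
Proof.
elim/poly_ind: P => [|P c IH]; first by rewrite mul0r !coef_norm0 mul0r.
have -> : coef_norm (P * 'X + c%:P) = coef_norm P + normc c.
  rewrite (@coef_norm_widen (P * 'X + c%:P) (size P).+1); last first.
    by rewrite size_MXaddC; case: ifP.
  rewrite big_ord_recl coefD coefMX coefC add0r addrC; congr (_ + _).
  by apply: eq_bigr => i _; rewrite coefD coefMX coefC addr0.
rewrite mulrDl -mulrA ['X * Q]mulrC mulrA mul_polyC mulrDl.
by rewrite (le_trans (coef_normD _ _)) // coef_normMX coef_normZ lerD2r.
Qed.

Lemma normc_horner_le P (x : R[i]) : normc x <= 1 -> normc P.[x] <= coef_norm P.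
Proof.
move=> x1; rewrite horner_coef (le_trans (ler_normc_sum _ _ _)) // ler_sum // => i _.
rewrite Normc.normcM normcX ler_piMr ?normc_ge0 // exprn_ile1 ?normc_ge0 //.
Qed.

Lemma size_deriv_leq P : (size P^`() <= (size P).-1)%N.
Proof.
have [->|P0] := eqVneq P 0; first by rewrite derivC size_poly0.
by have := lt_size_deriv P0; case: (size P).
Qed.

Lemma normc_horner_lip P (x y : R[i]) : normc x <= 1 -> normc y <= 1 ->
  normc (P.[x] - P.[y]) <= coef_norm P^`() * normc (x - y).
Proof.
move=> x1 y1.
have h n : normc (x ^+ n - y ^+ n) <= n%:R * normc (x - y).
  rewrite subrXX Normc.normcM mulrC ler_wpM2r ?normc_ge0 //.
  rewrite (le_trans (ler_normc_sum _ _ _)) //.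
  have -> : n%:R = \sum_(i < n) (1 : R) by rewrite sumr_const card_ord.
  rewrite ler_sum // => i _.
  by rewrite Normc.normcM !normcX mulr_ile1 ?exprn_ge0 ?exprn_ile1 ?normc_ge0.
rewrite (@coef_norm_widen _ (size P).-1) ?size_deriv_leq //.
rewrite !horner_coef -sumrB (le_trans (ler_normc_sum _ _ _)) //.
case: (size P) => [|n] /=; first by rewrite !big_ord0 mul0r.
rewrite big_ord_recl !expr0 subrr Normc.normc0 add0r mulr_suml ler_sum // => i _.
rewrite -mulrBr Normc.normcM coef_deriv -mulr_natl Normc.normcM normc_natr.
by rewrite [leRHS]mulrAC [leRHS]mulrC ler_wpM2l ?normc_ge0 // lift0.
Qed.

End CoefNorm.

Section Bernstein.
Variable R : realType.
Implicit Types (c : nat -> R[i]) (Y : {poly R[i]}).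

(* Bernstein polynomial of the node values c 0, ..., c n in the variable Y,
   computed by de Casteljau's recursion. *)
Fixpoint bernstein Y n c : {poly R[i]} :=
  if n is k.+1 then Y * bernstein Y k (c \o succn) + (1 - Y) * bernstein Y k c
  else (c 0)%:P.

(** Used with Y = X / W, where the power is at most (1 + 2 / W)^n; [Gamma_] is large enough to
    absorb it. *)
Lemma coef_norm_bernstein Y n c (M : R) :
  (forall l, (l <= n)%N -> normc (c l) <= M) ->
  coef_norm (bernstein Y n c) <= M * (coef_norm Y + coef_norm (1 - Y)) ^+ n.
Proof.
elim: n c => [|n IH] c cM /=; first by rewrite expr0 mulr1 coef_normC cM.
rewrite exprS mulrCA [leRHS]mulrDl (le_trans (coef_normD _ _)) // lerD //.
  rewrite (le_trans (coef_normM _ _)) // ler_wpM2l ?coef_norm_ge0 // IH //.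
  by move=> l ln /=; apply: cM.
rewrite (le_trans (coef_normM _ _)) // ler_wpM2l ?coef_norm_ge0 // IH //.
by move=> l ln; rewrite cM // leqW.
Qed.

Lemma size_bernstein Y n c : (size Y <= 2)%N -> (size (bernstein Y n c) <= n.+1)%N.
Proof.
move=> Y2; elim: n c => [|n IH] c /=; first by rewrite size_polyC_leq1.
have Y2' : (size (1 - Y)%R <= 2)%N.
  by rewrite (leq_trans (size_polyD _ _)) // geq_max size_polyN Y2 size_poly1.
rewrite (leq_trans (size_polyD _ _)) // geq_max; apply/andP; split.
  rewrite (leq_trans (size_polyMleq _ _)) //.
  by rewrite -subn1 leq_subLR add1n (leq_trans (leq_add Y2 (IH _))).
rewrite (leq_trans (size_polyMleq _ _)) //.
by rewrite -subn1 leq_subLR add1n (leq_trans (leq_add Y2' (IH _))).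
Qed.

(** The bracket is the mean of (l - a)^2 for a binomial variable l with parameters n and x. The free
    centre a is what lets the induction pass: shifting the node values by one replaces a by a -
    1. *)
Lemma bernstein_near Y n c (v z : R[i]) (x e K a : R) :
  Y.[z] = x%:C -> 0 <= x <= 1 ->
  (forall l, (l <= n)%N -> normc (c l - v) <= e + K * (l%:R - a) ^+ 2) ->
  normc ((bernstein Y n c).[z] - v)
    <= e + K * (n%:R * x * (1 - x) + (n%:R * x - a) ^+ 2).
Proof.
move=> Yz /andP[x0 x1]; elim: n c a => [|n IH] c a cv /=.
  by rewrite hornerC !mul0r add0r cv.
have h1 : normc ((bernstein Y n (c \o succn)).[z] - v)
    <= e + K * (n%:R * x * (1 - x) + (n%:R * x - (a - 1)) ^+ 2).
  apply: IH => l ln /=; have := cv l.+1 ln; rewrite -natr1.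
  by have -> : l%:R + 1 - a = l%:R - (a - 1) by ring.
have h2 : normc ((bernstein Y n c).[z] - v)
    <= e + K * (n%:R * x * (1 - x) + (n%:R * x - a) ^+ 2).
  by apply: IH => l ln; rewrite cv // leqW.
have -> : (Y * bernstein Y n (c \o succn) + (1 - Y) * bernstein Y n c).[z] - v
  = x%:C * ((bernstein Y n (c \o succn)).[z] - v)
    + (1 - x)%:C * ((bernstein Y n c).[z] - v).
  by rewrite !hornerE Yz rmorphB rmorph1; ring.
rewrite (le_trans (ler_normcD _ _)) // !Normc.normcM !normc_real.
rewrite (ger0_norm x0) ger0_norm ?subr_ge0 //.
have := ler_wpM2l x0 h1.
have x1' : 0 <= 1 - x by rewrite subr_ge0.
have := ler_wpM2l x1' h2; rewrite -natr1; move: n%:R => N; lra.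
Qed.

Lemma bernstein_approx Y n c (v z : R[i]) (x e K : R) :
  (0 < n)%N -> Y.[z] = x%:C -> 0 <= x <= 1 -> 0 <= K ->
  (forall l, (l <= n)%N ->
     normc (c l - v) <= e + K * (l%:R / n%:R - x) ^+ 2) ->
  normc ((bernstein Y n c).[z] - v) <= e + K / n%:R.
Proof.
move=> n0 Yz x01 K0 cv.
have nR : 0 < n%:R :> R by rewrite ltr0n.
have := @bernstein_near Y n c v z x e (K / n%:R ^+ 2) (n%:R * x) Yz x01.
rewrite subrr expr0n addr0 => /(_ _)/le_trans; apply.
  move=> l ln; apply: le_trans (cv l ln) _.
  have -> : l%:R / n%:R - x = (l%:R - n%:R * x) / n%:R by field; rewrite gt_eqF.
  by rewrite expr_div_n mulrCA mulrC mulrAC.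
rewrite lerD2l -mulrA ler_wpM2l // -!mulrA expr2 invfM -!mulrA mulKf ?gt_eqF //.
rewrite ler_piMr ?invr_ge0 ?ltW //; case/andP: x01 => *; nra.
Qed.

End Bernstein.

(** * Upper integrals and density of polynomials in L^p *)

Section UpperIntegral.
Variable R : realType.
Local Notation mu := (@lebesgue_measure R).
Local Notation I01 := (`[0%R : R, 1%R]%classic).
Implicit Types F G : R -> R.

(* F is dominated on [0,1] by a measurable function of integral at most v;
   F itself need not be measurable. *)
Definition uint_le F (v : R) := exists2 G : R -> R,
  measurable_fun I01 G /\ (forall t, I01 t -> 0 <= G t /\ F t <= G t) &
  (\int[mu]_(t in I01) (G t)%:E <= v%:E)%E.

Lemma lebesgue_itv01 : mu I01 = 1%E.
Proof. by rewrite lebesgue_measure_itv /= lte_fin ltr01 oppr0 adde0. Qed.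

Lemma uint_le_cst F (c : R) : 0 <= c -> (forall t, 0 <= t <= 1 -> F t <= c) ->
  uint_le F c.
Proof.
move=> c0 Fc; exists (cst c).
  by split=> [|t /=]; [exact: measurable_cst|rewrite in_itv /= => /Fc].
by rewrite (@integral_cst _ _ _ mu I01 _ c%:E) //= lebesgue_itv01 mule1.
Qed.

Lemma uint_le_add F1 F2 v1 v2 : uint_le F1 v1 -> uint_le F2 v2 ->
  uint_le (fun t => F1 t + F2 t) (v1 + v2).
Proof.
move=> [G1 [m1 G1P] i1] [G2 [m2 G2P] i2]; exists (G1 \+ G2).
  split; first exact: measurable_funD.
  move=> t It; have [? ?] := G1P t It; have [? ?] := G2P t It.
  by split; [apply: addr_ge0|apply: lerD].
under eq_integral do rewrite EFinD.
rewrite ge0_integralD //.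
- by rewrite EFinD leeD.
- by move=> t /G1P[]; rewrite lee_fin.
- exact/measurable_EFinP.
- by move=> t /G2P[]; rewrite lee_fin.
- exact/measurable_EFinP.
Qed.

Lemma uint_le_scale F (a v : R) : 0 <= a -> uint_le F v ->
  uint_le (fun t => a * F t) (a * v).
Proof.
move=> a0 [G [m GP] i]; exists (fun t => a * G t).
  split; first by apply: measurable_funM => //; exact: measurable_cst.
  by move=> t /GP[? ?]; split; [exact: mulr_ge0|exact: ler_wpM2l].
under eq_integral do rewrite EFinM.
rewrite ge0_integralZl_EFin //.
- by rewrite EFinM lee_wpmul2l.
- by move=> t /GP[]; rewrite lee_fin.
- exact/measurable_EFinP.
Qed.

Lemma uint_le_weaken F1 F2 v1 v2 : (forall t, 0 <= t <= 1 -> F2 t <= F1 t) ->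
  v1 <= v2 -> uint_le F1 v1 -> uint_le F2 v2.
Proof.
move=> F12 v12 [G [m GP] i]; exists G; last by apply: le_trans i _; rewrite lee_fin.
split=> // t It; have [? ?] := GP t It; split=> //.
by apply: le_trans (F12 _ _) _ => //; move: It; rewrite /= in_itv.
Qed.

Lemma uint_le_sum (J : eqType) (s : seq J) (F : J -> R -> R) (v : J -> R) :
  (forall j, j \in s -> uint_le (F j) (v j)) ->
  uint_le (fun t => \sum_(j <- s) F j t) (\sum_(j <- s) v j).
Proof.
elim: s => [|j s IH] h.
  by rewrite big_nil; apply: uint_le_cst => // t _; rewrite big_nil.
rewrite big_cons; have hs i : i \in s -> uint_le (F i) (v i).
  by move=> si; apply: h; rewrite inE si orbT.
apply: uint_le_weaken (uint_le_add (h j (mem_head _ _)) (IH hs)) => // t _.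
by rewrite big_cons.
Qed.

Lemma uint_le_ball (x r : R) : 0 <= r ->
  uint_le (fun t => (`|t - x| <= r)%R%:R) (2 * r).
Proof.
move=> r0; exists (\1_(`[x - r, x + r]%classic)).
  split=> [|t _]; first exact: measurable_indic.
  split; first by rewrite indicE ler0n.
  by rewrite indicE mem_setE in_itv /= ler_distl.
rewrite integral_indic //.
rewrite (le_trans (y := mu `[x - r, x + r]%classic)) //.
  by apply: le_measure => //; rewrite ?inE //; apply: measurableI.
rewrite lebesgue_measure_itv /= lte_fin.
by case: ifP => _; rewrite -?EFinB lee_fin; [lra|rewrite mulr_ge0].
Qed.

Lemma integral_le_uint F (v : R) : measurable_fun I01 F ->
  (forall t, 0 <= t <= 1 -> 0 <= F t) -> uint_le F v ->
  (\int[mu]_(t in I01) (F t)%:E <= v%:E)%E.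
Proof.
move=> mF F0 [G [m GP] i]; apply: le_trans i; apply: ge0_le_integral => //.
- exact/measurable_EFinP.
- exact/measurable_EFinP.
- by move=> t /GP[_]; rewrite lee_fin.
Qed.

Lemma uint_le_integral F (v : R) : measurable_fun I01 F ->
  (forall t, 0 <= t <= 1 -> 0 <= F t) ->
  (\int[mu]_(t in I01) (F t)%:E <= v%:E)%E -> uint_le F v.
Proof.
by move=> mF F0 i; exists F => //; split=> // t; rewrite /= in_itv /= => /F0.
Qed.

End UpperIntegral.

Section PowerInequalities.
Variable R : realType.
Implicit Types (a b c p : R).

Lemma powRD_le p a b : 0 <= p -> 0 <= a -> 0 <= b ->
  (a + b) `^ p <= 2 `^ p * (a `^ p + b `^ p).
Proof.
move=> p0 a0 b0; rewrite mulrDr -!powRM //.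
have [ab|/ltW ab] := leP a b.
  by rewrite ler_wpDl ?powR_ge0 // ge0_ler_powR ?nnegrE ?mulr_ge0 ?addr_ge0 //; lra.
by rewrite ler_wpDr ?powR_ge0 // ge0_ler_powR ?nnegrE ?mulr_ge0 ?addr_ge0 //; lra.
Qed.

Lemma powRD3_le p a b c : 0 <= p -> 0 <= a -> 0 <= b -> 0 <= c ->
  (a + b + c) `^ p <= 3 `^ p * (a `^ p + b `^ p + c `^ p).
Proof.
move=> p0 a0 b0 c0; rewrite !mulrDr -!powRM //.
have h m : 0 <= m -> a + b + c <= 3 * m -> (a + b + c) `^ p <= (3 * m) `^ p.
  by move=> *; rewrite ge0_ler_powR ?nnegrE ?mulr_ge0 ?addr_ge0.
have := powR_ge0 (3 * a) p; have := powR_ge0 (3 * b) p; have := powR_ge0 (3 * c) p.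
have [ab|/ltW ab] := leP a b; have [bc|/ltW bc] := leP b c; have [ac|/ltW ac] := leP a c.
all: try by have := h c c0; lra.
all: try by have := h b b0; lra.
all: by have := h a a0; lra.
Qed.

(** Every c in [0, a + b] satisfies c^p <= c (a + b)^(p - 1); add this for c = a and c = b. *)
Lemma powR_superadd p a b : 1 <= p -> 0 <= a -> 0 <= b ->
  a `^ p + b `^ p <= (a + b) `^ p.
Proof.
move=> p1 a0 b0.
have [|] := boolP (a + b == 0).
  rewrite paddr_eq0 // => /andP[/eqP-> /eqP->].
  by rewrite !powR0 ?addr0 ?powR0 //; apply/eqP; lra.
move=> ab0; have abp : 0 < a + b by rewrite lt_def ab0 addr_ge0.
have h c : 0 <= c -> c <= a + b -> c `^ p <= c * (a + b) `^ (p - 1).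
  move=> c0 cab; have [->|c1] := eqVneq c 0.
    by rewrite powR0 ?mul0r //; apply/eqP; lra.
  have -> : c `^ p = c * c `^ (p - 1).
    rewrite -{2}(powRr1 c0) -powRD ?c1 ?implybT //; congr (_ `^ _); ring.
  by rewrite ler_wpM2l // ge0_ler_powR ?nnegrE ?(ltW abp) //; lra.
have := h a a0; have := h b b0.
have -> : (a + b) `^ p = (a + b) * (a + b) `^ (p - 1).
  rewrite -{2}(powRr1 (ltW abp)) -powRD ?ab0 ?implybT //; congr (_ `^ _); ring.
rewrite mulrDl; lra.
Qed.

End PowerInequalities.

Section Density.
Variable R : realType.
Local Notation mu := (@lebesgue_measure R).
Local Notation I01 := (`[0%R : R, 1%R]%classic).
Implicit Types (g h : R -> R[i]) (u V : R -> R) (p : R).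

Lemma Lp_normE p g : p != 0 -> Lp_norm p g =
  ((\int[mu]_(t in I01) (normc (g t) `^ p)%:E) `^ p^-1)%E.
Proof.
move=> p0; rewrite /Lp_norm unlock; congr (_ `^ _)%E; rewrite [RHS]integral_mkcond.
apply: eq_integral => t _; rewrite /= /patch; case: ifP => _ /=.
  by rewrite ger0_norm // normc_ge0.
by rewrite normr0 powR0.
Qed.

Lemma integral_powR_ge0 p g :
  (0 <= \int[mu]_(t in I01) (normc (g t) `^ p)%:E)%E.
Proof. by apply: integral_ge0 => t _; rewrite lee_fin powR_ge0. Qed.

Lemma Lp_norm_lt p g (v e : R) : 0 < p -> 0 < e -> v < e `^ p ->
  (\int[mu]_(t in I01) (normc (g t) `^ p)%:E <= v%:E)%E ->
  (Lp_norm p g < e%:E)%E.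
Proof.
move=> p0 e0 ve; rewrite Lp_normE ?gt_eqF //.
have := integral_powR_ge0 p g; case: (\int[mu]_(t in I01) _)%E => [r| |] //=.
rewrite !lee_fin lte_fin => r0 rv.
rewrite -[e in ltRHS](@powRr1 _ e) ?ltW // -(@mulfV _ p) ?gt_eqF // powRrM.
rewrite gt0_ltr_powR ?invr_gt0 ?nnegrE ?powR_ge0 //.
exact: le_lt_trans rv ve.
Qed.

Lemma Lp_norm_fin p g : 0 < p -> (Lp_norm p g < +oo)%E ->
  (\int[mu]_(t in I01) (normc (g t) `^ p)%:E < +oo)%E.
Proof.
move=> p0; rewrite Lp_normE ?gt_eqF //.
by case: (\int[mu]_(t in I01) _)%E => [r| |] //=; rewrite ?ltry // invr_eq0 gt_eqF.
Qed.

Lemma unif_continuous_itv V : continuous V -> forall e : R, 0 < e ->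
  exists2 d : R, 0 < d &
    forall x y : R, 0 <= x <= 1 -> 0 <= y <= 1 -> `|x - y| < d -> `|V x - V y| < e.
Proof.
move=> cV e e0.
have cov : near_covering I01 by apply/compact_near_coveringP; exact: segment_compact.
have hd : (\forall d \near 0^'+, I01 `<=` (fun x : R =>
    forall y : R, `|x - y| < d -> `|V x - V y| < e))%classic.
  apply: cov => x _; have e20 : 0 < e / 2 by rewrite divr_gt0.
  have /cvgrPdist_lt/(_ _ e20)/nbhs_ballP[r /= r0 hr] := cV x.
  exists (ball x (r / 2), [set d | d < r / 2]%classic).
    split=> /=; first by apply: nbhsx_ballx; rewrite divr_gt0.
    by apply: nbhs_right_lt => //; rewrite divr_gt0.
  move=> [x' d] /= [x'x' dr] y x'y; have x'x : `|x - x'| < r / 2 := x'x'.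
  have rE : r / 2 < r by rewrite gtr_pMr // invf_lt1 // ltr1n.
  have h1 : `|V x' - V x| < e / 2.
    by rewrite distrC; apply: hr; apply: lt_trans x'x rE.
  have h2 : `|V x - V y| < e / 2.
    apply: hr; apply: le_lt_trans (ler_distD x' _ y) _.
    by rewrite [ltRHS](splitr r) ltrD // (lt_trans x'y dr).
  apply: le_lt_trans (ler_distD (V x) _ _) _.
  by rewrite [ltRHS](splitr e) ltrD.
have /filter_ex[d [d0 hV]] : (\forall d \near 0^'+,
   (0 < d /\ forall x : R, I01 x -> forall y : R, `|x - y| < d -> `|V x - V y| < e))%classic.
  near=> d; split; first by near: d; exact: nbhs_right_gt.
  by near: d.
exists d => // x y x01 _; apply: hV; by rewrite /= in_itv.
Unshelve. all: by end_near.
Qed.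

(** Brings a modulus of continuity into the quadratic form required by [bernstein_approx]. When |x -
    y| >= d, a chain of N > 1/d equal steps gives N e, which is at most (N e / d^2) (x - y)^2. *)
Lemma unif_continuous_quad (h : R -> R[i]) (e d : R) : 0 < e -> 0 < d ->
  (forall x y : R, 0 <= x <= 1 -> 0 <= y <= 1 -> `|x - y| < d ->
     normc (h x - h y) <= e) ->
  exists2 K : R, 0 <= K & forall x y : R, 0 <= x <= 1 -> 0 <= y <= 1 ->
    normc (h x - h y) <= e + K * (x - y) ^+ 2.
Proof.
move=> e0 d0 hd; set N := (Num.bound d^-1).
have Nd : d^-1 < N%:R by apply: archi_boundP; rewrite invr_ge0 ltW.
have NR : 0 < N%:R :> R by apply: lt_trans Nd; rewrite invr_gt0.
have Nd1 : 1 < N%:R * d by rewrite -ltr_pdivrMr // mul1r.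
have chain x y : 0 <= x <= 1 -> 0 <= y <= 1 -> forall k, (k <= N)%N ->
    normc (h x - h (x + k%:R / N%:R * (y - x))) <= k%:R * e.
  move=> /andP[x0 x1] /andP[y0 y1].
  have seg k : (k <= N)%N -> 0 <= x + k%:R / N%:R * (y - x) <= 1.
    move=> kN; have s0 : 0 <= k%:R / N%:R :> R by rewrite divr_ge0.
    have s1 : k%:R / N%:R <= 1 :> R by rewrite ler_pdivrMr // mul1r ler_nat.
    by move: s0 s1; move: (_ / _) => s s0 s1; nra.
  elim=> [|k IH] kN; first by rewrite !mul0r addr0 subrr Normc.normc0.
  apply: le_trans (ler_normc_distD (h (x + k%:R / N%:R * (y - x))) _ _) _.
  have -> : k.+1%:R * e = k%:R * e + e by rewrite -natr1 mulrDl mul1r.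
  rewrite lerD //; first by apply: IH; rewrite ltnW.
  apply: hd; rewrite ?seg // 1?ltnW //.
  rewrite -natr1; have -> : x + k%:R / N%:R * (y - x) - (x + (k%:R + 1) / N%:R * (y - x))
    = (x - y) / N%:R by field; rewrite gt_eqF.
  rewrite normrM (ger0_norm (_ : 0 <= N%:R^-1)) ?invr_ge0 // ltr_pdivrMr // mulrC.
  by apply: le_lt_trans Nd1; rewrite ler_norml; apply/andP; split; lra.
exists (N%:R * e / d ^+ 2); first by rewrite divr_ge0 ?mulr_ge0 ?exprn_ge0 // ltW.
move=> x y x01 y01; have [xyd|dxy] := ltP `|x - y| d.
  by rewrite ler_wpDr ?hd // mulr_ge0 ?sqr_ge0 // divr_ge0 ?mulr_ge0 ?exprn_ge0 // ltW.
have := chain x y x01 y01 N (leqnn _).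
have -> : x + N%:R / N%:R * (y - x) = y by field; rewrite gt_eqF.
move=> h1; apply: le_trans h1 _.
rewrite ler_wpDl ?(ltW e0) // -mulrA ler_peMr ?mulr_ge0 ?(ltW e0) //.
rewrite mulrC ler_pdivlMr ?exprn_gt0 // mul1r -[leRHS]real_normK ?num_real //.
by rewrite ler_pXn2r ?nnegrE // ltW.
Qed.

Lemma weierstrass (h : R -> R[i]) :
  (forall e : R, 0 < e -> exists2 d : R, 0 < d &
     forall x y : R, 0 <= x <= 1 -> 0 <= y <= 1 -> `|x - y| < d ->
       normc (h x - h y) <= e) ->
  forall e : R, 0 < e -> exists P : {poly R[i]}, forall t : R, 0 <= t <= 1 ->
    normc (h t - P.[t%:C]) <= e.
Proof.
move=> hu e e0; have e20 : 0 < e / 2 by rewrite divr_gt0.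
have [d d0 hd] := hu _ e20.
have [K K0 hK] := unif_continuous_quad e20 d0 hd.
set n := (Num.bound (K / (e / 2))).+1.
have nR : 0 < n%:R :> R by rewrite ltr0n.
have Kn : K / n%:R <= e / 2.
  rewrite ler_pdivrMr // mulrC -ler_pdivrMr // ltW //.
  apply: lt_trans (archi_boundP _) _; first by rewrite divr_ge0 // ltW.
  by rewrite ltr_nat.
exists (bernstein 'X n (fun l => h (l%:R / n%:R))) => t t01; rewrite normcBC.
apply: le_trans (bernstein_approx (x := t) (e := e / 2) (K := K) _ _ _ K0 _) _ => //.
- by rewrite hornerX.
- move=> l ln; apply: hK => //; rewrite divr_ge0 //=.
  by rewrite ler_pdivrMr // mul1r ler_nat.
- by rewrite [leRHS](splitr e) lerD2l.
Qed.

(* Signed power: an odd increasing bijection of R turning L^p data into L^1 data. *)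
Definition spow (a x : R) : R := Num.max x 0 `^ a - Num.max (- x) 0 `^ a.

Lemma spow_ge0E a x : a != 0 -> 0 <= x -> spow a x = x `^ a.
Proof.
move=> a0 x0; rewrite /spow max_l // max_r ?oppr_le0 //.
by rewrite powR0 // subr0.
Qed.

Lemma spowN a x : spow a (- x) = - spow a x.
Proof. by rewrite /spow opprK opprB. Qed.

Lemma normr_spow a x : a != 0 -> `|spow a x| = `|x| `^ a.
Proof.
move=> a0; wlog x0 : x / 0 <= x => [hw|].
  have [/hw//|/ltW x0] := leP 0 x.
  by rewrite -[x]opprK spowN !normrN hw ?oppr_ge0 // normrN.
by rewrite spow_ge0E // ger0_norm ?powR_ge0 // ger0_norm.
Qed.

Lemma spowK p x : p != 0 -> spow p^-1 (spow p x) = x.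
Proof.
move=> p0; wlog x0 : x / 0 <= x => [hw|].
  have [/hw//|/ltW x0] := leP 0 x.
  by rewrite -[x]opprK 2!spowN hw ?oppr_ge0.
by rewrite !spow_ge0E ?invr_eq0 ?powR_ge0 // -powRrM mulfV // powRr1.
Qed.

(** By symmetry |y| <= |x| and x >= 0. For equal signs, superadditivity of the p-th power gives even
    x - y; for opposite signs, both roots are at most x^(1/p) and x <= |x - y|, which produces the
    factor 2^p. *)
Lemma spow_dist p x y : 1 <= p ->
  `|spow p^-1 x - spow p^-1 y| `^ p <= 2 `^ p * `|x - y|.
Proof.
move=> p1; have p0 : 0 < p by apply: lt_le_trans p1.
have pn0 : p^-1 != 0 by rewrite invr_eq0 gt_eqF.
have pow (z : R) : 0 <= z -> (z `^ p^-1) `^ p = z.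
  by move=> z0; rewrite -powRrM mulVf ?powRr1 // gt_eqF.
have twop : 1 <= 2 `^ p :> R 
  by have := @ler_powR R 2 (ler1n _ 2) 0 p (ltW p0); rewrite powRr0.
wlog xy : x y / `|y| <= `|x| => [hw|].
  have [/hw//|/ltW/hw] := leP `|y| `|x|; by rewrite distrC (distrC y).
wlog x0 : x y xy / 0 <= x => [hw|].
  have [/hw|/ltW x0] := leP 0 x; first exact.
  have := hw (- x) (- y); rewrite !normrN !spowN oppr_ge0 -!opprD !normrN.
  exact.
rewrite (ger0_norm x0) in xy.
have [y0|/ltW y0] := leP 0 y.
  rewrite (ger0_norm y0) in xy.
  rewrite !spow_ge0E // !ger0_norm ?subr_ge0 //; last first.
    by rewrite ge0_ler_powR ?nnegrE // invr_ge0 ltW.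
  apply: (@le_trans _ _ (x - y)); last by rewrite ler_peMl ?subr_ge0.
  rewrite lerBrDr -{2}(pow y y0) -{2}(pow x x0).
  have le' : y `^ p^-1 <= x `^ p^-1 by rewrite ge0_ler_powR ?nnegrE // invr_ge0 ltW.
  have := @powR_superadd _ p (x `^ p^-1 - y `^ p^-1) (y `^ p^-1) p1.
  by rewrite subrK; apply; rewrite ?powR_ge0 // subr_ge0.
rewrite -[y]opprK spowN opprK !spow_ge0E ?oppr_ge0 // opprK.
rewrite (ler0_norm y0) in xy.
have h : (- y) `^ p^-1 <= x `^ p^-1.
  by rewrite ge0_ler_powR ?nnegrE ?oppr_ge0 // invr_ge0 ltW.
rewrite !ger0_norm ?addr_ge0 ?powR_ge0 //; last by lra.
apply: (@le_trans _ _ ((2 * x `^ p^-1) `^ p)).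
  rewrite ge0_ler_powR ?nnegrE ?mulr_ge0 ?addr_ge0 ?powR_ge0 //; first by apply: ltW.
  by lra.
by rewrite powRM ?powR_ge0 // pow // ler_wpM2l ?powR_ge0 //; lra.
Qed.

Lemma measurable_spow a u : measurable_fun I01 u ->
  measurable_fun I01 (fun t => spow a (u t)).
Proof.
move=> mu_; apply: measurable_funB; apply: measurableT_comp (measurable_powR _) _.
  exact: measurable_maxr.
by apply: measurable_maxr => //; exact: measurableT_comp.
Qed.

(** The signed p-th power of u is integrable, hence an L^1 limit of continuous functions;
    [spow_dist] carries both the approximation and the uniform continuity back through the signed
    p-th root. *)
Lemma real_approx p u : 1 <= p -> measurable_fun I01 u ->
  (\int[mu]_(t in I01) (`|u t| `^ p)%:E < +oo)%E -> forall e : R, 0 < e ->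
  exists v : R -> R, (forall e' : R, 0 < e' -> exists2 d : R, 0 < d &
     forall x y : R, 0 <= x <= 1 -> 0 <= y <= 1 -> `|x - y| < d ->
       `|v x - v y| <= e') /\
     uint_le (fun t => `|u t - v t| `^ p) e.
Proof.
move=> p1 mu_ fu e e0; have p0 : 0 < p by apply: lt_le_trans p1.
have ms := measurable_spow p mu_.
have int : mu.-integrable I01 (EFin \o (fun t => spow p (u t))).
  apply/integrableP; split; first exact/measurable_EFinP.
  apply: le_lt_trans fu; apply: ge0_le_integral => //.
  - by apply: measurableT_comp => //; exact/measurable_EFinP.
  - apply/measurable_EFinP; apply: measurableT_comp (measurable_powR _) _.
    exact: measurableT_comp.
  - by move=> t _; rewrite /= lee_fin normr_spow ?gt_eqF.
have fin01 : (mu I01 < +oo)%E by rewrite lebesgue_itv01 ltry.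
have [g_ [cg ig cvg]] := approximation_continuous_integrable (measurable_itv _) fin01 int.
have e'0 : 0 < e / 2 `^ p by rewrite divr_gt0 // powR_gt0.
have [n hn] : exists n, (\int[mu]_(t in I01) `|(spow p (u t) - g_ n t)%:E| < (e / 2 `^ p)%:E)%E.
  have /fine_cvgP[finN] := cvg.
  move=> /cvgrPdist_lt/(_ _ e'0) [N _ hN]; case: finN => N' _ hN'.
  exists (maxn N N'); have /= := hN (maxn N N') (leq_maxl _ _).
  have /= := hN' (maxn N N') (leq_maxr _ _).
  rewrite sub0r normrN; move=> fin_; rewrite -[X in (X < _)%E]fineK // lte_fin.
  by apply: le_lt_trans; exact: ler_norm.
exists (fun t => spow p^-1 (g_ n t)); split.
  move=> e1 e10; have e2 : 0 < e1 `^ p / 2 `^ p by rewrite divr_gt0 ?powR_gt0.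
  have [d d0 hd] := unif_continuous_itv (cg n) e2.
  exists d => // x y x01 y01 xy; have := hd x y x01 y01 xy.
  rewrite ltr_pdivlMr ?powR_gt0 // mulrC => hlt.
  rewrite leNgt; apply/negP => lt_e1.
  have := le_lt_trans (spow_dist (g_ n x) (g_ n y) p1) hlt.
  by rewrite ltNge ge0_ler_powR ?nnegrE // ltW.
apply: (uint_le_weaken (F1 := fun t => 2 `^ p * `|spow p (u t) - g_ n t|)
   (v1 := 2 `^ p * (e / 2 `^ p))).
- by move=> t _; rewrite -{1}(@spowK p (u t)) ?gt_eqF // spow_dist.
- by rewrite mulrC divfK // gt_eqF // powR_gt0.
- apply: uint_le_scale; first exact: powR_ge0.
  apply: uint_le_integral => //; last exact: ltW.
  apply: measurableT_comp => //; apply: measurable_funB; first exact: ms.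
  by apply: measurable_funTS; apply: continuous_measurable_fun; exact: cg.
Qed.

Lemma measurable_normc (D : set R) g : measurable_fun D (fun t => complex.Re (g t)) ->
  measurable_fun D (fun t => complex.Im (g t)) -> measurable_fun D (fun t => normc (g t)).
Proof.
move=> mRe mIm; have -> : (fun t => normc (g t)) =
    (fun t => Num.sqrt (complex.Re (g t) ^+ 2 + complex.Im (g t) ^+ 2)).
  by apply: funext => t; case: (g t).
apply: measurableT_comp; first exact: continuous_measurable_fun (@sqrt_continuous R).
by apply: measurable_funD; apply: measurable_funX.
Qed.

Lemma Lp_poly_dense p g : 1 <= p -> Lp p g -> forall e : R, 0 < e ->
  exists P : {poly R[i]},
    uint_le (fun t => normc (g t - P.[t%:C]) `^ p) e.
Proof.
move=> p1 [mRe mIm fin] e e0; have p0 : 0 < p by apply: lt_le_trans p1.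
have {}fin := Lp_norm_fin p0 fin.
have le_Re (z : R[i]) : `|complex.Re z| <= normc z.
  by case: z => a b /=; rewrite -sqrtr_sqr; apply: ler_wsqrtr; rewrite lerDl sqr_ge0.
have le_Im (z : R[i]) : `|complex.Im z| <= normc z.
  by case: z => a b /=; rewrite -sqrtr_sqr; apply: ler_wsqrtr; rewrite lerDr sqr_ge0.
have normc_le (z : R[i]) : normc z <= `|complex.Re z| + `|complex.Im z|.
  case: z => a b /=; rewrite -[leRHS]ger0_norm ?addr_ge0 // -[leRHS]sqrtr_sqr; apply: ler_wsqrtr.
  rewrite sqrrD !real_normK ?num_real //.
  by have := mulr_ge0 (normr_ge0 a) (normr_ge0 b); lra.
have mnorm := measurable_normc mRe mIm.
have part u : measurable_fun I01 u -> (forall t, `|u t| <= normc (g t)) ->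
    (\int[mu]_(t in I01) (`|u t| `^ p)%:E < +oo)%E.
  move=> mu_ ug; apply: le_lt_trans fin; apply: ge0_le_integral => //.
  - apply/measurable_EFinP; apply: measurableT_comp (measurable_powR _) _.
    exact: measurableT_comp.
  - by apply/measurable_EFinP; apply: measurableT_comp (measurable_powR _) _.
  - by move=> t _; rewrite lee_fin ge0_ler_powR ?nnegrE ?normc_ge0 // ltW.
(* The real part, the imaginary part and the Weierstrass step get equal shares, after the factor 3^p
   of [powRD3_le]. *)
have e'0 : 0 < e / 3 `^ p / 3 by rewrite !divr_gt0 ?powR_gt0.
have [v1 [u1 a1]] := real_approx p1 mRe (part _ mRe (fun t => le_Re (g t))) e'0.
have [v2 [u2 a2]] := real_approx p1 mIm (part _ mIm (fun t => le_Im (g t))) e'0.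
pose h t := (v1 t +i* v2 t).
have hu : forall e : R, 0 < e -> exists2 d : R, 0 < d &
     forall x y : R, 0 <= x <= 1 -> 0 <= y <= 1 -> `|x - y| < d ->
       normc (h x - h y) <= e.
  move=> e1 e10; have e120 : 0 < e1 / 2 by rewrite divr_gt0.
  have [d1 d10 h1] := u1 _ e120; have [d2 d20 h2] := u2 _ e120.
  exists (Num.min d1 d2); first by rewrite lt_min d10.
  move=> x y x01 y01; rewrite lt_min => /andP[xy1 xy2].
  apply: le_trans (normc_le _) _; rewrite [leRHS](splitr e1).
  by apply: lerD; [exact: h1|exact: h2].
have e''0 : 0 < (e / 3 `^ p / 3) `^ p^-1 by rewrite powR_gt0.
have [P hP] := weierstrass hu e''0; exists P.
apply: (uint_le_weaken (F1 := fun t => 3 `^ p * (`|complex.Re (g t) - v1 t| `^ p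
    + `|complex.Im (g t) - v2 t| `^ p + (e / 3 `^ p / 3)))
   (v1 := 3 `^ p * (e / 3 `^ p / 3 + e / 3 `^ p / 3 + e / 3 `^ p / 3))).
- move=> t t01; apply: le_trans (_ : (`|complex.Re (g t) - v1 t|
    + `|complex.Im (g t) - v2 t| + (e / 3 `^ p / 3) `^ p^-1) `^ p <= _); last first.
    apply: le_trans (powRD3_le (ltW p0) _ _ _) _; rewrite ?powR_ge0 //.
    by rewrite -[X in _ + X]powRrM mulVf ?gt_eqF // powRr1 // ltW.
  rewrite ge0_ler_powR ?nnegrE ?normc_ge0 ?addr_ge0 ?powR_ge0 ?(ltW p0) //.
  apply: le_trans (ler_normc_distD (h t) _ _) _; apply: lerD; last exact: hP.
  apply: le_trans (normc_le _) _; rewrite /h.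
  by case: (g t) => a b /=.
- have p3 : 3 `^ p != 0 :> R by rewrite gt_eqF ?powR_gt0.
  by move: p3; move: (3 `^ p) => c c0; rewrite le_eqVlt; apply/orP; left; apply/eqP; field.
- apply: uint_le_scale; first exact: powR_ge0.
  apply: uint_le_add; first exact: uint_le_add.
  by apply: uint_le_cst => //; apply: ltW.
Qed.

End Density.

(** * The rational model *)

Section RationalRotation.
Variables (R : realType) (f : {poly R[i]}) (q r : nat).
Hypotheses (q_gt0 : (0 < q)%N) (coprime_rq : coprime r q).
Implicit Types (s : R) (i k l n : nat).

(** For 0 <= s < 1/q this is the fractional part of s + i/q + l r/q, written without [frac] so that
    it is affine in s, also at the right end of the cell. *)
Definition node i l s : R := s + ((i + l * r) %% q)%:R / q%:R.

(* Value at t = s + i/q of the k-th power of the Bishop operator with the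
   rational parameter r/q. *)
Definition rat_iter k i s : R[i] :=
  (\prod_(l < k) node i l s)%:C * f.[(node i k s)%:C].

Definition period_prod s : R := \prod_(j < q) (s + j%:R / q%:R).

Lemma modn_mul_inj a : injective (fun l : 'I_q =>
  Ordinal (ltn_pmod (a + l * r) q_gt0)).
Proof.
move=> l l' /(congr1 val) /= /eqP; rewrite eqn_modDl => e.
apply/val_inj => /=; move: e; wlog le_ll' : l l' / (l' <= l)%N => [hw|].
  have [/hw//|/ltnW/hw h] := leqP l' l; by rewrite eq_sym => /h.
rewrite eqn_mod_dvd ?leq_mul2r ?le_ll' ?orbT // -mulnBl Gauss_dvdl; last by rewrite coprime_sym.
move=> /dvdnP[[|c] e]; first by apply/eqP; rewrite eqn_leq le_ll' -subn_eq0 e mul0n eqxx.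
by have := ltn_ord l; move: e; rewrite mulSn; move: (c * q)%N => z; lia.
Qed.

Lemma node_period i k s : node i (k + q) s = node i k s.
Proof. by rewrite /node mulnDl addnA -modnDmr modnMr addn0. Qed.

Lemma prod_node_period i k s : \prod_(l < q) node i (k + l) s = period_prod s.
Proof.
rewrite /period_prod [RHS](reindex_inj (@modn_mul_inj (i + k * r))) /=.
by apply: eq_bigr => l _; rewrite /node mulnDl addnA.
Qed.

Lemma rat_iter_period k n i s :
  rat_iter (k + n * q) i s = (period_prod s ^+ n)%:C * rat_iter k i s.
Proof.
elim: n k => [|n IH] k; first by rewrite addn0 expr0 mul1r.
rewrite mulSn addnA IH exprSr rmorphM /= -mulrA; congr (_ * _).
rewrite /rat_iter big_split_ord /= prod_node_period node_period.
by rewrite rmorphM /= [RHS]mulrCA mulrA.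
Qed.

(* The starting points -u r (mod q) make the orbit matrix at s = 0 triangular. *)
Definition start (u : nat) : nat := (q.-1 * u * r)%N.

Lemma start_add_mod (u : nat) : ((start u + u * r) %% q = 0)%N.
Proof.
by rewrite /start -mulnDl -{2}[u]mul1n -mulnDl addn1 prednK // -mulnA modnMr.
Qed.

(** Since r is invertible modulo q, the columns of [orbit_mx] run through all q cells, only in
    another order. *)
Lemma start_surj i : (i < q)%N -> exists u : 'I_q, (start u %% q)%N = i.
Proof.
move=> iq.
have inj : injective (fun u : 'I_q => Ordinal (ltn_pmod (start u) q_gt0)).
  move=> u v /(congr1 val) /= e; apply: (@modn_mul_inj 0); apply: val_inj => /=.
  have hu : ((start u + (u * r + v * r)) %% q = (v * r) %% q)%N.
    by rewrite addnA -modnDml start_add_mod add0n.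
  have hv : ((start v + (u * r + v * r)) %% q = (u * r) %% q)%N.
    by rewrite [(u * r + _)%N]addnC addnA -modnDml start_add_mod add0n.
  by rewrite !add0n -hu -hv -modnDml -e modnDml.
have [g _ gK] := injF_bij inj.
by exists (g (Ordinal iq)); have /(congr1 val) /= := gK (Ordinal iq).
Qed.

Definition orbit_mx s : 'M[R[i]]_q := \matrix_(k, u) rat_iter k (start u) s.

(** [orbit_mx] with s as an indeterminate: its determinant is a polynomial of controlled degree, as
    the root estimate requires. *)
Definition orbit_poly_mx : 'M[{poly R[i]}]_q := \matrix_(k, u)
  ((\prod_(l < k) ('X + (((start u + l * r) %% q)%:R / q%:R)%:C%:P)) *
   (f \Po ('X + (((start u + k * r) %% q)%:R / q%:R)%:C%:P))).

Lemma det_orbit_mxE s : \det (orbit_mx s) = (\det orbit_poly_mx).[s%:C].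
Proof.
have -> : (\det orbit_poly_mx).[s%:C] = horner_eval s%:C (\det orbit_poly_mx) by [].
rewrite -det_map_mx; congr (\det _); apply/matrixP => k u; rewrite !mxE /= /horner_eval.
rewrite hornerM horner_prod horner_comp !hornerE /rat_iter /node rmorph_prod /= -rmorphD.
by congr (_ * _); apply: eq_bigr => l _; rewrite !hornerE rmorphD.
Qed.

Lemma node_start0 u : node (start u) u 0 = 0.
Proof.
by rewrite /node start_add_mod mul0r addr0.
Qed.

(** The orbit started at -u r meets the point 0 at time u, and that zero weight kills every iterate
    k > u. *)
Lemma orbit_mx0_trig : is_trig_mx (orbit_mx 0)^T.
Proof.
apply/is_trig_mxP => u k uk; rewrite !mxE /rat_iter.
by rewrite (bigD1 (Ordinal uk)) //= node_start0 mul0r mul0r.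
Qed.

(** Before time u the residue is -(u - l) r, nonzero modulo q because 0 < u - l < q. *)
Lemma node_start_ge u l : (l < u)%N -> (u < q)%N -> q%:R^-1 <= node (start u) l 0.
Proof.
move=> lu uq; rewrite /node add0r -{1}[q%:R^-1]mul1r ler_wpM2r ?invr_ge0 //.
rewrite ler1n lt0n; apply/negP; rewrite -/(dvdn q _) /start -mulnDl Gauss_dvdl; last first.
  by rewrite coprime_sym.
have -> : (q.-1 * u + l = q * u - (u - l))%N.
  have : (q * u = q.-1 * u + u)%N by rewrite -{1}(prednK q_gt0) mulSn addnC.
  by move: lu; move: (q * u)%N (q.-1 * u)%N => y z; lia.
rewrite dvdn_subr ?dvdn_mulr //; last by rewrite -{1}[u]mul1n; apply: leq_trans (leq_subr _ _) _; rewrite leq_mul2r q_gt0 orbT.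
by move=> /dvdn_leq; rewrite subn_gt0 => /(_ lu); lia.
Qed.

(** The u-th diagonal entry is f(0) times u nodes, each at least 1/q, and the sum of all u < q is
    [s_ q]. *)
Lemma det_orbit_mx0 : normc f`_0 ^+ q / q%:R ^+ s_ q <= normc (\det (orbit_mx 0)).
Proof.
rewrite -det_tr (det_trig orbit_mx0_trig) normc_prod.
have -> : normc f`_0 ^+ q / q%:R ^+ s_ q =
    \prod_(u < q) (q%:R^-1 ^+ u * normc f`_0) :> R.
  rewrite big_split /= prodr_const card_ord mulrC -exprVn; congr (_ * _).
  rewrite prodrXr; congr (_ ^+ _).
  by rewrite -(big_mkord xpredT id) bin2_sum bin2 /s_ subn1 divn2.
apply: ler_prod => u _; rewrite mulr_ge0 ?exprn_ge0 ?invr_ge0 ?normc_ge0 //=.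
rewrite !mxE /rat_iter node_start0 rmorph0 horner_coef0 Normc.normcM.
rewrite ler_wpM2r ?normc_ge0 // normc_real.
have -> : q%:R^-1 ^+ u = \prod_(l < u) q%:R^-1 :> R by rewrite prodr_const card_ord.
apply: le_trans _ (ler_norm _); apply: ler_prod => l _.
by rewrite invr_ge0 ler0n node_start_ge.
Qed.

End RationalRotation.

Lemma size_det_leq (A : comNzRingType) n d (M : 'M[{poly A}]_n) :
  (forall i j, (size (M i j) <= d.+1)%N) -> (size (\det M) <= (n * d).+1)%N.
Proof.
move=> Md; rewrite /determinant; elim/big_ind: _ => [|P Q sP sQ|s _].
- by rewrite size_poly0.
- by rewrite (leq_trans (size_polyD _ _)) // geq_max sP.
- have h (g : 'I_n -> 'I_n) : (\sum_(i < n) size (M i (g i)) <= n * d.+1)%N.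
    apply: (@leq_trans (\sum_(i < n) d.+1)); first exact: leq_sum.
    by rewrite sum_nat_const card_ord.
  rewrite mulr_sign; case: ifP => _; rewrite ?size_polyN.
  all: rewrite (leq_trans (size_poly_prod_leq _ _)) // card_ord leq_subLR.
  all: apply: (@leq_trans (n * d.+1).+1); first by rewrite ltnS; exact: h.
  all: by rewrite mulnS addnS.
Qed.

(** * Regularized Cramer coefficients *)

Section BoundedLipschitz.
Variables (R : realType) (dom : R -> Prop).
Implicit Types (B L K : R) (F G : R -> R[i]).

(** Bound and Lipschitz constant are propagated together, because the product rule needs both. *)
Definition bounded_lip B L F :=
  (forall s, dom s -> normc (F s) <= B) /\
  (forall s s', dom s -> dom s' -> normc (F s - F s') <= L * `|s - s'|).

Lemma bounded_lip_weaken B L B' L' F : B <= B' -> L <= L' ->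
  bounded_lip B L F -> bounded_lip B' L' F.
Proof.
move=> BB LL [bF lF]; split=> [s ds|s s' ds ds']; first by rewrite (le_trans (bF s ds)).
by rewrite (le_trans (lF s s' ds ds')) // ler_wpM2r.
Qed.

Lemma bounded_lipD B L B' L' F G : bounded_lip B L F -> bounded_lip B' L' G ->
  bounded_lip (B + B') (L + L') (fun s => F s + G s).
Proof.
move=> [bF lF] [bG lG]; split=> [s ds|s s' ds ds'].
  by rewrite (le_trans (ler_normcD _ _)) // lerD ?bF ?bG.
rewrite opprD addrACA (le_trans (ler_normcD _ _)) // mulrDl.
by rewrite lerD ?lF ?lG.
Qed.

Lemma bounded_lipM B L B' L' F G : 0 <= B -> 0 <= B' -> 0 <= L ->
  bounded_lip B L F -> bounded_lip B' L' G ->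
  bounded_lip (B * B') (L * B' + B * L') (fun s => F s * G s).
Proof.
move=> B0 B'0 L0 [bF lF] [bG lG]; split=> [s ds|s s' ds ds'].
  by rewrite Normc.normcM ler_pM ?normc_ge0 ?bF ?bG.
have -> : F s * G s - F s' * G s' = (F s - F s') * G s + F s' * (G s - G s') by ring.
rewrite (le_trans (ler_normcD _ _)) // !Normc.normcM mulrDl lerD //.
  by rewrite mulrAC ler_pM ?normc_ge0 ?lF ?bG.
by rewrite -mulrA ler_pM ?normc_ge0 ?lG ?bF.
Qed.

Lemma bounded_lip_sum (I : Type) (t : seq I) B L (F : I -> R -> R[i]) :
  (forall i, bounded_lip B L (F i)) ->
  bounded_lip ((size t)%:R * B) ((size t)%:R * L) (fun s => \sum_(i <- t) F i s).
Proof.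
move=> hF; elim: t => [|i t IH].
  rewrite !mul0r; split=> [s _|s s' _ _]; first by rewrite big_nil Normc.normc0.
  by rewrite !big_nil subr0 Normc.normc0 mul0r.
have [b l] := bounded_lipD (hF i) IH.
rewrite /= -natr1 ![(_ + 1) * _]mulrDl !mul1r ![_ + B]addrC ![_ + L]addrC.
by split=> *; rewrite !big_cons; [apply: b|apply: l].
Qed.

Lemma bounded_lip_prod (I : Type) (t : seq I) K (F : I -> R -> R[i]) : 1 <= K ->
  (forall i, bounded_lip K K (F i)) ->
  bounded_lip (K ^+ size t) ((size t)%:R * K ^+ size t) (fun s => \prod_(i <- t) F i s).
Proof.
move=> K1 hF; have K0 : 0 <= K by apply: le_trans K1.
elim: t => [|i t IH].
  rewrite mul0r; split=> [s _|s s' _ _]; first by rewrite big_nil Normc.normc1.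
  by rewrite !big_nil subrr Normc.normc0 mul0r.
have [b l] := bounded_lipM K0 (exprn_ge0 (size t) K0) K0 (hF i) IH.
split=> *; rewrite !big_cons /= exprS; first exact: b.
apply: le_trans (l _ _ _ _) _ => //; rewrite ler_wpM2r //.
by rewrite -natr1; move: (size t)%:R (K ^+ size t) => a c; rewrite le_eqVlt; apply/orP; left; apply/eqP; ring.
Qed.

(** A single number above both the size bound n! K^n and the Lipschitz bound n! n K^n of a
    determinant. It increases with n, so it also serves for the cofactors. *)
Definition det_bound K n : R := n`!%:R * n.+1%:R * K ^+ n.

Lemma det_bound_le K m n : 1 <= K -> (m <= n)%N -> det_bound K m <= det_bound K n.
Proof.
move=> K1 mn; have K0 : 0 <= K by apply: le_trans K1.
rewrite /det_bound ler_pM ?mulr_ge0 ?exprn_ge0 //; last exact: ler_weXn2l.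
by rewrite -!natrM ler_nat leq_mul // leq_fact.
Qed.

Lemma det_bound_ge1 K n : 1 <= K -> 1 <= det_bound K n.
Proof.
move=> K1; apply: le_trans (det_bound_le K1 (leq0n n)).
by rewrite /det_bound fact0 expr0 !mulr1.
Qed.

Lemma bounded_lip_det K n (M : R -> 'M[R[i]]_n) : 1 <= K ->
  (forall i j, bounded_lip K K (fun s => M s i j)) ->
  bounded_lip (det_bound K n) (det_bound K n) (fun s => \det (M s)).
Proof.
move=> K1 hM; have K0 : 0 <= K by apply: le_trans K1.
set S := index_enum 'S_n.
have cS : size S = n`! by rewrite -card_Sn -sum1_card -sum1_size big_mkcond.
have Kn := exprn_ge0 n K0; have fn : 0 <= n`!%:R :> R by rewrite ler0n.
apply: (bounded_lip_weaken (B := (size S)%:R * K ^+ n)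
  (L := (size S)%:R * (n%:R * K ^+ n))).
- rewrite cS /det_bound -mulrA ler_wpM2l // ler_peMl // ler1n //.
- rewrite cS /det_bound -mulrA ler_wpM2l // ler_wpM2r // ler_nat //.
rewrite /determinant; apply: bounded_lip_sum => s.
have [b l] : bounded_lip (K ^+ n) (n%:R * K ^+ n) (fun x => \prod_(i < n) M x i (s i)).
  have cI : size (index_enum 'I_n) = n.
    by rewrite -[RHS]card_ord -sum1_card -sum1_size [RHS]big_mkcond.
  by have := bounded_lip_prod (index_enum 'I_n) K1 (fun i => hM i (s i)); rewrite cI.
split=> *; rewrite ?[_ * _ - _]mulr_sign !mulr_sign; case: ifP => _; rewrite -?opprD ?normcN.
- exact: b.
- exact: b.
- by apply: l.
- by apply: l.
Qed.

End BoundedLipschitz.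

Section RegularizedInverse.
Variables (R : realType) (e : R).
Hypothesis e_gt0 : 0 < e.
Implicit Types z w : R[i].

Definition reg_inv z : R[i] := z^*%C * ((normc z ^+ 2 + e ^+ 2)^-1)%:C.

Let den_gt0 z : 0 < normc z ^+ 2 + e ^+ 2.
Proof. by rewrite ltr_wpDl ?exprn_ge0 ?normc_ge0 // exprn_gt0. Qed.

Lemma mul_reg_inv z :
  z * reg_inv z = (1 - e ^+ 2 / (normc z ^+ 2 + e ^+ 2))%:C.
Proof.
rewrite /reg_inv mulrA mul_conjc -rmorphM; congr (_%:C).
by field; rewrite gt_eqF.
Qed.

Lemma normc_reg_inv z : normc (reg_inv z) <= e^-1.
Proof.
rewrite Normc.normcM normc_conj normc_real ger0_norm ?invr_ge0 ?(ltW (den_gt0 z)) //.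
rewrite ler_pdivrMr // mulrC ler_pdivlMr //.
have := sqr_ge0 (normc z - e); have := normc_ge0 z; move: e_gt0.
by move: (normc z) => x; nra.
Qed.

(** Over the common denominator Z W the numerator is at most (|z w| + e^2) |z - w|, and e^2 (|z w| +
    e^2) <= Z W because |z w| <= |z|^2 + |w|^2. *)
Lemma reg_inv_lip z w : normc (reg_inv z - reg_inv w) <= normc (z - w) / e ^+ 2.
Proof.
set Z := normc z ^+ 2 + e ^+ 2; set W := normc w ^+ 2 + e ^+ 2.
have Z0 : 0 < Z := den_gt0 z; have W0 : 0 < W := den_gt0 w.
have -> : reg_inv z - reg_inv w =
    (z^*%C * w^*%C * (w - z) + (e ^+ 2)%:C * (z - w)^*%C) * ((Z * W)^-1)%:C.
  have cB : (z - w)^*%C = z^*%C - w^*%C by rewrite rmorphB.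
  have -> : z^*%C * w^*%C * (w - z) + (e ^+ 2)%:C * (z - w)^*%C
     = z^*%C * W%:C - w^*%C * Z%:C.
    by rewrite cB /W /Z !rmorphD /= -!mul_conjc; ring.
  have c0 (x : R) : 0 < x -> x%:C != 0 :> R[i] by move=> x0; rewrite fmorph_eq0 gt_eqF.
  rewrite /reg_inv -/Z -/W !fmorphV !rmorphM /=.
  by field; rewrite !c0.
rewrite Normc.normcM normc_real ger0_norm ?invr_ge0 ?mulr_ge0 ?(ltW Z0) ?(ltW W0) //.
rewrite ler_pdivrMr ?mulr_gt0 // (le_trans (ler_normcD _ _)) //.
rewrite !Normc.normcM !normc_conj normc_real ger0_norm ?exprn_ge0 ?(ltW e_gt0) //.
rewrite (normcBC w) -mulrDl [leLHS]mulrC -[leRHS]mulrA ler_wpM2l ?normc_ge0 //.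
rewrite [leRHS]mulrC ler_pdivlMr ?exprn_gt0 // /Z /W.
have := sqr_ge0 (normc z - normc w); have := normc_ge0 z; have := normc_ge0 w.
move: (normc z) (normc w) => x y y0 x0 xy.
have xy' : 0 <= x * y by rewrite mulr_ge0.
have e2 : 0 <= e ^+ 2 by rewrite sqr_ge0.
have h : x * y <= x ^+ 2 + y ^+ 2 by nra.
have := ler_wpM2l e2 h; have := sqr_ge0 (x * y); lra.
Qed.

End RegularizedInverse.

Section CoefficientFunctions.
Variables (R : realType) (f P : {poly R[i]}) (q r : nat) (K e : R).
Hypotheses (q_gt0 : (0 < q)%N) (coprime_rq : coprime r q).
Hypotheses (e_gt0 : 0 < e) (e_le1 : e <= 1) (K_ge1 : 1 <= K).
Hypotheses (fK : coef_norm f <= K)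
  (f'K : q%:R * coef_norm f + coef_norm f^`() <= K)
  (PK : coef_norm P <= K) (P'K : coef_norm P^`() <= K).
Implicit Types (s : R) (i k l u : nat).

(** Closed on the right, so that [period_prod] takes all values in [0, W] on it and every Bernstein
    node has a preimage. *)
Definition base_cell s := 0 <= s <= q%:R^-1.
Let qR : 0 < q%:R :> R. Proof. by rewrite ltr0n. Qed.
Let K0 : 0 <= K. Proof. exact: le_trans K_ge1. Qed.

Lemma node_itv i l s : base_cell s -> 0 <= node q r i l s <= 1.
Proof.
move=> /andP[s0 s1]; rewrite /node addr_ge0 ?divr_ge0 //=.
have : ((i + l * r) %% q)%:R + 1 <= q%:R :> R by rewrite natr1 ler_nat ltn_pmod.
rewrite -(ler_pM2r (_ : 0 < q%:R^-1)) ?invr_gt0 // mulfV ?gt_eqF // mulrDl mul1r.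
by move: (_ / q%:R) => a; lra.
Qed.

Lemma node_dist i l s s' : node q r i l s - node q r i l s' = s - s'.
Proof. by rewrite /node; ring. Qed.

Lemma prod_dist n (x y : nat -> R) (d : R) :
  (forall l, (l < n)%N -> 0 <= x l <= 1) -> (forall l, (l < n)%N -> 0 <= y l <= 1) ->
  (forall l, (l < n)%N -> `|x l - y l| <= d) ->
  `|\prod_(l < n) x l - \prod_(l < n) y l| <= n%:R * d.
Proof.
elim: n => [|n IH] x01 y01 xy; first by rewrite !big_ord0 subrr normr0 mul0r.
rewrite !big_ord_recr /=; set a := \prod_(l < n) x l; set b := \prod_(l < n) y l.
have h : `|a - b| <= n%:R * d by apply: IH => l ln; [apply: x01|apply: y01|apply: xy]; rewrite ltnW.
have b1 : `|b| <= 1.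
  rewrite ger0_norm; first by apply: prodr_ile1 => l _; apply: y01; apply: ltnW (ltn_ord l).
  by apply: prodr_ge0 => l _; have /andP[] := y01 l (ltnW (ltn_ord l)).
have x1 : `|x n| <= 1 by have /andP[? ?] := x01 n (ltnSn n); rewrite ger0_norm.
have -> : a * x n - b * y n = (a - b) * x n + b * (x n - y n) by ring.
rewrite (le_trans (ler_normD _ _)) // !normrM -natr1 mulrDl mul1r lerD //.
  by rewrite (le_trans _ h) // ler_piMr.
by rewrite (le_trans _ (xy n (ltnSn n))) // ler_piMl.
Qed.

Lemma prod_itv n (x : nat -> R) : (forall l, (l < n)%N -> 0 <= x l <= 1) ->
  0 <= \prod_(l < n) x l <= 1.
Proof.
move=> x01; rewrite prodr_ge0 => [|l _]; last by have /andP[] := x01 l (ltn_ord l).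
by apply: prodr_ile1 => l _; apply: x01.
Qed.

Lemma unit_normc (x : R) : 0 <= x <= 1 -> normc x%:C <= 1.
Proof. by case/andP=> *; rewrite normc_real ger0_norm. Qed.

(** Serves twice: for the Lipschitz constant of an iterate in s, and for comparing the iterates of
    parameter alpha with those of parameter r/q. *)
Lemma weighted_value_dist n (x y : R) (a b d : R) :
  0 <= a <= 1 -> 0 <= b <= 1 -> 0 <= x <= 1 -> 0 <= y <= 1 ->
  `|a - b| <= n%:R * d -> `|x - y| <= d ->
  normc (a%:C * f.[x%:C] - b%:C * f.[y%:C])
    <= (n%:R * coef_norm f + coef_norm f^`()) * d.
Proof.
move=> a01 b01 x01 y01 ab xy.
have -> : a%:C * f.[x%:C] - b%:C * f.[y%:C] =
   (a - b)%:C * f.[x%:C] + b%:C * (f.[x%:C] - f.[y%:C]) by rewrite rmorphB; ring.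
rewrite (le_trans (ler_normcD _ _)) // !Normc.normcM mulrDl lerD //.
  rewrite mulrAC ler_pM ?normc_ge0 ?normc_real ?normc_horner_le ?unit_normc //.
rewrite (@le_trans _ _ (normc (f.[x%:C] - f.[y%:C]))) //.
  by rewrite ler_piMl ?normc_ge0 // unit_normc.
rewrite (le_trans (normc_horner_lip _ _ _)) ?unit_normc //.
by rewrite ler_wpM2l ?coef_norm_ge0 // -rmorphB normc_real.
Qed.

Lemma bounded_lip_rat_iter i k : (k <= q)%N ->
  bounded_lip base_cell K K (rat_iter f q r k i).
Proof.
move=> kq; have prod01 s : base_cell s -> 0 <= \prod_(l < k) node q r i l s <= 1.
  by move=> ds; apply: (prod_itv (x := fun l => node q r i l s)) => l _; apply: node_itv.
split=> [s ds|s s' ds ds'].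
  rewrite Normc.normcM -[K]mul1r ler_pM ?normc_ge0 ?unit_normc ?prod01 //.
  by rewrite (le_trans (normc_horner_le _ _)) ?unit_normc ?node_itv.
apply: le_trans (weighted_value_dist (n := k) (d := `|s - s'|) _ _ _ _ _ _) _.
- exact: prod01.
- exact: prod01.
- exact: node_itv.
- exact: node_itv.
- apply: (prod_dist (x := fun l => node q r i l s) (y := fun l => node q r i l s')).
  + by move=> l _; exact: node_itv.
  + by move=> l _; exact: node_itv.
  + by move=> l _; rewrite node_dist.
- by rewrite node_dist.
- rewrite ler_wpM2r // (le_trans _ f'K) // lerD2r ler_wpM2r ?coef_norm_ge0 //.
  by rewrite ler_nat.
Qed.

Let X := det_bound K q.
Let X1 : 1 <= X. Proof. exact: det_bound_ge1. Qed.
Let X0 : 0 <= X. Proof. exact: le_trans X1. Qed.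

Lemma bounded_lip_orbit_det : bounded_lip base_cell X X (fun s => \det (orbit_mx f q r s)).
Proof.
apply: bounded_lip_det => // i j.
have [b l] := bounded_lip_rat_iter (start q r j) (ltnW (ltn_ord i)).
by split=> *; rewrite !mxE; [apply: b|apply: l].
Qed.

Lemma bounded_lip_orbit_adj (i j : 'I_q) :
  bounded_lip base_cell X X (fun s => (\adj (orbit_mx f q r s)) i j).
Proof.
have [b l] : bounded_lip base_cell X X
    (fun s => \det (row' j (col' i (orbit_mx f q r s)))).
  have h : det_bound K q.-1 <= X by apply: det_bound_le => //; apply: leq_pred.
  apply: (bounded_lip_weaken h h); apply: bounded_lip_det => // u v.
  have [b l] := bounded_lip_rat_iter (start q r (lift i v)) (ltnW (ltn_ord (lift j u))).
  by split=> *; rewrite !mxE; [apply: b|apply: l].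
split=> *; rewrite !mxE /cofactor.
  by rewrite -signr_odd mulr_sign; case: ifP => _; rewrite ?normcN; apply: b.
by rewrite -mulrBr -signr_odd mulr_sign; case: ifP => _; rewrite ?normcN; apply: l.
Qed.

(* Cramer's formula for sum_k c_k T^k f = P, with 1/det replaced by [reg_inv]. *)
Definition coef_fun (k : 'I_q) s : R[i] :=
  (\sum_(u < q) P.[(node q r (start q r u) 0 s)%:C] * (\adj (orbit_mx f q r s)) u k)
  * reg_inv e (\det (orbit_mx f q r s)).

(** The adjugate times the matrix is the scalar D, so the only defect is D [reg_inv] D in place of
    1. It is substantial only where |D| is not large compared with e. *)
Lemma coef_fun_mul (u : 'I_q) s :
  \sum_(k < q) coef_fun k s * rat_iter f q r k (start q r u) s =
  (1 - e ^+ 2 / (normc (\det (orbit_mx f q r s)) ^+ 2 + e ^+ 2))%:C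
  * P.[(node q r (start q r u) 0 s)%:C].
Proof.
rewrite -mul_reg_inv //; set D := \det _; set A := orbit_mx f q r s.
pose g := \row_(v < q) P.[(node q r (start q r v) 0 s)%:C].
have -> : \sum_(k < q) coef_fun k s * rat_iter f q r k (start q r u) s =
   reg_inv e D * (g *m \adj A *m A) 0 u.
  rewrite [(_ *m A) 0 u]mxE mulr_sumr; apply: eq_bigr => k _.
  rewrite /coef_fun [A k u]mxE mulrAC -/A -/D mulrC; congr (_ * (_ * _)).
  by rewrite [RHS]mxE; apply: eq_bigr => v _; rewrite [g _ _]mxE.
rewrite -mulmxA mul_adj_mx mul_mx_scalar mxE [g 0 u]mxE -/D.
by rewrite mulrA [D * _]mulrC.
Qed.

(** The product rule gives q K X (2/e + X/e^2); the factor 3 comes from 1/e <= X/e^2, valid as e <=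
    1 <= X. *)
Lemma bounded_lip_coef_fun (k : 'I_q) : bounded_lip base_cell
  (q%:R * K * X / e) (3 * q%:R * K * X ^+ 2 / e ^+ 2) (coef_fun k).
Proof.
have hg (u : 'I_q) : bounded_lip base_cell K K
    (fun s => P.[(node q r (start q r u) 0 s)%:C]).
  split=> [s ds|s s' ds ds'].
    by rewrite (le_trans (normc_horner_le _ _)) ?unit_normc ?node_itv.
  rewrite (le_trans (normc_horner_lip _ _ _)) ?unit_normc ?node_itv //.
  by rewrite -rmorphB normc_real node_dist ler_wpM2r.
have hsum := bounded_lip_sum (index_enum 'I_q)
  (fun u : 'I_q => bounded_lipM K0 X0 K0 (hg u) (bounded_lip_orbit_adj u k)).
have cI : size (index_enum 'I_q) = q.
  by rewrite -[RHS]card_ord -sum1_card -sum1_size [RHS]big_mkcond.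
rewrite cI in hsum.
have hreg : bounded_lip base_cell e^-1 (X / e ^+ 2)
    (fun s => reg_inv e (\det (orbit_mx f q r s))).
  have [b l] := bounded_lip_orbit_det.
  split=> [s ds|s s' ds ds']; first exact: normc_reg_inv.
  apply: le_trans (reg_inv_lip _ _ _) _ => //.
  by rewrite mulrAC ler_wpM2r ?invr_ge0 ?exprn_ge0 ?(ltW e_gt0) // l.
have e0 : 0 <= e^-1 by rewrite invr_ge0 ltW.
have qKX : 0 <= q%:R * (K * X) by exact: mulr_ge0 (ler0n _ _) (mulr_ge0 K0 X0).
have qKX2 : 0 <= q%:R * (K * X + K * X).
  by exact: mulr_ge0 (ler0n _ _) (addr_ge0 (mulr_ge0 K0 X0) (mulr_ge0 K0 X0)).
apply: bounded_lip_weaken (bounded_lipM qKX e0 qKX2 hsum hreg).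
  by rewrite !mulrA lexx.
have -> : 3 * q%:R * K * X ^+ 2 / e ^+ 2 =
   q%:R * K * X * (2 * (X / e ^+ 2) + X / e ^+ 2) by field; rewrite gt_eqF.
have -> : q%:R * (K * X + K * X) / e + q%:R * (K * X) * (X / e ^+ 2) =
   q%:R * K * X * (2 * e^-1 + X / e ^+ 2) by field; rewrite gt_eqF.
rewrite -(mulrA q%:R) ler_wpM2l // lerD2r ler_wpM2l //.
rewrite ler_pdivlMr ?exprn_gt0 // expr2 mulKf ?gt_eqF //.
exact: le_trans e_le1 X1.
Qed.

End CoefficientFunctions.

(** * The set where the determinant is small *)

Section SmallDenominator.
Variables (R : realType) (q : nat).
Hypothesis q_gt0 : (0 < q)%N.
Implicit Types (s t rho x : R) (j J : nat).
Let qR : 0 < q%:R :> R. Proof. by rewrite ltr0n. Qed.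

(** At t = 1 the index is q, so the cells to be counted over [0,1] are q + 1. *)
Definition cell_index t : nat := Num.truncn (q%:R * t).
Definition cell_pos t : R := t - (cell_index t)%:R / q%:R.

Lemma cell_posE t : t = cell_pos t + (cell_index t)%:R / q%:R.
Proof. by rewrite subrK. Qed.

Lemma cell_index_itv t : 0 <= t ->
  (cell_index t)%:R <= q%:R * t < (cell_index t)%:R + 1.
Proof. by move=> t0; rewrite natr1 truncn_itv // mulr_ge0. Qed.

Lemma cell_pos_ge0 t : 0 <= t -> 0 <= cell_pos t.
Proof.
by move=> t0; rewrite subr_ge0 ler_pdivrMr // mulrC; have /andP[] := cell_index_itv t0.
Qed.

Lemma cell_pos_lt t : 0 <= t -> cell_pos t < q%:R^-1.
Proof.
move=> t0; rewrite ltrBlDr.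
have -> : q%:R^-1 + (cell_index t)%:R / q%:R = ((cell_index t)%:R + 1) / q%:R :> R.
  by field; rewrite gt_eqF.
rewrite ltr_pdivlMr // mulrC.
by have /andP[] := cell_index_itv t0.
Qed.

Lemma cell_index_lt t : 0 <= t -> t < 1 -> (cell_index t < q)%N.
Proof.
move=> t0 t1; rewrite -(ltr_nat R); have /andP[h _] := cell_index_itv t0.
by apply: le_lt_trans h _; rewrite gtr_pMr.
Qed.

Lemma cell_index_le t : 0 <= t <= 1 -> (cell_index t <= q)%N.
Proof.
case/andP=> t0 t1; rewrite -(ler_nat R); have /andP[h _] := cell_index_itv t0.
by apply: le_trans h _; rewrite ger_pMr.
Qed.

(** Here rho is the modulus of a root: for real s >= 0 one has |s - z| >= |s - |z||, so only moduli
    matter. *)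
Definition near_root rho j t : bool := `|1 - cell_pos t / rho| <= 4^-1 ^+ j.

(** The bound is uniform in rho and q. If rho > 4/(3q), then s/rho < 3/4 on the whole cell and the
    set is empty. Otherwise it is covered by q + 1 intervals of length 2 rho 4^(-j), and rho (q + 1)
    <= 3. *)
Lemma uint_le_near_root rho j : 0 < rho -> (0 < j)%N ->
  uint_le (fun t => (near_root rho j t)%:R) (6 * 4^-1 ^+ j).
Proof.
move=> rho0 j0; have j4 : 4^-1 ^+ j <= 4^-1 :> R.
  by case: j j0 => // j _; rewrite exprS ler_piMr // exprn_ile1 // invf_le1 // ler1n.
have j40 : 0 <= 4^-1 ^+ j :> R by rewrite exprn_ge0.
have [rho_big|rho_small] := ltP (4 / (3 * q%:R)) rho.
  apply: uint_le_cst => [|t /andP[t0 _]]; first by rewrite mulr_ge0.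
  suff -> : near_root rho j t = false by rewrite mulr_ge0.
  apply/negP; rewrite /near_root => /ler_normlP[_].
  have h : cell_pos t / rho < 3 / 4.
    rewrite ltr_pdivrMr // (lt_le_trans (cell_pos_lt t0)) //.
    have := ltW rho_big; rewrite ler_pdivrMr ?mulr_gt0 // => h.
    by rewrite -[q%:R^-1]mul1r ler_pdivrMr //; lra.
  by move: h j4; move: (_ / rho) (_ ^+ j) => a b; lra.
apply: (uint_le_weaken (F1 := fun t => \sum_(i < q.+1)
    (`|t - (i%:R / q%:R + rho)| <= rho * 4^-1 ^+ j)%R%:R)
  (v1 := \sum_(i < q.+1) 2 * (rho * 4^-1 ^+ j))).
- move=> t t01; case: (boolP (near_root rho j t)) => [h|_]; last by rewrite sumr_ge0.
  rewrite (bigD1 (Ordinal (cell_index_le t01 : (cell_index t < q.+1)%N))) //=.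
  rewrite {1}(_ : (`|_| <= _)%R = true) ?lerDl ?sumr_ge0 //.
  have -> : t - ((cell_index t)%:R / q%:R + rho) = - rho * (1 - cell_pos t / rho).
    by rewrite {1}(cell_posE t); field; rewrite !gt_eqF.
  by rewrite normrM normrN (gtr0_norm rho0) ler_wpM2l // ltW.
- rewrite sumr_const card_ord -[leLHS]mulr_natr -[6](_ : 2 * (3 : R) = _); last by ring.
  rewrite -!mulrA ler_wpM2l // mulrCA mulrC ler_wpM2r //.
  have q1 : 1 <= q%:R :> R by rewrite ler1n.
  apply: (@le_trans _ _ (4 / (3 * q%:R) * q.+1%:R)); first by rewrite ler_wpM2r.
  by rewrite mulrAC ler_pdivrMr ?mulr_gt0 // -natr1; lra.
- by apply: uint_le_sum => i _; apply: uint_le_ball; rewrite mulr_ge0 // ltW.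
Qed.

Definition root_weight rho J t : R :=
  3 + \sum_(1 <= j < J) 2 ^+ j.+1 * (near_root rho j t)%:R.

Lemma root_weight_ge3 rho J t : 3 <= root_weight rho J t.
Proof. by rewrite lerDl sumr_ge0 // => j _; rewrite mulr_ge0 ?exprn_ge0. Qed.

(** If |1 - s/rho| lies between 4^(-j-1) and 4^(-j), the term of index j already contributes
    2^(j+1), whose square is 4^(j+1); for j = 0 the constant 3 suffices. *)
Lemma root_weightP rho J t : ~~ near_root rho J t ->
  1 <= `|1 - cell_pos t / rho| * root_weight rho J t ^+ 2.
Proof.
rewrite /near_root -ltNge; set x := `|_| => xJ.
have x0 : 0 <= x by apply: normr_ge0.
have w0 J' : 0 <= root_weight rho J' t by apply: le_trans (root_weight_ge3 _ _ _).
elim: J xJ => [|J IH] xJ.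
  rewrite expr0 in xJ; have := root_weight_ge3 rho 0 t.
  by move: (root_weight _ _ _) => w w3; nra.
have [xJ'|xJ'] := ltP (4^-1 ^+ J) x.
  apply: le_trans (IH xJ') _; rewrite ler_wpM2l // ler_pXn2r ?nnegrE ?w0 //.
  rewrite /root_weight lerD2l; case: J {IH xJ xJ'} => [|J].
    by rewrite !big_geq.
  by rewrite [leRHS]big_nat_recr //= lerDl mulr_ge0 ?exprn_ge0.
have wJ : 2 ^+ J.+1 <= root_weight rho J.+1 t.
  case: J {IH} xJ xJ' => [|J] xJ xJ'.
    by have := root_weight_ge3 rho 1 t; rewrite expr1; lra.
  rewrite /root_weight big_nat_recr //= {2}/near_root xJ' mulr1 addrA.
  rewrite lerDr addr_ge0 // sumr_ge0 // => j _; rewrite mulr_ge0 ?exprn_ge0 //.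
apply: (@le_trans _ _ (4^-1 ^+ J.+1 * (2 ^+ J.+1) ^+ 2)).
  have e1 : 4^-1 * 2 ^+ 2 = 1 :> R by field.
  by rewrite exprAC -exprMn e1 expr1n.
by rewrite ler_pM ?exprn_ge0 ?(ltW xJ) // ler_pXn2r ?nnegrE ?exprn_ge0 ?w0.
Qed.

(** The weight 2^(j+1) sits on a set of measure at most 6 * 4^(-j), so the total is below 3 + 12
    whatever J is. The exponent 1/2 is what makes this series converge. *)
Lemma uint_le_root_weight rho J : 0 < rho -> uint_le (root_weight rho J) 15.
Proof.
move=> rho0; apply: (uint_le_weaken (F1 := root_weight rho J)
   (v1 := 3 + \sum_(1 <= j < J) 12 * 2^-1 ^+ j)) => //.
- have h n : \sum_(1 <= j < n.+1) 12 * 2^-1 ^+ j = 12 * (1 - 2^-1 ^+ n) :> R.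
    elim: n => [|n IH]; first by rewrite big_geq // expr0; ring.
    by rewrite big_nat_recr //= IH !exprS; field.
  case: J => [|J]; first by rewrite big_geq //; lra.
  rewrite h; have : 0 <= 2^-1 ^+ J :> R by rewrite exprn_ge0.
  lra.
- apply: uint_le_add; first exact: uint_le_cst.
  apply: uint_le_sum => j; rewrite mem_index_iota => /andP[j0 _].
  have -> : 12 * 2^-1 ^+ j = 2 ^+ j.+1 * (6 * 4^-1 ^+ j) :> R.
    rewrite (_ : 4^-1 = 2^-1 * 2^-1); last by field.
    rewrite exprMn exprS; set y := 2^-1 ^+ j.
    have -> : 2 * 2 ^+ j * (6 * (y * y)) = 12 * y * (2 ^+ j * y) by ring.
    by rewrite /y -exprMn mulfV ?expr1n ?mulr1.
  by apply: uint_le_scale (uint_le_near_root _ _); rewrite ?exprn_ge0.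
Qed.

Lemma AGM_seq (ws : seq R) : all (fun x => 0 <= x) ws ->
  \prod_(x <- ws) x <= ((\sum_(x <- ws) x) / (size ws)%:R) ^+ size ws.
Proof.
move=> ws0; rewrite (big_nth 0) big_mkord (big_nth 0) big_mkord.
have E0 : {in 'I_(size ws), forall i : 'I_(size ws), 0 <= ws`_i}.
  by move=> i _; move/allP: ws0; apply; rewrite mem_nth.
by have [] := leif_AGM E0; rewrite card_ord.
Qed.

(** Padding with ones makes the exponent the degree bound k instead of the unknown number of
    roots. *)
Lemma AGM_pad (T : Type) (rs : seq T) (W : T -> R) k : (size rs <= k)%N ->
  (forall z, 0 <= W z) ->
  \prod_(z <- rs) W z <= ((\sum_(z <- rs) W z + (k - size rs)%:R) / k%:R) ^+ k.
Proof.
move=> rsk W0; set ws := [seq W z | z <- rs] ++ nseq (k - size rs) 1.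
have sw : size ws = k by rewrite size_cat size_map size_nseq subnKC.
have p1 n : \prod_(x <- nseq n (1 : R)) x = 1.
  by elim: n => [|n IH]; rewrite ?big_nil // big_cons IH mulr1.
have s1 n : \sum_(x <- nseq n (1 : R)) x = n%:R.
  by elim: n => [|n IH]; rewrite ?big_nil // big_cons IH addrC natr1.
have := @AGM_seq ws; rewrite sw !big_cat /= !big_map p1 s1 mulr1; apply.
rewrite all_cat all_nseq ler01 orbT andbT all_map.
by elim: (rs) => //= z l ->; rewrite W0.
Qed.

(* Cartan-type estimate, by AM-GM applied to the integrable weights [root_weight], which
   dominate |1 - s/|z|| ^ (-1/2) at the roots z of D. *)
Lemma uint_le_small_denominator (D : {poly R[i]}) (k : nat) (b e theta : R) :
  (0 < k)%N -> (size D <= k.+1)%N -> 0 < b -> b <= normc D.[0] -> 0 < e ->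
  1 <= theta -> e * theta ^+ (2 * k) <= b ->
  uint_le (fun t => e ^+ 2 / (normc D.[(cell_pos t)%:C] ^+ 2 + e ^+ 2))
    (15 / theta + 6 / k%:R).
Proof.
move=> k0 sD b0 bD e0 th1 eb; have th0 : 0 < theta by apply: lt_le_trans th1.
have kR : 0 < k%:R :> R by rewrite ltr0n.
have D00 : D.[0] != 0.
  by apply/eqP => h; move: bD; rewrite h Normc.normc0; lra.
have [rs DE] := closed_field_poly_normal D.
have lc0 : lead_coef D != 0.
  by rewrite lead_coef_eq0; apply: contraNneq D00 => ->; rewrite horner0.
have rsk : (size rs <= k)%N.
  by move: sD; rewrite DE size_scale // size_prod_XsubC ltnS.
have hE z : D.[z] = lead_coef D * \prod_(w <- rs) (z - w).
  rewrite {1}DE hornerZ horner_prod; congr (_ * _); apply: eq_bigr => w _.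
  by rewrite hornerXsubC.
have rs0 z : z \in rs -> 0 < normc z.
  move=> zrs; rewrite lt_def normc_ge0 andbT; apply: contraNneq D00 => /Normc.eq0_normc z0.
  by rewrite hE (big_rem z) //= z0 subrr mul0r mulr0.
(* Dividing D(s) by D(0) removes the leading coefficient, and each factor |s - z| / |z| is at least
   |1 - s/|z||. *)
have ratio s : 0 <= s -> b * \prod_(z <- rs) `|1 - s / normc z| <= normc D.[s%:C].
  move=> s0.
  apply: (@le_trans _ _ (normc D.[0] * \prod_(z <- rs) `|1 - s / normc z|)).
    by rewrite ler_wpM2r // prodr_ge0.
  rewrite !hE !Normc.normcM -mulrA ler_wpM2l ?normc_ge0 // !normc_prod -big_split /=.
  rewrite big_seq [leRHS]big_seq; apply: ler_prod => z zrs.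
  rewrite mulr_ge0 ?normc_ge0 //= sub0r normcN -{1}[normc z]ger0_norm ?normc_ge0 //.
  rewrite -normrM mulrBr mulr1 mulrCA mulfV ?mulr1 ?gt_eqF ?rs0 //.
  have sE : normc s%:C = s by rewrite normc_real ger0_norm.
  rewrite ler_norml; apply/andP; split.
    by have := lerB_normc s%:C z; rewrite sE; lra.
  by have := lerB_normc z s%:C; rewrite normcBC sE; lra.
pose A t := (\sum_(z <- rs) root_weight (normc z) k t + (k - size rs)%:R) / k%:R.
pose N t := \sum_(z <- rs) (near_root (normc z) k t)%:R : R.
have A0 t : 0 <= A t.
  rewrite divr_ge0 // addr_ge0 // sumr_ge0 // => z _.
  by apply: le_trans (root_weight_ge3 _ _ _).
apply: (uint_le_weaken (F1 := fun t => theta^-1 * A t + N t)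
  (v1 := theta^-1 * (k%:R^-1 * (\sum_(z <- rs) 15 + (k - size rs)%:R))
         + \sum_(z <- rs) 6 * 4^-1 ^+ k)).
- move=> t /andP[t0 t1]; set d := normc _.
  have d0 : 0 <= d by apply: normc_ge0.
  have den0 : 0 < d ^+ 2 + e ^+ 2 by rewrite ltr_wpDl ?exprn_ge0 ?exprn_gt0.
  have E1 : e ^+ 2 / (d ^+ 2 + e ^+ 2) <= 1.
    by rewrite ler_pdivrMr // mul1r lerDr exprn_ge0.
  (* Next to a root, or where the mean weight A exceeds theta, the trivial bound 1 is already
     dominated by N or A/theta. *)
  have [near|far] := boolP (has (fun z => near_root (normc z) k t) rs).
    move: near => /hasP[z zrs /= zn]; apply: le_trans E1 _.
    have TA0 : 0 <= theta^-1 * A t by apply: mulr_ge0 => //; rewrite invr_ge0 ltW.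
    by rewrite ler_wpDl // /N (big_rem z) //= zn lerDl sumr_ge0.
  rewrite ler_wpDr ?sumr_ge0 //.
  have [thA|Ath] := leP theta (A t).
    by apply: le_trans E1 _; rewrite mulrC ler_pdivlMr // mul1r.
  have amgm : \prod_(z <- rs) root_weight (normc z) k t <= A t ^+ k.
    apply: AGM_pad => // z; by apply: le_trans (root_weight_ge3 _ _ _).
  have w0 z : 0 <= root_weight (normc z) k t by apply: le_trans (root_weight_ge3 _ _ _).
  have one : 1 <= \prod_(z <- rs) `|1 - cell_pos t / normc z| * A t ^+ (2 * k).
    rewrite mulnC exprM.
    apply: (@le_trans _ _ (\prod_(z <- rs) (`|1 - cell_pos t / normc z|
         * root_weight (normc z) k t ^+ 2))).
      apply: (@le_trans _ _ (\prod_(z <- rs | z \in rs) 1)); first by rewrite big1.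
      rewrite [leRHS]big_seq; apply: ler_prod => z zrs; rewrite ler01 root_weightP //.
      by move/hasPn: far; apply.
    rewrite big_split /= ler_wpM2l ?prodr_ge0 // prodrXl.
    by rewrite ler_pXn2r ?nnegrE ?exprn_ge0 ?prodr_ge0.
  have bd : b <= d * A t ^+ (2 * k).
    have := ratio _ (cell_pos_ge0 t0); rewrite -/d => h.
    apply: le_trans (_ : b * (\prod_(z <- rs) `|1 - cell_pos t / normc z| * A t ^+ (2 * k)) <= _).
      by rewrite ler_peMr ?(ltW b0).
    by rewrite mulrA ler_wpM2r ?exprn_ge0.
  have Apos : 0 < A t.
    rewrite lt_def A0 andbT; apply/eqP => Az; move: bd.
    by rewrite Az expr0n muln_eq0 /= eqn0Ngt k0 /= mulr0; lra.
  have dpos : 0 < d.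
    rewrite lt_def d0 andbT; apply/eqP => dz; move: bd; rewrite dz mul0r; lra.
  have ed : e <= d * (A t / theta) ^+ (2 * k).
    rewrite expr_div_n mulrA ler_pdivlMr ?exprn_gt0 //.
    exact: le_trans eb bd.
  have small : (A t / theta) ^+ (2 * k) <= A t / theta.
    have r1 : A t / theta <= 1 by rewrite ler_pdivrMr // mul1r ltW.
    have r0 : 0 <= A t / theta by apply: divr_ge0 (A0 t) (ltW th0).
    by rewrite -[leRHS]expr1 ler_wiXn2l // muln_gt0.
  have ed' : e <= d * (theta^-1 * A t).
    by apply: le_trans ed _; rewrite ler_wpM2l // [leRHS]mulrC.
  rewrite ler_pdivrMr // mulrDr.
  have x0 : 0 <= theta^-1 * A t by rewrite mulr_ge0 ?invr_ge0 ?(ltW th0).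
  move: x0 ed'; move: (theta^-1 * A t) => x x0 ed'.
  have : e ^+ 2 <= e * (d * x) by rewrite expr2 ler_wpM2l // ltW.
  have : 0 <= x * (d ^+ 2 + e ^+ 2 - e * d).
    rewrite mulr_ge0 //; have := sqr_ge0 (d - e); have := sqr_ge0 e; have := sqr_ge0 d; nra.
  lra.
- rewrite lerD //.
    rewrite [leRHS]mulrC ler_wpM2l ?invr_ge0 ?(ltW th0) // mulrC ler_pdivrMr //.
    rewrite -{2}(subnKC rsk) natrD mulrDr lerD //.
      by rewrite big_const_seq count_predT iter_addr_0 mulr_natr.
    by rewrite ler_peMl // ler1n.
  (* At most k roots, each costing 6 * 4^(-k), and k^2 <= 4^k. *)
  rewrite big_const_seq count_predT iter_addr_0 -[leLHS]mulr_natr -mulrA ler_wpM2l //.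
  rewrite exprVn mulrC ler_pdivrMr ?exprn_gt0 // ler_pdivlMl //.
  rewrite -natrM -natrX ler_nat -[4%N]/(2 * 2)%N expnMn.
  by rewrite leq_mul // ?(leq_trans rsk) // ltnW // ltn_expl.
- apply: uint_le_add; last first.
    by apply: uint_le_sum => z /rs0 z0; apply: uint_le_near_root.
  apply: uint_le_scale; first by rewrite invr_ge0 ltW.
  apply: (uint_le_weaken (F1 := fun t => k%:R^-1 *
    (\sum_(z <- rs) root_weight (normc z) k t + (k - size rs)%:R))) (lexx _) _.
    by move=> t _; rewrite /A mulrC.
  apply: uint_le_scale; first by rewrite invr_ge0 ltW.
  apply: uint_le_add; last exact: uint_le_cst.
  by apply: uint_le_sum => z /rs0 z0; apply: uint_le_root_weight.
Qed.

End SmallDenominator.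

(** * Approximation for a fixed denominator *)

Section PeriodProduct.
Variables (R : realType) (q : nat).
Hypothesis q_gt0 : (0 < q)%N.
Implicit Types s : R.
Let qR : 0 < q%:R :> R. Proof. by rewrite ltr0n. Qed.
Let W : R := W_ R q.

Lemma W_gt0 : 0 < W.
Proof. by rewrite divr_gt0 ?exprn_gt0 // ltr0n fact_gt0. Qed.

Let v s : R := \prod_(j < q.-1) (s + j.+1%:R / q%:R).

Lemma period_prodE s : period_prod q s = s * v s.
Proof.
rewrite /period_prod /v; case: q q_gt0 => // m _.
by rewrite big_ord_recl mul0r addr0.
Qed.

Lemma period_prod_end : period_prod q q%:R^-1 = W.
Proof.
rewrite /W /W_ fact_prod /period_prod natr_prod; move: qR; move: q => m mR.
rewrite (eq_bigr (fun j : 'I_m => j.+1%:R * m%:R^-1)); last first.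
  by move=> j _; rewrite -natr1 mulrDl mul1r addrC.
rewrite big_split /= prodr_const card_ord exprVn; congr (_ * _).
by rewrite big_add1 /= big_mkord.
Qed.

Lemma cofactor_prod0 : v 0 = W.
Proof.
have := period_prod_end; rewrite /W /W_ /v; case: q q_gt0 qR => // m _ mR _.
rewrite factS natrM exprS -mulf_div divff ?gt_eqF // mul1r /=.
rewrite (eq_bigr (fun j : 'I_m => j.+1%:R * m.+1%:R^-1)); last by move=> j _; rewrite add0r.
rewrite big_split /= prodr_const card_ord exprVn; congr (_ * _).
by rewrite fact_prod natr_prod big_add1 /= big_mkord.
Qed.

Lemma cofactor_prod_le s s' : 0 <= s' -> s' <= s -> v s' <= v s.
Proof.
move=> s0 ss; apply: ler_prod => j _; rewrite lerD2r ss andbT.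
by rewrite addr_ge0 // divr_ge0.
Qed.

(** The product is s v(s) with v increasing and v(0) = W, so its slope is at least W. Hence s is a
    1-Lipschitz function of the rescaled variable w/W, and no Lipschitz constant is lost in passing
    to it. *)
Lemma period_prod_slope s s' : 0 <= s -> 0 <= s' ->
  `|s - s'| * W <= `|period_prod q s - period_prod q s'|.
Proof.
wlog ss : s s' / s' <= s => [hw|] s0 s'0.
  have [/hw|/ltW ss] := leP s' s; first exact.
  by rewrite distrC [leRHS]distrC hw.
have vs := cofactor_prod_le s'0 ss.
have Wv : W <= v s by rewrite -cofactor_prod0; apply: cofactor_prod_le.
have h : (s - s') * W <= period_prod q s - period_prod q s'.
  rewrite !period_prodE; have ss0 : 0 <= s - s' by rewrite subr_ge0.
  by have := ler_wpM2l ss0 Wv; have := ler_wpM2l s'0 vs; lra.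
rewrite ger0_norm ?subr_ge0 //; apply: le_trans h _; exact: ler_norm.
Qed.

Lemma period_prod_itv s : base_cell q s -> 0 <= period_prod q s <= W.
Proof.
case/andP=> s0 s1; rewrite -period_prod_end; apply/andP; split.
  by apply: prodr_ge0 => j _; rewrite addr_ge0 // divr_ge0.
by apply: ler_prod => j _; rewrite lerD2r s1 andbT addr_ge0 // divr_ge0.
Qed.

Lemma period_prod_ivt y : 0 <= y <= W ->
  exists2 s, base_cell q s & period_prod q s = y.
Proof.
case/andP=> y0 yW.
pose w : {poly R} := \prod_(j < q) ('X + (j%:R / q%:R)%:P) - y%:P.
have wE s : w.[s] = period_prod q s - y.
  rewrite hornerD hornerN hornerC horner_prod; congr (_ - _).
  by apply: eq_bigr => j _; rewrite !hornerE.
have h1 : 0 <= q%:R^-1 :> R by rewrite invr_ge0.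
have h2 : w.[0] <= 0 <= w.[q%:R^-1].
  by rewrite !wE period_prod_end period_prodE mul0r sub0r oppr_le0 y0 subr_ge0.
have [s s01 /rootP ws] := poly_ivt h1 h2.
by exists s => //; move: ws; rewrite wE; lra.
Qed.

End PeriodProduct.

Section BishopIterates.
Variables (R : realType) (f : {poly R[i]}) (alpha : R).
Local Notation F := (fun t : R => f.[t%:C]).
Implicit Types (t : R) (m : nat).

(** The point t = 1 is excluded because [frac] sends it to 0. *)
Lemma iter_bishopE m t : 0 <= t < 1 -> iter m (bishop alpha) F t =
  (\prod_(l < m) frac (t + l%:R * alpha))%:C * f.[(frac (t + m%:R * alpha))%:C].
Proof.
elim: m t => [|m IH] t /andP[t0 t1].
  by rewrite big_ord0 mul1r mul0r addr0 frac_id.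
rewrite iterS /bishop IH; last by rewrite frac_ge0 frac_lt1.
rewrite big_ord_recl mul0r addr0 (frac_id t0 t1) rmorphM /= -mulrA; congr (_ * (_%:C * _)).
  by apply: eq_bigr => l _; rewrite frac_fracD /bump /= -addrA add1n -natr1; congr frac; ring.
by rewrite frac_fracD -addrA -natr1; congr (_.[(frac _)%:C]); ring.
Qed.

Lemma normc_iter_bishop m t : 0 <= t <= 1 ->
  normc (iter m (bishop alpha) F t) <= coef_norm f.
Proof.
elim: m t => [|m IH] t t01 /=; first by rewrite normc_horner_le ?unit_normc.
rewrite /bishop Normc.normcM (le_trans _ (IH (frac (t + alpha)) _)) //.
  by rewrite ler_piMl ?normc_ge0 ?unit_normc.
by rewrite frac_ge0 ltW ?frac_lt1.
Qed.

Lemma linear_span_fin (S : set (R -> R[i])) (I : finType) (c : I -> R[i])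
  (h : I -> R -> R[i]) : (forall i, S (h i)) ->
  linear_span S (fun t => \sum_(i : I) c i * h i t).
Proof.
move=> Sh; exists #|I|, (fun j => c (enum_val j)), (fun j => h (enum_val j)).
split=> //; apply: funext => t.
by rewrite -[RHS](big_enum_val (fun i => c i * h i t)); apply: eq_bigl.
Qed.

End BishopIterates.

Section QuantitativeApproximation.
Variables (R : realType) (f P : {poly R[i]}) (q r n k : nat).
Variables (alpha K e b theta tau p : R).
Hypotheses (q_gt0 : (0 < q)%N) (coprime_rq : coprime r q) (n_gt0 : (0 < n)%N).
Hypotheses (e_gt0 : 0 < e) (e_le1 : e <= 1) (K_ge1 : 1 <= K).
Hypotheses (fK : coef_norm f <= K)
  (f'K : q%:R * coef_norm f + coef_norm f^`() <= K)
  (PK : coef_norm P <= K) (P'K : coef_norm P^`() <= K).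
Hypotheses (k_gt0 : (0 < k)%N) (k_ge : (q * (q + size f) <= k)%N).
Hypotheses (b_gt0 : 0 < b) (b_le : b <= normc f`_0 ^+ q / q%:R ^+ s_ q).
Hypotheses (theta_ge1 : 1 <= theta) (e_theta : e * theta ^+ (2 * k) <= b).
Hypotheses (p_ge1 : 1 <= p) (tau_ge0 : 0 <= tau).
Let d := (q * n + q - 1)%N.
Hypothesis alpha_near : d%:R * `|alpha - r%:R / q%:R| <= tau.
Implicit Types (s t : R).

Let qR : 0 < q%:R :> R. Proof. by rewrite ltr0n. Qed.
Let nR : 0 < n%:R :> R. Proof. by rewrite ltr0n. Qed.
Let K_ge0 : 0 <= K. Proof. exact: le_trans K_ge1. Qed.
Let W : R := W_ R q.
Let W0 : 0 < W. Proof. exact: W_gt0. Qed.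
Let X : R := det_bound K q.
Let X_ge0 : 0 <= X. Proof. exact: le_trans (det_bound_ge1 _ K_ge1). Qed.

(** Bounds the sum of the moduli of all coefficients of the polynomial in T: q coefficient
    polynomials, each with nodes bounded by q K X / e. *)
Definition coef_bound : R := q%:R * (q%:R * K * X / e * (1 + 2 / W) ^+ n).
Definition lip_bound : R := 3 * q%:R * K * X ^+ 2 / e ^+ 2.

Let coef_bound_ge0 : 0 <= coef_bound.
Proof.
have a0 : 0 <= q%:R * K * X / e by rewrite divr_ge0 ?(ltW e_gt0) // mulr_ge0 // mulr_ge0.
have a1 : 0 <= 1 + 2 / W by rewrite addr_ge0 // divr_ge0 // ltW.
exact: mulr_ge0 (ler0n _ _) (mulr_ge0 a0 (exprn_ge0 _ a1)).
Qed.

Let lip_bound_ge0 : 0 <= lip_bound.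
Proof.
by rewrite divr_ge0 ?exprn_ge0 ?(ltW e_gt0) // !mulr_ge0 // exprn_ge0.
Qed.

Let Y : {poly R[i]} := (W^-1)%:C *: 'X.

Let coefs_exist : exists c : 'I_q -> {poly R[i]}, forall j : 'I_q,
  [/\ (size (c j) <= n.+1)%N,
      coef_norm (c j) <= q%:R * K * X / e * (1 + 2 / W) ^+ n &
      forall s, base_cell q s ->
        normc ((c j).[(period_prod q s)%:C] - coef_fun f P r e j s)
          <= lip_bound / Num.sqrt n%:R].
Proof.
(* The node values are taken where w/W = l/n; beyond n the choice 0 is a mere default. *)
have /choice[nd ndP] l : exists s, (l <= n)%N ->
    base_cell q s /\ period_prod q s = W * (l%:R / n%:R).
  case: (leqP l n) => ln; last by exists 0.
  have [|s ds sE] := @period_prod_ivt R q q_gt0 (W * (l%:R / n%:R)); last by exists s.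
  rewrite mulr_ge0 ?divr_ge0 ?(ltW W0) //= ger_pMr //.
  by rewrite ler_pdivrMr // mul1r ler_nat.
exists (fun j => bernstein Y n (fun l => coef_fun f P r e j (nd l))) => j.
have [bc lc] := bounded_lip_coef_fun r q_gt0 e_gt0 e_le1 K_ge1 fK f'K PK P'K j.
split.
- apply: size_bernstein; rewrite (leq_trans (size_scale_leq _ _)) // size_polyX.
  by [].
- apply: le_trans (@coef_norm_bernstein _ Y n _ (q%:R * K * X / e) _) _.
    by move=> l /ndP[dl _]; apply: bc.
  have a0 : 0 <= q%:R * K * X / e by rewrite divr_ge0 ?(ltW e_gt0) // mulr_ge0 // mulr_ge0.
  rewrite ler_wpM2l //.
  have cX : coef_norm ('X : {poly R[i]}) = 1.
    by have := @coef_normMX R 1; rewrite mul1r coef_normC Normc.normc1.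
  have cY : coef_norm Y = W^-1.
    by rewrite coef_normZ cX mulr1 normc_real ger0_norm // invr_ge0 ltW.
  have cY' : coef_norm (1 - Y) <= 1 + W^-1.
    apply: le_trans (coef_normD _ _) _; rewrite coef_normC Normc.normc1 lerD2l.
    by rewrite -scaleN1r coef_normZ normcN Normc.normc1 mul1r cY.
  rewrite ler_pXn2r ?nnegrE ?addr_ge0 ?coef_norm_ge0 ?divr_ge0 ?(ltW W0) //.
  by rewrite cY; lra.
- move=> s ds; have /andP[w0 wW] := period_prod_itv q_gt0 ds.
  have sn0 : 0 < Num.sqrt n%:R :> R by rewrite sqrtr_gt0.
  have sn2 : Num.sqrt n%:R ^+ 2 = n%:R :> R by rewrite sqr_sqrtr.
  (* The Lipschitz bound is put in quadratic form by y <= 1/(2x) + x y^2 / 2 with x = sqrt n. The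
     constant part and the Bernstein variance then each contribute half of the error. *)
  have -> : lip_bound / Num.sqrt n%:R = lip_bound / Num.sqrt n%:R / 2
      + lip_bound * Num.sqrt n%:R / 2 / n%:R.
    by rewrite -{4}sn2; field; rewrite gt_eqF.
  apply: (@bernstein_approx _ Y n _ _ _ (period_prod q s / W)).
  + by [].
  + by rewrite /Y hornerZ hornerX -rmorphM mulrC.
  + by rewrite divr_ge0 ?(ltW W0) //= ler_pdivrMr // mul1r.
  + by rewrite divr_ge0 // mulr_ge0 // ltW.
  move=> l ln; have [dl lE] := ndP l ln.
  apply: le_trans (lc _ _ dl ds) _; rewrite -/X -/lip_bound.
  have -> : lip_bound / Num.sqrt n%:R / 2 + lip_bound * Num.sqrt n%:R / 2
      * (l%:R / n%:R - period_prod q s / W) ^+ 2 =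
    lip_bound * ((Num.sqrt n%:R)^-1 / 2 + Num.sqrt n%:R / 2
      * (l%:R / n%:R - period_prod q s / W) ^+ 2) by ring.
  rewrite ler_wpM2l //.
  have h : `|nd l - s| <= `|l%:R / n%:R - period_prod q s / W|.
    have /andP[a0 _] := dl; have /andP[b0 _] := ds.
    have := period_prod_slope q_gt0 a0 b0; rewrite lE -/W => h.
    rewrite -(ler_pM2r W0) (le_trans h) //.
    have -> : W * (l%:R / n%:R) - period_prod q s
       = (l%:R / n%:R - period_prod q s / W) * W by field; rewrite !gt_eqF.
    by rewrite normrM (gtr0_norm W0).
  apply: le_trans h _; rewrite -[X in _ + _ * X]real_normK ?num_real //.
  move: `|_ - _ / W| (Num.sqrt n%:R) sn0 => y x x0.
  rewrite -subr_ge0.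
  have -> : x^-1 / 2 + x / 2 * y ^+ 2 - y = (x * y - 1) ^+ 2 / (2 * x).
    by field; rewrite gt_eqF.
  by rewrite divr_ge0 ?sqr_ge0 // mulr_ge0 // ltW.
Qed.

Let bad t : R := \sum_(i < q.+1) (`|t - i%:R / q%:R| <= tau)%R%:R.

Let not_bad t : 0 <= t <= 1 -> (forall i : 'I_q.+1, tau < `|t - i%:R / q%:R|) ->
  [/\ t < 1, (cell_index q t < q)%N & tau < cell_pos q t < q%:R^-1 - tau].
Proof.
move=> /andP[t0 t1] nb.
have t1' : t < 1.
  rewrite lt_neqAle t1 andbT; apply/eqP => tE.
  by have := nb ord_max; rewrite tE /= mulfV ?gt_eqF // subrr normr0 ltNge tau_ge0.
have iq := cell_index_lt q_gt0 t0 t1'.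
split=> //; apply/andP; split.
  have := nb (inord (cell_index q t)); rewrite inordK; last exact: ltnW.
  by rewrite -/(cell_pos q t) ger0_norm // cell_pos_ge0.
have := nb (inord (cell_index q t).+1); rewrite inordK; last exact: iq.
rewrite -natr1 mulrDl mul1r opprD addrA -/(cell_pos q t).
rewrite ler0_norm; last by rewrite subr_le0 ltW // cell_pos_lt.
by lra.
Qed.

(** The drift l (alpha - r/q) is at most tau, while the position in the cell is farther than tau
    from both ends. So the orbit crosses no cell boundary and the fractional part does not jump. *)
Let frac_orbit t (u : 'I_q) l : t < 1 -> 0 <= t -> (start q r u %% q)%N = cell_index q t ->
  tau < cell_pos q t < q%:R^-1 - tau -> (l <= d)%N ->
  `|frac (t + l%:R * alpha) - node q r (start q r u) l (cell_pos q t)| <= tau.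
Proof.
move=> t1 t0 uE /andP[s_gt s_lt] ld; set s := cell_pos q t; set e1 := alpha - r%:R / q%:R.
have le1 : `|l%:R * e1| <= tau.
  rewrite normrM normr_nat (le_trans _ alpha_near) // ler_wpM2r //.
  by rewrite ler_nat.
move/ler_normlP: (le1) => [e1m e1p].
set m := (start q r u + l * r)%N.
have nodeE : node q r (start q r u) l s = s + (m %% q)%:R / q%:R by [].
have mq : (m %% q)%:R / q%:R + q%:R^-1 <= 1 :> R.
  rewrite -{2}[q%:R^-1]mul1r -mulrDl ler_pdivrMr // mul1r natr1 ler_nat.
  exact: ltn_pmod.
have m0 : 0 <= (m %% q)%:R / q%:R :> R by rewrite divr_ge0.
set N := ((cell_index q t + l * r) %/ q)%N.
have tE : t + l%:R * alpha = N%:R + (node q r (start q r u) l s + l%:R * e1).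
  rewrite nodeE /m -modnDml uE.
  have h : (cell_index q t + l * r)%:R = N%:R * q%:R + ((cell_index q t + l * r) %% q)%:R :> R.
    by rewrite {1}(divn_eq (cell_index q t + l * r) q) natrD natrM.
  rewrite natrD natrM in h.
  have {1}-> : t = s + (cell_index q t)%:R / q%:R by rewrite subrK.
  have -> : l%:R * alpha = l%:R * e1 + l%:R * r%:R / q%:R by rewrite /e1; ring.
  have -> : (cell_index q t)%:R = N%:R * q%:R + ((cell_index q t + l * r) %% q)%:R
     - l%:R * r%:R :> R by rewrite -h addrK.
  by field; rewrite gt_eqF.
rewrite (@frac_unique _ _ (node q r (start q r u) l s + l%:R * e1) N).
- by rewrite addrAC subrr add0r.
- by rewrite tE.
- by rewrite nodeE; rewrite /s; lra.
- by rewrite nodeE; rewrite /s; lra.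
Qed.

(** The summands are, in order, the costs of replacing alpha by r/q, of the Bernstein approximation,
    of regularizing the determinant, and of the points within tau of a multiple of 1/q. *)
Let main_value : R := 3 `^ p * ((coef_bound * ((d%:R * coef_norm f + coef_norm f^`()) * tau)) `^ p
    + (q%:R * coef_norm f * (lip_bound / Num.sqrt n%:R)) `^ p
    + coef_norm P `^ p * (15 / theta + 6 / k%:R))
  + (coef_bound * coef_norm f + coef_norm P) `^ p * (q.+1%:R * (2 * tau)).

Lemma bishop_span_approx : exists2 h, linear_span
    (Defs.orbit (bishop alpha) (fun t : R => f.[t%:C])) h &
  uint_le (fun t => normc (P.[t%:C] - h t) `^ p) main_value.
Proof.
have [c cP] := coefs_exist.
(* The power w^l of the j-th coefficient stands for the iterate of order l q, applied after the j-th
   one; the largest exponent is d. *)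
pose idx (kj : 'I_q * 'I_n.+1) : nat := (kj.1 + kj.2 * q)%N.
pose T m := iter m (bishop alpha) (fun t : R => f.[t%:C]).
pose h t := \sum_(kj : 'I_q * 'I_n.+1) (c kj.1)`_kj.2 * T (idx kj) t.
exists h; first by apply: linear_span_fin => kj; exists (idx kj).
have p0 : 0 < p by apply: lt_le_trans p_ge1.
have idx_d kj : (idx kj <= d)%N.
  rewrite /idx /d -addnBA // addnC leq_add //.
    by rewrite mulnC leq_mul2l -ltnS ltn_ord orbT.
  by rewrite -ltnS subn1 prednK.
have sum_c : \sum_(kj : 'I_q * 'I_n.+1) normc (c kj.1)`_kj.2 <= coef_bound.
  rewrite -(pair_bigA _ (fun (j : 'I_q) (l : 'I_n.+1) => normc (c j)`_l)) /=.
  apply: (@le_trans _ _ (\sum_(j < q) q%:R * K * X / e * (1 + 2 / W) ^+ n)).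
    apply: ler_sum => j _; have [cs cn _] := cP j.
    by rewrite -(coef_norm_widen cs).
  by rewrite sumr_const card_ord -[leLHS]mulr_natl /coef_bound.
have weighted (a : nat -> R[i]) (B : R) : (forall m, (m <= d)%N -> normc (a m) <= B) ->
    0 <= B -> normc (\sum_(kj : 'I_q * 'I_n.+1) (c kj.1)`_kj.2 * a (idx kj)) <= coef_bound * B.
  move=> aB B0; apply: le_trans (ler_normc_sum _ _ _) _.
  apply: (@le_trans _ _ ((\sum_(kj : 'I_q * 'I_n.+1) normc (c kj.1)`_kj.2) * B)).
    rewrite mulr_suml ler_sum // => kj _; rewrite Normc.normcM ler_wpM2l ?normc_ge0 //.
    by apply: aB.
  by rewrite ler_wpM2r.
pose D := \det (orbit_poly_mx f q r).
pose E t := e ^+ 2 / (normc D.[(cell_pos q t)%:C] ^+ 2 + e ^+ 2).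
have E01 t : 0 <= E t <= 1.
  have den : 0 < normc D.[(cell_pos q t)%:C] ^+ 2 + e ^+ 2.
    by rewrite ltr_wpDl ?exprn_ge0 ?normc_ge0 ?exprn_gt0.
  rewrite /E divr_ge0 ?exprn_ge0 ?(ltW den) ?(ltW e_gt0) //=.
  by rewrite ler_pdivrMr // mul1r lerDr exprn_ge0 ?normc_ge0.
set a1 := coef_bound * ((d%:R * coef_norm f + coef_norm f^`()) * tau).
set a2 := q%:R * coef_norm f * (lip_bound / Num.sqrt n%:R).
have a1_ge0 : 0 <= a1.
  by rewrite /a1 mulr_ge0 // mulr_ge0 // addr_ge0 ?coef_norm_ge0 // mulr_ge0 ?coef_norm_ge0.
have a2_ge0 : 0 <= a2.
  exact: mulr_ge0 (mulr_ge0 (ler0n _ _) (coef_norm_ge0 _)) (divr_ge0 lip_bound_ge0 (sqrtr_ge0 _)).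
have good t : 0 <= t <= 1 -> (forall i : 'I_q.+1, tau < `|t - i%:R / q%:R|) ->
    normc (P.[t%:C] - h t) <= a1 + a2 + coef_norm P * E t.
  move=> t01 nb; have /andP[t0 _] := t01; have [t1 iq s_itv] := not_bad t01 nb.
  have [u uE] := start_surj q_gt0 coprime_rq iq.
  set s := cell_pos q t in s_itv *.
  have ds : base_cell q s.
    by rewrite /base_cell cell_pos_ge0 //= ltW // cell_pos_lt.
  pose G j := rat_iter f q r j (start q r u) s.
  have GB j : normc (G j) <= coef_norm f.
    rewrite /G /rat_iter Normc.normcM -[leRHS]mul1r ler_pM ?normc_ge0 //.
      apply: unit_normc; apply: (prod_itv (x := fun l => node q r (start q r u) l s)) => l _.
      exact: node_itv.
    by rewrite normc_horner_le // unit_normc // node_itv.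
  have step1 : normc (h t - \sum_(kj : 'I_q * 'I_n.+1) (c kj.1)`_kj.2 * G (idx kj)) <= a1.
    rewrite /h -sumrB.
    under eq_bigr do rewrite -mulrBr.
    apply: (weighted (fun m => T m t - G m)); last first.
      by rewrite mulr_ge0 // addr_ge0 ?coef_norm_ge0 // mulr_ge0 ?coef_norm_ge0.
    move=> m md; rewrite /T iter_bishopE ?t0 // /G /rat_iter.
    have fr01 l : 0 <= frac (t + l%:R * alpha) <= 1 by rewrite frac_ge0 ltW ?frac_lt1.
    apply: le_trans (weighted_value_dist (n := m) (d := tau) _ _ _ _ _ _ _) _.
    - by apply: (prod_itv (x := fun l => frac (t + l%:R * alpha))).
    - apply: (prod_itv (x := fun l => node q r (start q r u) l s)) => l _.
      exact: node_itv.
    - exact: fr01.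
    - exact: node_itv.
    - apply: (prod_dist (x := fun l => frac (t + l%:R * alpha))
         (y := fun l => node q r (start q r u) l s)) => l lm.
      + exact: fr01.
      + exact: node_itv.
      + by apply: frac_orbit => //; apply: leq_trans (ltnW lm) md.
    - by apply: frac_orbit.
    by rewrite ler_wpM2r // lerD2r ler_wpM2r ?coef_norm_ge0 // ler_nat.
  have sumG : \sum_(kj : 'I_q * 'I_n.+1) (c kj.1)`_kj.2 * G (idx kj) =
      \sum_(j < q) (c j).[(period_prod q s)%:C] * G j.
    rewrite -(pair_bigA _ (fun (j : 'I_q) (l : 'I_n.+1) => (c j)`_l * G (j + l * q)%N)) /=.
    apply: eq_bigr => j _; have [cs _ _] := cP j.
    rewrite (horner_coef_wide _ cs) mulr_suml; apply: eq_bigr => l _.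
    by rewrite /G rat_iter_period // rmorphXn mulrA.
  have step2 : normc (\sum_(j < q) (c j).[(period_prod q s)%:C] * G j -
      \sum_(j < q) coef_fun f P r e j s * G j) <= a2.
    rewrite -sumrB; apply: le_trans (ler_normc_sum _ _ _) _.
    have -> : a2 = \sum_(j < q) lip_bound / Num.sqrt n%:R * coef_norm f.
      by rewrite sumr_const card_ord -[RHS]mulr_natl /a2; ring.
    apply: ler_sum => j _; rewrite -mulrBl Normc.normcM.
    apply: ler_pM; rewrite ?normc_ge0 ?GB //.
    by have [_ _ cj] := cP j; exact: cj.
  have step3 : normc (P.[t%:C] - \sum_(j < q) coef_fun f P r e j s * G j) <= coef_norm P * E t.
    rewrite coef_fun_mul // det_orbit_mxE -/D -/(E t).
    have -> : node q r (start q r u) 0 s = t.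
      by rewrite /node mul0n addn0 uE /s subrK.
    have -> : P.[t%:C] - (1 - E t)%:C * P.[t%:C] = (E t)%:C * P.[t%:C].
      by rewrite rmorphB rmorph1; ring.
    have /andP[Et0 _] := E01 t.
    rewrite Normc.normcM normc_real ger0_norm // mulrC ler_wpM2r //.
    by rewrite (le_trans (normc_horner_le _ _)) // unit_normc.
  apply: le_trans (ler_normc_distD (\sum_(j < q) coef_fun f P r e j s * G j) _ _) _.
  rewrite addrC lerD //.
  apply: le_trans (ler_normc_distD (\sum_(j < q) (c j).[(period_prod q s)%:C] * G j) _ _) _.
  by rewrite addrC lerD //; [rewrite normcBC -sumG|rewrite normcBC].
(* On the bad set nothing is compared; its small measure compensates for this bound. *)
have crude t : 0 <= t <= 1 -> normc (P.[t%:C] - h t) <= coef_bound * coef_norm f + coef_norm P.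
  move=> t01; apply: le_trans (ler_normcB _ _) _; rewrite addrC lerD //.
    by apply: (weighted (fun m => T m t)) => [m _|]; rewrite ?coef_norm_ge0 ?normc_iter_bishop.
  by rewrite (le_trans (normc_horner_le _ _)) // unit_normc.
apply: (uint_le_weaken (F1 := fun t => 3 `^ p * (a1 `^ p + a2 `^ p + coef_norm P `^ p * E t)
    + (coef_bound * coef_norm f + coef_norm P) `^ p * bad t) (v1 := main_value)) => //.
  move=> t t01; have bad0 : 0 <= bad t by apply: sumr_ge0.
  have /andP[Et0 Et1] := E01 t.
  have main0 : 0 <= 3 `^ p * (a1 `^ p + a2 `^ p + coef_norm P `^ p * E t).
    apply: mulr_ge0; first exact: powR_ge0.
    by apply: addr_ge0; [apply: addr_ge0; exact: powR_ge0|exact: mulr_ge0 (powR_ge0 _ _) Et0].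
  have [/existsP[i hi]|] := boolP [exists i : 'I_q.+1, `|t - i%:R / q%:R| <= tau].
    have bad1 : 1 <= bad t.
      by rewrite /bad (bigD1 i) //= hi lerDl sumr_ge0.
    rewrite ler_wpDl // (@le_trans _ _ ((coef_bound * coef_norm f + coef_norm P) `^ p)) //.
      rewrite ge0_ler_powR ?nnegrE ?normc_ge0 ?(ltW p0) ?crude //.
      by rewrite addr_ge0 ?coef_norm_ge0 // mulr_ge0 ?coef_norm_ge0.
    by rewrite ler_peMr ?powR_ge0.
  rewrite negb_exists => /forallP nb; rewrite ler_wpDr ?mulr_ge0 ?powR_ge0 //.
  have KE0 : 0 <= coef_norm P * E t by rewrite mulr_ge0 ?coef_norm_ge0.
  apply: (@le_trans _ _ ((a1 + a2 + coef_norm P * E t) `^ p)).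
    rewrite ge0_ler_powR ?nnegrE ?normc_ge0 ?addr_ge0 ?(ltW p0) // good //.
    by move=> i; rewrite ltNge.
  apply: le_trans (powRD3_le (ltW p0) _ _ _) _ => //.
  rewrite ler_wpM2l ?powR_ge0 // lerD2l powRM ?coef_norm_ge0 // ler_wpM2l ?powR_ge0 //.
  (* As 0 <= E <= 1 and p >= 1, the power E^p is at most E, whose integral is what
     [uint_le_small_denominator] controls. *)
  have [->|En0] := eqVneq (E t) 0; first by rewrite powR0 // gt_eqF.
  by rewrite -[leRHS]powRr1 // ger_powR // lt_def En0 Et0 Et1.
apply: uint_le_add; last first.
  apply: uint_le_scale; first exact: powR_ge0.
  apply: (uint_le_weaken (F1 := bad) (v1 := \sum_(i < q.+1) 2 * tau)) => //.
    by rewrite sumr_const card_ord -[leLHS]mulr_natl.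
  by apply: uint_le_sum => i _; apply: uint_le_ball.
apply: uint_le_scale; first exact: powR_ge0.
apply: uint_le_add; first by apply: uint_le_cst => //; rewrite addr_ge0 ?powR_ge0.
apply: uint_le_scale; first exact: powR_ge0.
apply: (@uint_le_small_denominator R q q_gt0 _ k b e theta) => //.
- have sM : forall i j : 'I_q, (size (orbit_poly_mx f q r i j) <= (q + size f).+1)%N.
    move=> i j; rewrite mxE; apply: leq_trans (size_polyMleq _ _) _.
    have s1 : (size (\prod_(l < i) ('X + ((((start q r j + l * r) %% q)%N%:R / q%:R : R)%:C)%:P)
        : {poly R[i]})%R <= i.+1)%N.
      apply: leq_trans (size_poly_prod_leq _ _) _.
      under eq_bigr do rewrite size_XaddC.
      by rewrite sum_nat_const card_ord leq_subLR muln2 -addnn addnS.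
    rewrite size_comp_poly2 ?size_XaddC // -subn1 leq_subLR add1n.
    apply: leq_trans (leq_add s1 (leqnn _)) _.
    by apply: (@leq_trans (q + size f)); [rewrite leq_add2r | do 2 apply: leqW].
  by apply: leq_trans (size_det_leq sM) _; rewrite ltnS.
- apply: le_trans b_le _; apply: le_trans (det_orbit_mx0 f q_gt0 coprime_rq) _.
  by rewrite det_orbit_mxE rmorph0.
Qed.

End QuantitativeApproximation.

(** * Estimates for large denominators *)

Section Asymptotics.
Variables (R : realType) (f P : {poly R[i]}) (p rho : R) (q : nat).
Local Notation Q := (q%:R : R).
Local Notation m := (size f).
Hypotheses (p_gt1 : 1 < p) (q_ge11 : (11 <= q)%N).
Hypotheses (fQ : coef_norm f + coef_norm f^`() <= Q) (f0Q : Q^-1 <= normc f`_0).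
Hypotheses (PQ : coef_norm P <= Q) (P'Q : coef_norm P^`() <= Q).
Hypotheses (rho_gt0 : 0 < rho) (rho_le1 : rho <= 1).
Hypothesis rho_small : 16 * rho * m.+1%:R <= p - 1.
Hypothesis q_large : 4 * (9 + 2 * p) <= (p - 1) * Q.

Let Q_ge11 : 11 <= Q. Proof. by rewrite ler_nat. Qed.
Let Q0 : 0 < Q. Proof. by apply: lt_le_trans Q_ge11. Qed.
Let Q1 : 1 <= Q. Proof. by apply: le_trans Q_ge11; rewrite ler1n. Qed.
Let q_gt0 : (0 < q)%N. Proof. exact: leq_trans q_ge11. Qed.
Let p0 : 0 < p. Proof. exact: lt_trans p_gt1. Qed.

Lemma half_even n : ~~ odd n -> (n %/ 2)%:R = n%:R / 2 :> R.
Proof.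
move=> n_even; by rewrite divn2 -{2}(even_halfK n_even) -muln2 natrM mulfK.
Qed.

Lemma s_E : (s_ q)%:R = Q * (Q - 1) / 2.
Proof.
have e : ~~ odd (q * (q - 1)) by rewrite oddM oddB //= addbT andbN.
by rewrite (half_even e) natrM natrB.
Qed.

Lemma ell_E : (ell_ q)%:R = (Q - 1) * (Q - 2) / 2.
Proof.
have q2 : (2 <= q)%N by apply: leq_trans q_ge11.
have e : ~~ odd ((q - 1) * (q - 2)) by rewrite oddM !oddB //= addbF; case: (odd q).
by rewrite (half_even e) natrM !natrB.
Qed.

(** The value of theta: it tends to infinity with q, yet its power 2 [deg_bound] costs only an
    exponent of order rho q^2. *)
Definition growth : R := Q `^ rho.
Definition deg_bound : nat := (q * (q + m))%N.
(** The largest e allowed by the condition e theta^(2k) <= b. *)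
Definition reg_param : R := b_ f q / growth ^+ (2 * deg_bound).

Lemma growth_ge1 : 1 <= growth.
Proof. by have := @ler_powR R Q Q1 0 rho (ltW rho_gt0); rewrite powRr0. Qed.

Lemma growth_le : growth <= Q.
Proof. by have := @ler_powR R Q Q1 rho 1 rho_le1; rewrite powRr1 // ltW. Qed.

Lemma b_ge : Q `^ (- (Q + (s_ q)%:R)) <= b_ f q.
Proof.
rewrite powRN powRD; last by rewrite (gt_eqF Q0) implybT.
have i0 : 0 <= (Q ^+ s_ q)^-1 by rewrite invr_ge0 exprn_ge0 // ltW.
rewrite !powR_mulrn ?(ltW Q0) // invfM -exprVn /b_ ler_wpM2r //.
by rewrite ler_pXn2r ?nnegrE ?normc_ge0 // invr_ge0 ltW.
Qed.

Lemma b_gt0 : 0 < b_ f q.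
Proof. by apply: lt_le_trans b_ge; rewrite powR_gt0. Qed.

Lemma eps_powR_le : eps_ R q `^ p <= Q `^ (- p).
Proof.
have -> : Q `^ (- p) = Q^-1 `^ p by rewrite -[in RHS]powR_inv1 ?(ltW Q0) // -powRrM mulN1r.
rewrite ge0_ler_powR ?nnegrE ?invr_ge0 ?(ltW p0) ?(ltW Q0) // /eps_ div1r ?invr_ge0 //.
by rewrite lef_pV2 ?posrE ?ltr0n // ler_nat.
Qed.

Lemma eps_powR_le1 : eps_ R q `^ p <= 1.
Proof.
apply: le_trans eps_powR_le _; rewrite powRN invf_le1 ?powR_gt0 //.
by have := @ler_powR R Q Q1 0 p (ltW p0); rewrite powRr0.
Qed.

(** Of the exponent [kappa_] only the part [ell_], quadratic in q, is kept. *)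
Lemma eta_le : eta_ f p q <= b_ f q * Q `^ (- p * (ell_ q)%:R).
Proof.
have b0 := ltW b_gt0.
rewrite /eta_ -mulrA ler_wpM2l //.
have e0 : 0 <= eps_ R q `^ p / 8 by rewrite divr_ge0 ?powR_ge0.
have e1 : eps_ R q `^ p / 8 <= Q `^ (- p).
  by apply: le_trans eps_powR_le; rewrite ler_piMr ?powR_ge0 // invf_le1 // ler1n.
have e2 : eps_ R q `^ p / 8 <= 1.
  by apply: le_trans eps_powR_le1; rewrite ler_piMr ?powR_ge0 // invf_le1 // ler1n.
rewrite powRrM powR_mulrn ?powR_ge0 //.
apply: (@le_trans _ _ ((eps_ R q `^ p / 8) ^+ kappa_ f q)).
  by rewrite ler_piMl ?exprn_ge0 // invf_le1 // ler1n.
apply: (@le_trans _ _ ((eps_ R q `^ p / 8) ^+ ell_ q)).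
  by rewrite ler_wiXn2l // /kappa_ leq_addl.
by rewrite lerXn2r ?nnegrE ?powR_ge0.
Qed.

Lemma eta_gt0 : 0 < eta_ f p q.
Proof.
have e0 : 0 < eps_ R q by rewrite /eps_ divr_gt0 // ltr0n.
apply: mulr_gt0; first exact: divr_gt0 b_gt0 _.
by apply: exprn_gt0; apply: divr_gt0 => //; apply: powR_gt0.
Qed.

Lemma reg_param_gt0 : 0 < reg_param.
Proof. by rewrite divr_gt0 ?b_gt0 // exprn_gt0 // (lt_le_trans ltr01 growth_ge1). Qed.

(* The factor q ^ (8 q) absorbs all other bounds.  This needs p > 1: eta_q is roughly
   q ^ (- (1 + p) q^2 / 2) and reg_param ^ 2 at least roughly q ^ (- (3 + p) q^2 / 4). *)
Lemma eta_reg_param : Q ^+ (8 * q) * eta_ f p q <= reg_param ^+ 2.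
Proof.
have g0 : 0 < growth by apply: lt_le_trans growth_ge1.
have b0 := ltW b_gt0.
rewrite /reg_param expr_div_n ler_pdivlMr ?exprn_gt0 //.
apply: (@le_trans _ _ (b_ f q * (Q ^+ (8 * q) * Q `^ (- p * (ell_ q)%:R)
    * (growth ^+ (2 * deg_bound)) ^+ 2))).
  have G0 : 0 <= (growth ^+ (2 * deg_bound)) ^+ 2 by rewrite sqr_ge0.
  have A0 : 0 <= Q ^+ (8 * q) by rewrite exprn_ge0 // ltW.
  apply: le_trans (ler_wpM2r G0 (ler_wpM2l A0 eta_le)) _.
  by rewrite le_eqVlt; apply/orP; left; apply/eqP; ring.
rewrite [leRHS]expr2 ler_wpM2l //; apply: le_trans b_ge.
rewrite -exprM /growth -!powR_mulrn ?powR_ge0 ?(ltW Q0) // -powRrM.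
rewrite -!powRD ?(gt_eqF Q0) ?implybT //; apply: ler_powR => //.
(* One factor b has been cancelled. What remains is 9q + s_q + 4 rho q (q + m) <= p ell_q: by
   [rho_small] the rho term takes at most (p - 1) q^2 / 4, and by [q_large] the other quarter of (p
   - 1) q^2 covers the linear terms. *)
rewrite s_E ell_E /deg_bound !natrM natrD.
have qm : Q * (Q + m%:R) <= m.+1%:R * Q ^+ 2.
  have Q10 : 0 <= Q - 1 by rewrite subr_ge0.
  have := mulr_ge0 (mulr_ge0 (ltW Q0) (ler0n R m)) Q10; rewrite -natr1; lra.
have : rho * (Q * (Q + m%:R)) * 16 <= (p - 1) * Q ^+ 2.
  have := ler_wpM2l (ltW rho_gt0) qm; have := ler_wpM2r (sqr_ge0 Q) rho_small; lra.
have : 4 * (9 + 2 * p) * Q <= (p - 1) * Q * Q by rewrite ler_wpM2r // ltW.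
have := mulr_ge0 (ltW p0) (ltW Q0); move: p_gt1 Q_ge11; lra.
Qed.

Let B0E : B0 f = coef_norm f.
Proof. by rewrite /B0 big_mkord. Qed.

Let B1E : B1 f = coef_norm f^`().
Proof.
rewrite (@coef_norm_widen _ f^`() m.-1) ?size_deriv_leq //.
rewrite /B1 big_add1 big_mkord; apply: eq_bigr => i _.
by rewrite coef_deriv -[in RHS]mulr_natl Normc.normcM normc_natr.
Qed.

Let cf_ge0 : 0 <= coef_norm f. Proof. exact: coef_norm_ge0. Qed.
Let cf'_ge0 : 0 <= coef_norm f^`(). Proof. exact: coef_norm_ge0. Qed.

Let f0_le : normc f`_0 <= coef_norm f.
Proof.
rewrite /coef_norm; case E : m => [|l].
  by rewrite (size0nil E) big_ord0 nth_nil Normc.normc0.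
by rewrite big_ord_recl lerDl sumr_ge0 // => i _; apply: normc_ge0.
Qed.

Let fQ' : coef_norm f <= Q. Proof. by apply: le_trans fQ; rewrite lerDl. Qed.

Let cf_ge : Q^-1 <= coef_norm f. Proof. exact: le_trans f0Q f0_le. Qed.

Let cfX_ge : (Q ^+ q)^-1 <= coef_norm f ^+ q.
Proof. by rewrite -exprVn ler_pXn2r ?nnegrE // invr_ge0 ltW. Qed.

Lemma reg_param_le1 : reg_param <= 1.
Proof.
apply: (@le_trans _ _ (b_ f q)).
  by rewrite ler_pdivrMr ?exprn_gt0 ?(lt_le_trans ltr01 growth_ge1) // ler_peMr ?(ltW b_gt0) // exprn_ege1 // growth_ge1.
rewrite /b_ ler_pdivrMr ?exprn_gt0 // mul1r.
apply: (@le_trans _ _ (Q ^+ q)).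
  by rewrite ler_pXn2r ?nnegrE ?normc_ge0 ?(ltW Q0) // (le_trans f0_le).
rewrite ler_weXn2l // -(ler_nat R) s_E; move: Q_ge11; move: Q => x; nra.
Qed.

Let e0 := reg_param_gt0.
Let eta0 := eta_gt0.

Lemma eta_pow_le j : (j <= 8 * q)%N -> Q ^+ j * eta_ f p q <= reg_param ^+ 2.
Proof.
move=> j8; apply: le_trans eta_reg_param.
by rewrite ler_wpM2r ?(ltW eta0) // ler_weXn2l.
Qed.

Let X_le : det_bound (Q ^+ 2) q <= Q ^+ (3 * q + 2).
Proof.
have h1 : q`!%:R <= Q ^+ q.
  rewrite -natrX ler_nat fact_prod; apply: (@leq_trans (\prod_(1 <= i < q.+1) q)).
    by rewrite !big_add1 /= !big_mkord; apply: leq_prod => i _; apply: ltn_ord.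
  by rewrite prod_nat_const_nat subn1.
have h2 : q.+1%:R <= Q ^+ 2 by rewrite -natr1; move: Q_ge11; move: Q => x; nra.
rewrite /det_bound -exprM.
have -> : Q ^+ (3 * q + 2) = Q ^+ q * Q ^+ 2 * Q ^+ (2 * q).
  have -> : (3 * q + 2 = q + 2 + 2 * q)%N by rewrite addnAC -mulSn.
  by rewrite !exprD.
by rewrite !ler_pM ?mulr_ge0 ?exprn_ge0 // ltW.
Qed.

Let UB0_ge : (Q ^+ q)^-1 <= coef_norm f * U_ f q.
Proof.
apply: le_trans cfX_ge _; rewrite /U_ B0E -{1}(prednK q_gt0) exprS subn1.
rewrite ler_wpM2l // ler_peMl ?exprn_ge0 // ler1n fact_gt0 //.
Qed.

Let U_gt0 : 0 < U_ f q.
Proof.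
by rewrite mulr_gt0 ?exprn_gt0 // ?ltr0n ?fact_gt0 // B0E (lt_le_trans _ cf_ge) // invr_gt0.
Qed.

Let U_ge : (Q ^+ q.+1)^-1 <= U_ f q.
Proof.
rewrite exprS invfM mulrC ler_pdivrMr // (le_trans UB0_ge) // mulrC.
by rewrite ler_wpM2l // ltW.
Qed.

Let R_ge : (Q ^+ q)^-1 <= R_ f q.
Proof.
apply: le_trans cfX_ge _; rewrite /R_ /J_ B0E B1E -{1}(prednK q_gt0) exprS subn1.
rewrite ler_wpM2r ?exprn_ge0 //.
have h1 : 1 <= q`!%:R * Q by rewrite -natrM ler1n muln_gt0 fact_gt0.
have h2 : coef_norm f <= Q * coef_norm f + coef_norm f^`().
  by rewrite ler_wpDr // ler_peMl.
apply: le_trans h2 _; rewrite ler_peMl // addr_ge0 // mulr_ge0 // ltW.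
Qed.

Let L_ge : U_ f q * R_ f q / eta_ f p q ^+ 2 <= L_ f p q.
Proof.
have U0 := ltW U_gt0; have h0 := ltW eta0.
have R0 : 0 <= R_ f q by apply: le_trans R_ge; rewrite invr_ge0 exprn_ge0 // ltW.
have J0 : 0 <= J_ f q by rewrite /J_ B0E B1E addr_ge0 // mulr_ge0 // ltW.
have t1 : 0 <= H_ f p q / cutoff_ p q.
  by rewrite /H_ /cutoff_ !divr_ge0 ?powR_ge0 // mulr_ge0.
have t2 : 0 <= V_ f q / eta_ f p q.
  have pi0 : 0 <= pi :> R by apply: pi_ge0.
  rewrite divr_ge0 // /V_ B0E mulr_ge0 // addr_ge0 //.
    by rewrite mulr_ge0 ?exprn_ge0 // mulr_ge0.
  by rewrite mulr_ge0 ?exprn_ge0 // mulr_ge0.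
have t3 : 0 <= U_ f q * R_ f q / eta_ f p q ^+ 2.
  by rewrite divr_ge0 ?exprn_ge0 // mulr_ge0.
have -> : L_ f p q = H_ f p q / cutoff_ p q + V_ f q / eta_ f p q
   + 2 * (U_ f q * R_ f q / eta_ f p q ^+ 2) by rewrite /L_ !mulrA.
lra.
Qed.

(** The logarithm in [N_] is at least 1, its argument being at least exp 1. *)
Let N_ge : Lambda_ f p q <= (N_ f p q)%:R.
Proof.
have l1 : 1 <= Lambda_ f p q by rewrite /Lambda_ le_max lexx.
have ln1 : 1 <= ln (4 * Lambda_ f p q + expR 1).
  rewrite -[leLHS](expRK 1) ler_ln ?posrE ?expR_gt0 //.
    by rewrite lerDr mulr_ge0 // (le_trans _ l1).
  by rewrite addr_gt0 ?expR_gt0 // mulr_gt0 // (lt_le_trans _ l1).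
have h : Lambda_ f p q <= 4 * Lambda_ f p q * ln (4 * Lambda_ f p q + expR 1).
  by move: l1 ln1; move: (Lambda_ _ _ _) (ln _) => x y; nra.
apply: le_trans h _; apply: le_trans (ceil_ge _) _.
by rewrite /N_ natr_absz ler_int ler_norm.
Qed.

Let N_gt0 : (0 < N_ f p q)%N.
Proof.
rewrite -(ltr_nat R); apply: lt_le_trans N_ge.
by rewrite /Lambda_ lt_max ltr01.
Qed.

Let eps0 : 0 < eps_ R q. Proof. by rewrite /eps_ divr_gt0 // ltr0n. Qed.

(** Only the last summand of [L_] carries 1 / eta^2; the factor pi q / eps in [Lambda_] is at least
    1 and is dropped. *)
Let UR_N : coef_norm f * U_ f q * R_ f q / eta_ f p q ^+ 2 <= (N_ f p q)%:R.
Proof.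
apply: le_trans N_ge; rewrite /Lambda_ le_max; apply/orP; right.
have R0 : 0 <= R_ f q by apply: le_trans R_ge; rewrite invr_ge0 exprn_ge0 // ltW.
have UR0 : 0 <= U_ f q * R_ f q / eta_ f p q ^+ 2.
  by rewrite divr_ge0 ?exprn_ge0 ?(ltW eta0) // mulr_ge0 // ltW.
have L0 : 0 <= L_ f p q by apply: le_trans L_ge.
have pi1 : 1 <= pi :> R by apply: le_trans (pi_ge2 R); rewrite ler1n.
have piq : 1 <= pi * Q.
  by apply: le_trans pi1 _; rewrite ler_peMr // pi_ge0.
have ie : 1 <= (eps_ R q)^-1 by rewrite /eps_ div1r invrK ler1n.
apply: (@le_trans _ _ (coef_norm f * L_ f p q)).
  apply: le_trans (ler_wpM2l cf_ge0 L_ge); rewrite le_eqVlt; apply/orP; left.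
  by apply/eqP; ring.
rewrite B0E ler_pdivlMr // -[leRHS]mulrA -[leLHS]mulr1.
have h : 0 <= coef_norm f * L_ f p q by rewrite mulr_ge0.
have e1 : eps_ R q <= 1 by rewrite /eps_ div1r invf_le1 ?ler1n ?ltr0n.
rewrite mulr1; apply: (@le_trans _ _ (coef_norm f * L_ f p q)).
  by rewrite ler_piMr.
by rewrite ler_peMl.
Qed.

(** Both B0 U and R are at least |f(0)|^q >= q^(-q), so N is at least q^(-2q) / eta^2. *)
Let sqrtN_ge : (Q ^+ q)^-1 / eta_ f p q <= Num.sqrt (N_ f p q)%:R.
Proof.
have i0 : 0 <= (Q ^+ q)^-1 by rewrite invr_ge0 exprn_ge0 // ltW.
have l0 : 0 <= (Q ^+ q)^-1 / eta_ f p q by rewrite divr_ge0 // ltW.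
rewrite -(ger0_norm l0) -sqrtr_sqr; apply: ler_wsqrtr; apply: le_trans UR_N.
rewrite expr_div_n ler_wpM2r ?invr_ge0 ?exprn_ge0 ?(ltW eta0) //.
by rewrite expr2 ler_pM.
Qed.

Let K_ge1 : 1 <= Q ^+ 2. Proof. by rewrite exprn_ege1. Qed.

Let lip_small : Q * coef_norm f * (lip_bound q (Q ^+ 2) reg_param
   / Num.sqrt (N_ f p q)%:R) <= Q^-1.
Proof.
set e := reg_param; set h := eta_ f p q; set X := det_bound (Q ^+ 2) q.
have X0 : 0 <= X by apply: le_trans (det_bound_ge1 q K_ge1).
have h0 : 0 < h := eta0.
have sN : 0 < Num.sqrt (N_ f p q)%:R :> R by rewrite sqrtr_gt0 ltr0n.
have isN : (Num.sqrt (N_ f p q)%:R)^-1 <= Q ^+ q * h :> R.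
  have Qh : 0 < Q ^+ q * h by exact: mulr_gt0 (exprn_gt0 _ Q0) h0.
  by rewrite -[leRHS]invrK lef_pV2 ?posrE ?invr_gt0 // invfM.
have X2 : X ^+ 2 <= Q ^+ (6 * q + 4).
  have -> : (6 * q + 4 = (3 * q + 2) * 2)%N by rewrite mulnDl mulnAC.
  by rewrite exprM ler_pXn2r ?nnegrE ?exprn_ge0 ?X_le // ltW.
have key : Q ^+ (7 * q + 11) * h <= e ^+ 2.
  (* The exponent collects X^2 (6q + 4), 1/sqrt N (q) and seven further powers; 7q + 11 <= 8q
     explains the threshold 11. *)
  by apply: eta_pow_le; rewrite [(8 * q)%N]mulSn addnC leq_add2r.
have e2 : 0 < e ^+ 2 by rewrite exprn_gt0 // reg_param_gt0.
rewrite /lip_bound -/X -/e.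
have -> : Q * coef_norm f * (3 * Q * Q ^+ 2 * X ^+ 2 / e ^+ 2 / Num.sqrt (N_ f p q)%:R)
  = coef_norm f * 3 * (X ^+ 2 * (Num.sqrt (N_ f p q)%:R)^-1 * Q ^+ 4) / e ^+ 2.
  by rewrite !exprS expr0; ring.
rewrite ler_pdivrMr // ler_pdivlMl //.
apply: le_trans key.
have -> : Q ^+ (7 * q + 11) * h = Q ^+ 2 * Q ^+ 3 * (Q ^+ (6 * q + 4) * (Q ^+ q * h)) * Q ^+ 2.
  have -> : (7 * q + 11 = 2 + 3 + (6 * q + 4 + q) + 2)%N.
    by rewrite mulSn addnAC; ring.
  by rewrite !exprD; ring.
have -> : Q * (coef_norm f * 3 * (X ^+ 2 * (Num.sqrt (N_ f p q)%:R)^-1 * Q ^+ 4))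
  = coef_norm f * 3 * Q ^+ 3 * (X ^+ 2 * (Num.sqrt (N_ f p q)%:R)^-1) * Q ^+ 2.
  by rewrite !exprS expr0; ring.
have Q00 := ltW Q0; have Q3 : 3 <= Q by apply: le_trans Q_ge11; rewrite ler_nat.
apply: ler_wpM2r; first exact: exprn_ge0.
apply: ler_pM.
- by rewrite mulr_ge0 ?exprn_ge0 // mulr_ge0.
- by rewrite mulr_ge0 ?exprn_ge0 // invr_ge0 ltW.
- by rewrite ler_wpM2r ?exprn_ge0 // expr2 ler_pM.
- by rewrite ler_pM ?exprn_ge0 // invr_ge0 ltW.
Qed.

(** It suffices that q K X / e <= H = U / eta. This is easy since e is at least e^2, which exceeds
    eta by q^(8q), while U is no smaller than q^(-q-1). *)
Let coef_bound_le : coef_bound q (N_ f p q) (Q ^+ 2) reg_param <= C_ f p q.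
Proof.
have Q00 := ltW Q0.
set e := reg_param; set h := eta_ f p q; set X := det_bound (Q ^+ 2) q.
have X0 : 0 <= X by apply: le_trans (det_bound_ge1 q K_ge1).
have h0 : 0 < h := eta0; have e0' : 0 < e := e0.
have w0 : 0 <= (W_ R q)^-1 by rewrite invr_ge0 ltW // W_gt0.
rewrite /coef_bound /C_ -/X -/e.
have key : Q ^+ (4 * q + 6) * h <= e.
  apply: (@le_trans _ _ (e ^+ 2)).
    apply: eta_pow_le; rewrite -[8%N]/(4 + 4)%N mulnDl leq_add2l.
    by rewrite (leq_trans (_ : (6 <= 1 * 11)%N)) // leq_mul.
  by rewrite expr2 ler_piMr ?(ltW e0') // reg_param_le1.
have H0 : 0 <= H_ f p q by rewrite /H_ divr_ge0 ?(ltW U_gt0) // ltW.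
have main : Q * Q ^+ 2 * X / e <= H_ f p q.
  rewrite /H_ -/h ler_pdivrMr // [leRHS]mulrAC ler_pdivlMr //.
  apply: (@le_trans _ _ (Q * Q ^+ 2 * Q ^+ (3 * q + 2) * h)).
    by rewrite ler_wpM2r ?(ltW h0) // ler_wpM2l ?X_le // mulr_ge0 ?exprn_ge0.
  apply: (@le_trans _ _ ((Q ^+ q.+1)^-1 * e)); last by rewrite ler_wpM2r ?(ltW e0').
  rewrite ler_pdivlMl ?exprn_gt0 //; apply: le_trans key.
  have -> : (4 * q + 6 = q.+1 + (1 + 2 + (3 * q + 2)))%N.
    by rewrite mulSn addSn addnA; ring.
  by rewrite !exprD expr1 !mulrA.
have gam : (1 + 2 / W_ R q) ^+ N_ f p q <= Gamma_ R q ^+ N_ f p q.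
  rewrite lerXn2r ?nnegrE /Gamma_ ?addr_ge0 ?mulr_ge0 //.
  by rewrite lerD ?ler1n // ler_wpM2r // ler_nat.
have g0 : 0 <= (1 + 2 / W_ R q) ^+ N_ f p q.
  by rewrite exprn_ge0 // addr_ge0 // mulr_ge0.
have N1 : 1 <= (N_ f p q)%:R :> R by rewrite ler1n.
have m0 : 0 <= Q * Q ^+ 2 * X / e by rewrite divr_ge0 ?(ltW e0') // mulr_ge0 // mulr_ge0 // exprn_ge0.
apply: le_trans (ler_wpM2l Q00 (ler_pM m0 g0 main gam)) _.
have regroup (u v w x : R) : 3 * u * v * w * x = u * (v * x) * (3 * w) by ring.
rewrite regroup ler_peMr //; last by rewrite -natrM ler1n muln_gt0.
exact: mulr_ge0 Q00 (mulr_ge0 H0 (le_trans g0 gam)).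
Qed.

Let A_ge : coef_norm f + coef_norm f^`() <= A_ f p.
Proof.
rewrite /A_ B0E B1E lerD //.
  rewrite ler_peMl //.
  have := @ler_powR R 2 (ler1n _ 2) 0 p^-1; rewrite powRr0; apply.
  by rewrite invr_ge0 ltW.
have pw (x y : R) : 0 <= x -> 0 <= y -> x <= (x `^ p + y) `^ p^-1.
  move=> x0 y0; have xE : x = (x `^ p) `^ p^-1 by rewrite -powRrM mulfV ?gt_eqF // powRr1.
  rewrite {1}xE ge0_ler_powR ?nnegrE ?powR_ge0 ?addr_ge0 ?powR_ge0 ?lerDl //.
  by rewrite invr_ge0 ltW.
by apply: pw; rewrite ?powR_ge0.
Qed.

Let d_ge : Q <= (d_ f p q)%:R.
Proof.
rewrite ler_nat /d_ -addnBA // (@leq_trans (q * N_ f p q)) ?leq_addr //.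
by rewrite leq_pmulr.
Qed.

Let cb0 : 0 <= coef_bound q (N_ f p q) (Q ^+ 2) reg_param.
Proof.
have w0 : 0 <= 1 + 2 / W_ R q by rewrite addr_ge0 // divr_ge0 // ltW // W_gt0.
have X0 : 0 <= det_bound (Q ^+ 2) q by apply: le_trans (det_bound_ge1 q K_ge1).
apply: mulr_ge0 => //; apply: mulr_ge0; last exact: exprn_ge0.
by rewrite divr_ge0 ?(ltW e0) // mulr_ge0 // mulr_ge0 // exprn_ge0.
Qed.

Let C_ge0 : 0 <= C_ f p q. Proof. exact: le_trans cb0 coef_bound_le. Qed.

(** Makes the denominator of [delta_] positive, and lets the norm of P be absorbed into a multiple
    of (A C)^p. *)
Let AC_ge1 : 1 <= A_ f p * C_ f p q.
Proof.
have h0 := ltW eta0; have U0 := ltW U_gt0.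
have Qq : 0 <= Q ^+ q by rewrite exprn_ge0 // ltW.
have eq1 : eta_ f p q <= (Q ^+ q)^-1.
  rewrite -[leRHS]mul1r ler_pdivlMr ?exprn_gt0 // mulrC.
  apply: (@le_trans _ _ (reg_param ^+ 2)); first by apply: eta_pow_le; apply: leq_pmull.
  by rewrite exprn_ile1 ?reg_param_le1 // ltW // e0.
have UH : 1 <= coef_norm f * H_ f p q.
  by rewrite /H_ mulrA ler_pdivlMr // mul1r (le_trans eq1) // UB0_ge.
have Gam : 1 <= Gamma_ R q.
  by rewrite /Gamma_ ler_wpDr ?ler1n // divr_ge0 // ltW // W_gt0.
have H0 : 0 <= H_ f p q by rewrite /H_ divr_ge0.
have HC : H_ f p q <= C_ f p q.
  have regroup (u v w x : R) : 3 * u * v * w * x = v * (3 * u * w * x) by ring.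
  rewrite /C_ regroup ler_peMr // mulr_ege1 ?exprn_ege1 // mulr_ege1 ?ler1n //.
  by rewrite mulr_ege1 // ler1n.
apply: le_trans UH _; rewrite ler_pM //.
by apply: le_trans A_ge; rewrite lerDl.
Qed.

Lemma delta_gt0 : 0 < delta_ f p q.
Proof.
have dpos : 0 < (d_ f p q)%:R :> R by apply: lt_le_trans d_ge.
have A0 : 0 <= A_ f p by apply: le_trans A_ge; rewrite addr_ge0.
have Ap : 0 < A_ f p.
  rewrite lt_def A0 andbT; apply: contraTneq AC_ge1 => ->.
  by rewrite mul0r -ltNge ltr01.
have Cp : 0 < C_ f p q.
  rewrite lt_def C_ge0 andbT; apply: contraTneq AC_ge1 => ->.
  by rewrite mulr0 -ltNge ltr01.
rewrite /delta_ lt_min; apply/andP; split; first by apply: divr_gt0; rewrite ?mulr_gt0.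
apply: divr_gt0; first exact: powR_gt0.
by apply: mulr_gt0; rewrite ?powR_gt0 //; apply: mulr_gt0; rewrite ?mulr_gt0 ?powR_gt0.
Qed.

(** Instance of [bishop_span_approx] with K = q^2, which exceeds all norms of f and P once q does,
    and with tau = d |alpha - r/q|. Each of its four terms is a constant over [growth]. *)
Lemma bishop_span_approx_le (r : nat) (alpha : R) : coprime r q ->
  `|alpha - r%:R / Q| <= delta_ f p q ->
  exists2 h, linear_span (Defs.orbit (bishop alpha) (fun t : R => f.[t%:C])) h &
    uint_le (fun t => normc (P.[t%:C] - h t) `^ p)
      ((3 `^ p * (2 + 21 * coef_norm P `^ p) + 2 `^ p * (1 + coef_norm P `^ p)) / growth).
Proof.
move=> cop near; set x := `|_| in near.
have Q00 := ltW Q0; have x0 : 0 <= x by apply: normr_ge0.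
have P2 : coef_norm P <= Q ^+ 2 by apply: le_trans PQ _; rewrite expr2 ler_peMl.
have P'2 : coef_norm P^`() <= Q ^+ 2 by apply: le_trans P'Q _; rewrite expr2 ler_peMl.
have f2 : coef_norm f <= Q ^+ 2 by apply: le_trans fQ' _; rewrite expr2 ler_peMl.
have f'2 : Q * coef_norm f + coef_norm f^`() <= Q ^+ 2.
  apply: (@le_trans _ _ (Q * (coef_norm f + coef_norm f^`()))).
    by rewrite mulrDr lerD2l ler_peMl.
  by rewrite expr2 ler_wpM2l.
have k0 : (0 < deg_bound)%N by rewrite /deg_bound muln_gt0 q_gt0 addn_gt0 q_gt0.
have eth : reg_param * growth ^+ (2 * deg_bound) <= b_ f q.
  by rewrite /reg_param divfK // gt_eqF // exprn_gt0 // (lt_le_trans ltr01 growth_ge1).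
pose d := d_ f p q; have d_ge' : Q <= d%:R := d_ge.
have dpos : 0 < d%:R :> R by apply: lt_le_trans d_ge'.
have d1 : 1 <= d%:R :> R by apply: le_trans d_ge'.
pose tau := d%:R * x; have tau0 : 0 <= tau by rewrite mulr_ge0 // ltW.
have [h hspan hle] := @bishop_span_approx R f P q r (N_ f p q) deg_bound alpha (Q ^+ 2)
  reg_param (b_ f q) growth tau p q_gt0 cop N_gt0 e0 reg_param_le1 K_ge1 f2 f'2 P2 P'2
  k0 (leqnn _) b_gt0 (lexx _) growth_ge1 eth (ltW p_gt1) tau0 (lexx _).
exists h => //; apply: uint_le_weaken hle => //.
move: near; rewrite /delta_ le_min => /andP[x_d x_amp].
set G := coef_norm P `^ p; have G0 : 0 <= G by apply: powR_ge0.
set Z := (A_ f p * C_ f p q) `^ p.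
have A0 : 0 <= A_ f p by apply: le_trans A_ge; rewrite addr_ge0.
have Z1 : 1 <= Z by have := @ler_powR R _ AC_ge1 0 p (ltW p0); rewrite powRr0.
have tau_le : tau <= 1.
  move: x_d; rewrite ler_pdivlMr ?mulr_gt0 // => x_d; rewrite /tau; lra.
(* The second entry of the minimum in [delta_], with one factor d of d^(p+1) moved into tau; the
   first entry gave tau <= 1. *)
have Zx : Z * (d%:R `^ p * tau) <= eps_ R q `^ p / 2.
  move: x_amp; rewrite -/d.
  have dp : d%:R `^ (p + 1) = d%:R `^ p * d%:R :> R.
    by rewrite powRD ?powRr1 ?(ltW dpos) // (gt_eqF dpos) implybT.
  rewrite dp -[2 * _ * _]mulrA -powRM // -/Z.
  have D0 : 0 < 2 * Z * (d%:R `^ p * d%:R).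
    by rewrite !mulr_gt0 ?powR_gt0 // (lt_le_trans ltr01).
  rewrite ler_pdivlMr // ler_pdivlMr // => /(le_trans _); apply.
  by rewrite /tau le_eqVlt; apply/orP; left; apply/eqP; ring.
have epsQ : eps_ R q `^ p <= Q^-1.
  apply: le_trans eps_powR_le _; rewrite powRN lef_pV2 ?posrE ?powR_gt0 //.
  by have := @ler_powR R Q Q1 1 p (ltW p_gt1); rewrite powRr1.
have Qg : Q^-1 <= growth^-1.
  by rewrite lef_pV2 ?posrE ?growth_le // (lt_le_trans ltr01 growth_ge1).
have gi0 : 0 <= growth^-1 by rewrite invr_ge0 (le_trans ler01 growth_ge1).
have T1 : (coef_bound q (N_ f p q) (Q ^+ 2) reg_param *
    ((d%:R * coef_norm f + coef_norm f^`()) * tau)) `^ p <= growth^-1.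
  apply: (@le_trans _ _ ((A_ f p * C_ f p q * (d%:R * tau)) `^ p)).
    have dB : d%:R * coef_norm f + coef_norm f^`() <= A_ f p * d%:R.
      apply: (@le_trans _ _ ((coef_norm f + coef_norm f^`()) * d%:R)).
        by rewrite mulrDl mulrC lerD2l ler_peMr.
      by rewrite ler_wpM2r // ltW.
    have B0' : 0 <= d%:R * coef_norm f + coef_norm f^`().
      by rewrite addr_ge0 // mulr_ge0 // ltW.
    have dt0 : 0 <= d%:R * tau by rewrite mulr_ge0 // ltW.
    rewrite ge0_ler_powR ?nnegrE ?(ltW p0) //.
    - exact: mulr_ge0 cb0 (mulr_ge0 B0' tau0).
    - exact: mulr_ge0 (mulr_ge0 A0 C_ge0) dt0.
    have -> : A_ f p * C_ f p q * (d%:R * tau) = C_ f p q * (A_ f p * d%:R * tau) by ring.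
    apply: ler_pM => //; first exact: mulr_ge0 B0' tau0.
    exact: ler_wpM2r.
  have ac0 : 0 <= A_ f p * C_ f p q by rewrite mulr_ge0.
  have dt0 : 0 <= d%:R * tau by rewrite mulr_ge0 // ltW.
  rewrite (powRM p ac0 dt0) -/Z (powRM p (ltW dpos) tau0).
  apply: (@le_trans _ _ (Z * (d%:R `^ p * tau))).
    (* Since tau <= 1, tau^p is at most tau. *)
    rewrite ler_wpM2l ?(le_trans ler01 Z1) // ler_wpM2l ?powR_ge0 //.
    have [->|tn0] := eqVneq tau 0; first by rewrite powR0 // gt_eqF.
    by rewrite -[leRHS]powRr1 // ger_powR ?(ltW p_gt1) // lt_def tn0 tau0 tau_le.
  apply: le_trans Zx _; apply: le_trans (le_trans epsQ Qg).
  by rewrite ler_piMr ?powR_ge0 // invf_le1 // ler1n.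
have T2 : (Q * coef_norm f * (lip_bound q (Q ^+ 2) reg_param
   / Num.sqrt (N_ f p q)%:R)) `^ p <= growth^-1.
  have l0 : 0 <= lip_bound q (Q ^+ 2) reg_param.
    by rewrite /lip_bound divr_ge0 ?exprn_ge0 ?(ltW e0) // !mulr_ge0 // ?exprn_ge0 // ?sqr_ge0.
  have a0 : 0 <= Q * coef_norm f * (lip_bound q (Q ^+ 2) reg_param / Num.sqrt (N_ f p q)%:R).
    exact: mulr_ge0 (mulr_ge0 Q00 cf_ge0) (divr_ge0 l0 (sqrtr_ge0 _)).
  have Qi0 : 0 <= Q^-1 by rewrite invr_ge0.
  apply: (@le_trans _ _ (Q^-1 `^ p)); first by rewrite ge0_ler_powR ?nnegrE ?(ltW p0) // lip_small.
  apply: le_trans _ Qg; rewrite -[leRHS]powRr1 // ger_powR ?(ltW p_gt1) //.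
  by rewrite invr_gt0 Q0 invf_le1.
have T3 : G * (15 / growth + 6 / deg_bound%:R) <= 21 * G / growth.
  have : deg_bound%:R^-1 <= growth^-1.
    apply: le_trans _ Qg; rewrite lef_pV2 ?posrE ?ltr0n // ler_nat /deg_bound.
    by rewrite leq_pmulr // addn_gt0 q_gt0.
  move: (deg_bound%:R^-1) => y yg.
  have -> : 21 * G / growth = G * (15 / growth + 6 * growth^-1) by ring.
  by rewrite ler_wpM2l // lerD2l ler_wpM2l.
have T4 : (coef_bound q (N_ f p q) (Q ^+ 2) reg_param * coef_norm f + coef_norm P) `^ p
    * (q.+1%:R * (2 * tau)) <= 2 `^ p * (1 + G) / growth.
  have cb_le : coef_bound q (N_ f p q) (Q ^+ 2) reg_param * coef_norm f <= A_ f p * C_ f p q.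
    rewrite mulrC; apply: ler_pM cf_ge0 cb0 _ coef_bound_le.
    by apply: le_trans A_ge; rewrite lerDl.
  have ac0 : 0 <= A_ f p * C_ f p q by rewrite mulr_ge0.
  have cbf0 : 0 <= coef_bound q (N_ f p q) (Q ^+ 2) reg_param * coef_norm f.
    exact: mulr_ge0 cb0 cf_ge0.
  apply: (@le_trans _ _ (2 `^ p * (Z + G) * (q.+1%:R * (2 * tau)))).
    have t0 : 0 <= q.+1%:R * (2 * tau) by rewrite mulr_ge0 // mulr_ge0.
    apply: ler_wpM2r => //; apply: le_trans (_ : (A_ f p * C_ f p q + coef_norm P) `^ p <= _).
      rewrite ge0_ler_powR ?nnegrE ?(ltW p0) ?lerD2r //.
      - by rewrite addr_ge0 // coef_norm_ge0.
      - by rewrite addr_ge0 // coef_norm_ge0.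
    by rewrite powRD_le ?(ltW p0) // coef_norm_ge0.
  have ZG : Z + G <= (1 + G) * Z.
    by rewrite mulrDl mul1r lerD2l ler_peMr.
  have qe : q.+1%:R * eps_ R q `^ p <= 1.
    have -> : q.+1%:R = (eps_ R q)^-1 by rewrite /eps_ div1r invrK.
    rewrite mulrC ler_pdivrMr // mul1r -[leRHS]powRr1 ?(ltW eps0) //.
    by rewrite ger_powR ?(ltW p_gt1) // eps0 /eps_ div1r invf_le1 ?ler1n ?ltr0n.
  (* The factor d^p >= q is left over here and supplies the decay; the q + 1 bad intervals are paid
     for by (q + 1) eps^p <= 1. *)
  have Zt : Z * tau <= eps_ R q `^ p / 2 * Q^-1.
    have dpQ : Q <= d%:R `^ p.
      apply: le_trans d_ge' _.
      by have := @ler_powR R _ d1 1 p (ltW p_gt1); rewrite powRr1 // ltW.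
    rewrite ler_pdivlMr // (le_trans _ Zx) // -mulrA ler_wpM2l ?(le_trans ler01 Z1) //.
    by rewrite mulrC ler_wpM2r.
  have twop : 0 <= 2 `^ p :> R by apply: powR_ge0.
  apply: (@le_trans _ _ (2 `^ p * ((1 + G) * (q.+1%:R * (2 * (Z * tau)))))).
    have -> : 2 `^ p * ((1 + G) * (q.+1%:R * (2 * (Z * tau)))) =
      2 `^ p * ((1 + G) * Z) * (q.+1%:R * (2 * tau)) by ring.
    rewrite ler_wpM2r //; first by rewrite mulr_ge0 // mulr_ge0.
    by rewrite ler_wpM2l.
  rewrite -[leRHS]mulrA ler_wpM2l // ler_wpM2l ?addr_ge0 //.
  apply: le_trans _ Qg; apply: (@le_trans _ _ (q.+1%:R * eps_ R q `^ p * Q^-1)).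
    have -> : q.+1%:R * eps_ R q `^ p * Q^-1 = q.+1%:R * (2 * (eps_ R q `^ p / 2 * Q^-1)).
      by field; rewrite gt_eqF.
    by rewrite ler_wpM2l // ler_wpM2l.
  by rewrite ler_piMl // invr_ge0.
have -> : (3 `^ p * (2 + 21 * G) + 2 `^ p * (1 + G)) / growth =
    3 `^ p * (growth^-1 + growth^-1 + 21 * G / growth) + 2 `^ p * (1 + G) / growth by ring.
rewrite lerD // ler_wpM2l ?powR_ge0 // lerD // lerD //.
Qed.

End Asymptotics.

(** * Cyclicity *)

Section ComplexMeasurability.
Variable R : realType.
Implicit Types (g h : R -> R[i]) (D : set R).

Definition complex_measurable D g :=
  measurable_fun D (fun t => complex.Re (g t)) /\
  measurable_fun D (fun t => complex.Im (g t)).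

Lemma complex_measurable_cst D c : complex_measurable D (fun _ => c).
Proof. by split; apply: measurable_cst. Qed.

Lemma complex_measurableD D g h : complex_measurable D g -> complex_measurable D h ->
  complex_measurable D (fun t => g t + h t).
Proof.
move=> [gr gi] [hr hi]; split.
- have -> : (fun t => complex.Re (g t + h t)) =
    (fun t => complex.Re (g t) + complex.Re (h t)).
    by apply: funext => t; case: (g t) (h t) => a b [].
  exact: measurable_funD.
- have -> : (fun t => complex.Im (g t + h t)) =
    (fun t => complex.Im (g t) + complex.Im (h t)).
    by apply: funext => t; case: (g t) (h t) => a b [].
  exact: measurable_funD.
Qed.

Lemma complex_measurableM D g h : complex_measurable D g -> complex_measurable D h ->
  complex_measurable D (fun t => g t * h t).
Proof.
move=> [gr gi] [hr hi]; split.
- have -> : (fun t => complex.Re (g t * h t)) = (fun t =>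
    complex.Re (g t) * complex.Re (h t) - complex.Im (g t) * complex.Im (h t)).
    by apply: funext => t; case: (g t) (h t) => a b [].
  by apply: measurable_funB; apply: measurable_funM.
- have -> : (fun t => complex.Im (g t * h t)) = (fun t =>
    complex.Re (g t) * complex.Im (h t) + complex.Im (g t) * complex.Re (h t)).
    by apply: funext => t; case: (g t) (h t) => a b [].
  by apply: measurable_funD; apply: measurable_funM.
Qed.

Lemma complex_measurable_real D : measurable D -> complex_measurable D (fun t => t%:C).
Proof. by move=> mD; split; [apply: measurable_id|apply: measurable_cst]. Qed.

Lemma complex_measurable_sum D n (F : 'I_n -> R -> R[i]) :
  (forall i, complex_measurable D (F i)) ->
  complex_measurable D (fun t => \sum_(i < n) F i t).
Proof.
elim: n F => [|n IH] F mF.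
  by under eq_fun do rewrite big_ord0; exact: complex_measurable_cst.
under eq_fun do rewrite big_ord_recl.
by apply: complex_measurableD => //; apply: IH.
Qed.

Lemma complex_measurable_poly D (P : {poly R[i]}) : measurable D ->
  complex_measurable D (fun t => P.[t%:C]).
Proof.
move=> mD; elim/poly_ind: P => [|P c IH].
  by under eq_fun do rewrite horner0; exact: complex_measurable_cst.
under eq_fun do rewrite hornerD hornerMX hornerC.
apply: complex_measurableD (complex_measurable_cst _ _).
exact: complex_measurableM IH (complex_measurable_real mD).
Qed.

Lemma measurable_frac D (a : R) : measurable_fun D (fun t => frac (t + a)).
Proof.
apply: (measurable_funS measurableT) => //.
apply: measurable_funB; first exact: measurable_funD.
apply: nondecreasing_measurable => // x y xy.
by rewrite ler_int le_floor // lerD2r.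
Qed.

(** Stated on the whole line, so that composing with the shifted fractional part raises no question
    of range. *)
Lemma complex_measurable_iter (alpha : R) (f : {poly R[i]}) m :
  complex_measurable setT (iter m (bishop alpha) (fun t => f.[t%:C])).
Proof.
elim: m => [|m [IHr IHi]] /=; first exact: complex_measurable_poly.
apply: complex_measurableM; first exact: complex_measurable_real.
by split; [apply: (measurableT_comp IHr)|apply: (measurableT_comp IHi)]; exact: measurable_frac.
Qed.

Lemma complex_measurable_span (alpha : R) (f : {poly R[i]}) h :
  linear_span (Defs.orbit (bishop alpha) (fun t => f.[t%:C])) h ->
  complex_measurable setT h.
Proof.
move=> [n [c [g [gS ->]]]]; apply: complex_measurable_sum => i.
apply: complex_measurableM (complex_measurable_cst _ _) _.
by have [m _ <-] := gS i; exact: complex_measurable_iter.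
Qed.

Lemma complex_measurable_sub D g h : complex_measurable D g ->
  complex_measurable D h -> measurable_fun D (fun t => normc (g t - h t)).
Proof.
move=> mg mh; have [r i] : complex_measurable D (fun t => g t - h t).
  have -> : (fun t => g t - h t) = (fun t => g t + (-1) * h t).
    by apply: funext => t; rewrite mulN1r.
  by apply: complex_measurableD => //; apply: complex_measurableM.
exact: measurable_normc.
Qed.

End ComplexMeasurability.

Section Assembly.
Variables (R : realType) (p : R) (f : {poly R[i]}) (alpha : R).
Hypothesis p_gt1 : 1 < p.
Local Notation F := (fun t : R => f.[t%:C]).
Local Notation I01 := (`[0%R : R, 1%R]%classic).
Local Notation mu := (@lebesgue_measure R).
Let p0 : 0 < p. Proof. exact: lt_trans p_gt1. Qed.

Lemma cyclic_vector_of_poly_approx :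
  (forall (P : {poly R[i]}) (e : R), 0 < e ->
     exists2 h, linear_span (Defs.orbit (bishop alpha) F) h &
       uint_le (fun t => normc (P.[t%:C] - h t) `^ p) e) ->
  cyclic_vector p (bishop alpha) F.
Proof.
move=> approx; split.
  have [mr mi] := complex_measurable_poly f (measurable_itv `[0 : R, 1]).
  split => //; rewrite Lp_normE ?gt_eqF //.
  suff : (\int[mu]_(t in I01) (normc (F t) `^ p)%:E <= (coef_norm f `^ p)%:E)%E.
    have := integral_powR_ge0 p F.
    by case: (\int[mu]_(t in I01) _)%E => [x| |] //= _ _; rewrite ltry.
  apply: integral_le_uint.
  - by apply: measurableT_comp (measurable_powR _) _; apply: measurable_normc.
  - by move=> t _; apply: powR_ge0.
  apply: uint_le_cst => [|t t01]; first exact: powR_ge0.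
  rewrite ge0_ler_powR ?nnegrE ?normc_ge0 ?coef_norm_ge0 ?(ltW p0) //.
  by rewrite normc_horner_le // unit_normc.
apply/seteqP; split=> [g [] //|g Lg]; split=> // e e0.
have twop : 0 < 2 `^ p :> R by apply: powR_gt0.
(* Two such errors, times the 2^p of [powRD_le], add up to e^p / 2; the remaining half makes the
   norm inequality strict. *)
have v0 : 0 < e `^ p / 4 / 2 `^ p by rewrite !divr_gt0 ?powR_gt0.
have [P gP] := Lp_poly_dense (ltW p_gt1) Lg v0.
have [h hS Ph] := approx P _ v0; exists h => //.
have half : e `^ p / 2 < e `^ p by rewrite ltr_pdivrMr // ltr_pMr ?powR_gt0 // ltr1n.
apply: (Lp_norm_lt p0 e0 half); have [mr mi _] := Lg.
have mh : complex_measurable I01 h.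
  by have [hr hi] := complex_measurable_span hS; split; apply: measurable_funTS.
apply: integral_le_uint.
- apply: measurableT_comp (measurable_powR _) _.
  exact: (complex_measurable_sub (conj mr mi) mh).
- by move=> t _; apply: powR_ge0.
apply: uint_le_weaken (uint_le_scale (ltW twop) (uint_le_add gP Ph)).
- move=> t _; apply: le_trans (powRD_le (ltW p0) (normc_ge0 _) (normc_ge0 _)).
  rewrite ge0_ler_powR ?nnegrE ?addr_ge0 ?normc_ge0 ?(ltW p0) //.
  exact: ler_normc_distD.
- rewrite le_eqVlt; apply/orP; left; apply/eqP; field.
  by rewrite gt_eqF.
Qed.

(** Only the threshold depends on P and e, while [delta_] does not. Hence one gap condition, met for
    arbitrarily large n, handles all targets. *)
Lemma bishop_span_eventually : f.[0] != 0 -> forall (P : {poly R[i]}) (e : R), 0 < e ->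
  exists q0 : nat, forall q : nat, (q0 <= q)%N -> 0 < delta_ f p q /\
    forall r : nat, coprime r q -> `|alpha - r%:R / q%:R| <= delta_ f p q ->
    exists2 h, linear_span (Defs.orbit (bishop alpha) F) h &
      uint_le (fun t => normc (P.[t%:C] - h t) `^ p) e.
Proof.
move=> f0 P e e0; set m := size f.
pose rho : R := Num.min 1 ((p - 1) / (16 * m.+1%:R)).
have p10 : 0 < p - 1 by rewrite subr_gt0.
have rho0 : 0 < rho by rewrite lt_min ltr01 divr_gt0 // mulr_gt0.
have rho1 : rho <= 1 by rewrite ge_min lexx.
have rho_s : 16 * rho * m.+1%:R <= p - 1.
  have : rho <= (p - 1) / (16 * m.+1%:R) by rewrite ge_min lexx orbT.
  by rewrite ler_pdivlMr ?mulr_gt0 //; lra.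
pose M := (3 `^ p * (2 + 21 * coef_norm P `^ p) + 2 `^ p * (1 + coef_norm P `^ p)).
have M0 : 0 <= M.
  by rewrite addr_ge0 // mulr_ge0 ?powR_ge0 // addr_ge0 ?mulr_ge0 ?powR_ge0.
have nf0 : 0 < normc f`_0.
  rewrite lt_def normc_ge0 andbT; apply: contraNneq f0 => /Normc.eq0_normc.
  by rewrite horner_coef0 => ->.
(* A sum of all lower bounds wanted for q; the last term makes M / q^rho at most e. *)
pose B : R := (coef_norm f + coef_norm f^`()) + (normc f`_0)^-1 + coef_norm P
  + coef_norm P^`() + 4 * (9 + 2 * p) / (p - 1) + (M / e) `^ rho^-1.
have c1 := coef_norm_ge0 f; have c2 := coef_norm_ge0 f^`().
have c3 := coef_norm_ge0 P; have c4 := coef_norm_ge0 P^`().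
have c5 : 0 <= (normc f`_0)^-1 by rewrite invr_ge0 normc_ge0.
have c6 : 0 <= 4 * (9 + 2 * p) / (p - 1).
  by rewrite divr_ge0 ?(ltW p10) // mulr_ge0 // addr_ge0 // mulr_ge0 // ltW.
have c7 : 0 <= (M / e) `^ rho^-1 by apply: powR_ge0.
have BB : B < (Num.bound B)%:R.
  by apply: archi_boundP; rewrite /B !addr_ge0.
exists (11 + Num.bound B)%N => q qq.
have q11 : (11 <= q)%N by apply: leq_trans qq; apply: leq_addr.
have qB : B <= q%:R.
  by apply: le_trans (ltW BB) _; rewrite ler_nat (leq_trans _ qq) // leq_addl.
have q0 : 0 < q%:R :> R by rewrite ltr0n (leq_trans _ q11).
have le6 (x1 x2 x3 x4 x5 x6 z : R) : 0 <= x1 -> 0 <= x2 -> 0 <= x3 -> 0 <= x4 -> 0 <= x5 ->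
    0 <= x6 -> x1 + x2 + x3 + x4 + x5 + x6 <= z ->
    [/\ x1 <= z, x2 <= z, x3 <= z, x4 <= z & x5 <= z /\ x6 <= z].
  by move=> *; split; [| | | |split]; lra.
have [h1 h2' h3 h4 [h5' h6]] := le6 _ _ _ _ _ _ _ (addr_ge0 c1 c2) c5 c3 c4 c6 c7 qB.
have h2 : q%:R^-1 <= normc f`_0.
  by rewrite -[leRHS]invrK lef_pV2 ?posrE ?invr_gt0 //.
have h5 : 4 * (9 + 2 * p) <= (p - 1) * q%:R.
  by rewrite [leRHS]mulrC -ler_pdivrMr.
split; first exact: (delta_gt0 p_gt1 q11 h1 h2 rho0 rho_s h5).
move=> r cop near.
have [h hS hP] := bishop_span_approx_le p_gt1 q11 h1 h2 h3 h4 rho0 rho1 rho_s h5 cop near.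
exists h => //; apply: uint_le_weaken hP => //; rewrite -/M.
have g0 : 0 < @growth R rho q by rewrite /growth powR_gt0.
rewrite ler_pdivrMr // mulrC -ler_pdivrMr //.
have Me0 : 0 <= M / e by rewrite divr_ge0 // ltW.
have -> : M / e = ((M / e) `^ rho^-1) `^ rho.
  by rewrite -powRrM mulVf ?powRr1 // gt_eqF.
by rewrite /growth ge0_ler_powR ?nnegrE ?powR_ge0 // ltW.
Qed.

End Assembly.

Theorem theorem11 (R : realType) (p : R) (f : {poly R[i]}) (alpha : R)
    (p_gt1 : 1 < p) (f0_neq0 : f.[0] != 0)
    (alpha_gt0 : 0 < alpha) (alpha_lt1 : alpha < 1)
    (alpha_irr : irrational alpha)
    (large_gap : forall N : nat, exists n : nat, (N <= n)%N /\
       psi f p (convergent alpha n).2 < ((convergent alpha n.+1).2)%:R) :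
  cyclic_vector p (bishop alpha) (fun t : R => f.[t%:C]).
Proof.
apply: cyclic_vector_of_poly_approx => // P e e0.
have [q0 hq0] := @bishop_span_eventually R p f alpha p_gt1 f0_neq0 P e e0.
(* The 2 excludes q = 1, where [psi] is 1 instead of 1 / (q delta). *)
have [n [n_ge]] := large_gap (maxn 2 q0).
have q_ge := leq_trans n_ge (convergent_ge alpha_gt0 alpha_irr n).
have cop := convergent_coprime alpha_gt0 n.
have near := convergent_approx alpha_gt0 alpha_irr n.
have q'0 := convergent_gt0 alpha_irr n.+1.
move: q_ge cop near q'0; move: (convergent alpha n) ((convergent alpha n.+1).2).
move=> [r q] q' /= q_ge cop near q'0 gap.
rewrite geq_max in q_ge; case/andP: q_ge => q2 qq0.
have [d0 approx] := hq0 q qq0.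
apply: (approx r cop); apply: le_trans near _.
have qR : 0 < q%:R :> R by rewrite ltr0n ltnW.
have q'R : 0 < q'%:R :> R by rewrite ltr0n.
(* With q' the next denominator, q' > 1 / (q delta) amounts to 1 / (q q') < delta. *)
move: gap; rewrite /psi gtn_eqF // => gap.
rewrite ltr_pdivrMr ?mulr_gt0 // in gap.
by rewrite -[_^-1]div1r ler_pdivrMr ?mulr_gt0 // mulrC mulrAC mulrC ltW.
Qed.
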